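(* Let $X$ be a CB process with branching mechanism $\Phi$ given by $(\alpha,\beta,\pi)$, with $\pi\neq0$, and let $x>0$. For all $t\in(0,\infty)$ and $r\in(0,\infty)$, $$\mathbf{P}_x\left[\sup_{s\in(0,t]}\Delta X_s\le r\right]=\exp\left(-x\,u^{(r,\infty)}_t(\pi(r,\infty))\right)$$ and $$\mathbf{P}_x\left[\sup_{s\in(0,t]}\Delta X_s<r\right]=\exp\left(-x\,u^{[r,\infty)}_t(\pi[r,\infty))\right),$$ where, for $A=(r,\infty)$ and $A=[r,\infty)$ respectively and $\lambda\ge0$, $u^A_t(\lambda)$ is the unique locally bounded nonnegative solution of $$u^A_t(\lambda)=-\int_0^t\Phi^A(u^A_s(\lambda))\,ds+\int_0^t\lambda\,ds,$$ with $$\Phi^A(\lambda)=\left(\alpha+\int_A\theta\,\pi(d\theta)\right)\lambda+\beta\lambda^2+\int_{(0,\infty)\setminus A}(e^{-\lambda\theta}-1+\lambda\theta)\,\pi(d\theta).$$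
   Context: A branching mechanism is a function $\Phi(\lambda)=\alpha\lambda+\beta\lambda^2+\int_{(0,\infty)}(e^{-\lambda\theta}-1+\lambda\theta)\,\pi(d\theta)$, $\lambda\ge0$, with $\alpha\in\mathbb{R}$, $\beta\ge0$ and $\pi$ a $\sigma$-finite measure on $(0,\infty)$ (the Lévy measure) with $\int_{(0,\infty)}(\theta\wedge\theta^2)\,\pi(d\theta)<\infty$; the case $\Phi\equiv0$ is excluded. A CB process with branching mechanism $\Phi$ is an rcll $[0,\infty)$-valued Markov process $X=(X_t)_{t\ge0}$ such that, writing $\mathbf{P}_x$ for its law when $X_0=x$ and $\mathbf{E}_x$ for the expectation, $\mathbf{E}_x[e^{-\lambda X_t}]=e^{-xv_t(\lambda)}$ for $\lambda\ge0$, where $v_t(\lambda)$ is the unique locally bounded nonnegative solution of $v_t(\lambda)=\lambda-\int_0^t\Phi(v_s(\lambda))\,ds$. $\Delta X_s=X_s-X_{s-}$ for $s>0$. *)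

(* Defs.v *)
From HB Require Import structures.
From mathcomp Require Import all_boot all_order all_algebra.
From mathcomp Require Import all_classical all_reals all_analysis.
From mathcomp Require Import measurable_realfun.
Set Implicit Arguments.
Unset Strict Implicit.
Unset Printing Implicit Defensive.
Import Order.TTheory GRing.Theory Num.Theory.
Import numFieldNormedType.Exports.
Local Open Scope classical_set_scope.
Local Open Scope ring_scope.

Section Mechanism.
Context {R : realType}.
Implicit Types (alpha beta lam : R) (A : set R).
Implicit Type nu : {sigma_finite_measure set (measurableTypeR R) -> \bar R}.

Definition branching_mechanism alpha beta nu lam : R :=
  alpha * lam + beta * lam ^+ 2 +
  \int[nu]_(theta in `]0, +oo[) (expR (- lam * theta) - 1 + lam * theta).

(* Measures on (0, oo) are represented by measures on the real line that do not
   charge ]-oo, 0]. *)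
Definition is_branching_triple alpha beta nu : Prop :=
  [/\ 0 <= beta,
      nu `]-oo, 0]%classic = 0%E,
      (\int[nu]_(theta in `]0%R, +oo[) (Num.min theta (theta ^+ 2))%:E < +oo)%E
    & exists2 lam, 0 <= lam & branching_mechanism alpha beta nu lam != 0].

Definition truncated_mechanism alpha beta nu A lam : R :=
  (alpha + \int[nu]_(theta in A) theta) * lam + beta * lam ^+ 2 +
  \int[nu]_(theta in `]0, +oo[ `\` A)
    (expR (- lam * theta) - 1 + lam * theta).

End Mechanism.

Section IntegralEquation.
Context {R : realType}.
Implicit Types (Phi g f : R -> R) (t : R).

(* Locally bounded nonnegative solutions on [0, oo[ of
   f t = g t - \int_0^t Phi (f s) ds; values at negative times are irrelevant.
   The library's integral is total, so the existence of the integral is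
   required explicitly. *)
Definition is_solution Phi g f : Prop :=
  [/\ forall t, 0 <= t -> 0 <= f t,
      forall t, 0 <= t -> [bounded f s | s in `[0, t]],
      forall t, 0 <= t ->
        lebesgue_measure.-integrable `[0, t] (fun s => (Phi (f s))%:E)
    & forall t, 0 <= t ->
        f t = g t - \int[lebesgue_measure]_(s in `[0, t]) Phi (f s)].

Definition is_unique_solution Phi g f : Prop :=
  is_solution Phi g f /\
  forall f', is_solution Phi g f' -> forall t, 0 <= t -> f' t = f t.

End IntegralEquation.

Section Process.
Context {R : realType} {d : measure_display} {T : measurableType d}.
(* Time is [0, oo[ inside R, and so is the state space: P x matters only for
   x >= 0 and X t only for t >= 0. *)
Implicit Types (P : R -> probability T R) (X : R -> T -> R) (x s t lam : R).

Definition rcll X : Prop :=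
  forall w,
    (forall t, 0 <= t -> X s w @[s --> t^'+] --> X t w) /\
    (forall t, 0 < t -> cvg (X s w @[s --> t^'-])).

Definition jump X (s : R) (w : T) : R := X s w - lim (X u w @[u --> s^'-]).

Definition sup_jump X (t : R) (w : T) : \bar R :=
  ereal_sup [set (jump X s w)%:E | s in `]0, t]].

Definition natural_filtration X (s : R) : set (set T) :=
  <<s \bigcup_(u in `[0, s]) preimage_set_system setT (X u) measurable >>.

(* Time-homogeneous Markov process with laws (P x)_{x >= 0}: the last clause
   says that P_x(X_{s+t} \in B | F_s) = P_{X_s}(X_t \in B). *)
Definition is_markov P X : Prop :=
  [/\ forall t, 0 <= t -> measurable_fun setT (X t) /\ forall w, 0 <= X t w,
      forall x, 0 <= x -> P x (X 0 @^-1` [set x]) = 1%E,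
      forall (t : R) (B : set R), 0 <= t -> measurable B ->
        measurable_fun (`[0, +oo[%classic : set R)
          (fun x => P x (X t @^-1` B))
    & forall (x s t : R) (A : set T) (B : set R),
        0 <= x -> 0 <= s -> 0 <= t ->
        natural_filtration X s A -> measurable B ->
        P x (A `&` X (s + t) @^-1` B) =
          (\int[P x]_(w in A) P (X s w) (X t @^-1` B))%E].

Definition is_CB alpha beta
    (nu : {sigma_finite_measure set (measurableTypeR R) -> \bar R}) P X : Prop :=
  [/\ is_branching_triple alpha beta nu,
      rcll X,
      is_markov P X
    & exists v : R -> R -> R,
        (forall lam, 0 <= lam ->
           is_unique_solution (branching_mechanism alpha beta nu)
             (fun=> lam) (v ^~ lam)) /\
        (forall x t lam, 0 <= x -> 0 <= t -> 0 <= lam ->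
           'E_(P x)[fun w => expR (- lam * X t w)]%E =
             (expR (- x * v t lam))%:E)].

End Process.

Arguments is_CB {R d T} alpha beta nu P X.

(* Main.v *)
(* Cut [0, t] into n intervals of length h = t / n and ask that every increment of
   X over these intervals be at most c. For rcll paths these events lie, in the
   limit, between {sup jump < c} and {sup jump <= c}. Let u solve
   u' = pi(A) - Phi^A(u) with u_0 = kappa > 0. Inserting the factors
   exp(-u_{t-kh} X_{kh}) and telescoping over k, the Markov property reduces the
   probability of the n-th event, damped by exp(-kappa X_t), to
     E_y[exp(-u_s X_h); X_h - y <= c] - exp(-y u_{s+h}) = o(h) + error from pi near c,
   uniformly in y and s. Since Phi^A(l) - pi(A) = Phi(l) - int_A e^{-l z} pi(dz), this
   says that increments exceeding c occur at rate y pi(c, oo). That rate comes from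
   Laplace transforms alone: second differences of l -> E_y[exp(-l X_h)] give the
   small-time behaviour of (1 - e^{-z})^2 e^{-jz} for all j, and polynomials in e^{-z}
   approximate the indicator of z > c up to the weight (1 - e^{-z})^2. The damping
   keeps u bounded away from 0, which gives uniformity in y; at the end c tends to r
   and kappa tends to 0. *)
Require Import Defs.
From HB Require Import structures.
From mathcomp Require Import all_boot all_order all_algebra.
From mathcomp Require Import all_classical all_reals all_analysis.
From mathcomp Require Import measurable_realfun giry.
From mathcomp Require Import ring lra.
Set Implicit Arguments.
Unset Strict Implicit.
Unset Printing Implicit Defensive.
Import Order.TTheory GRing.Theory Num.Theory.
Import numFieldNormedType.Exports.
Local Open Scope classical_set_scope.
Local Open Scope ring_scope.

(** * Elementary bounds on the exponential, and Gronwall *)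

(** Errors are summed over n steps started from random, unbounded states, so each must be small
    against h whatever the state [y]. Expanding in h costs powers of [y], which [expR (- (c * y))]
    absorbs only for c > 0; hence a lower bound c0 of u on [0, t], which degenerates as kappa
    vanishes. This dictates the order of the limits: first n, then c to r, and kappa last. The
    weight (1 - e^{-z})^2 is forced by pi, which may have infinite mass near 0 and need only
    integrate z^2 there. The term in beta survives the second difference as a mass 2 beta at z = 0,
    so the approximating polynomials must also be small at e^{-0} = 1. The two formulas differ when
    pi has an atom at r. The jump sizes on which A and the test by c may disagree lie in a set B
    containing c: ]r, r + dl] for A = ]r, oo[, and ]r - dl, r[ for A = [r, oo[. Both shrink to the
    empty set and never contain r, so pi(B) tends to 0 in either case. *)

Section RealBounds.
Context {R : realType}.
Implicit Types a b c m x y s t z M L T D C : R.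

Lemma expR_sub_le a b : expR (- a) - expR (- b) <= expR (- a) * (b - a).
Proof.
have -> : expR (- b) = expR (- a) * expR (a - b) by rewrite -expRD; congr expR; ring.
rewrite -{1}[expR (- a)]mulr1 -mulrBr ler_wpM2l ?expR_ge0//.
by have := expR_ge1Dx (a - b); lra.
Qed.

Lemma expR_lipschitz m a b : m <= a -> m <= b ->
  `|expR (- a) - expR (- b)| <= expR (- m) * `|a - b|.
Proof.
wlog ab : a b / a <= b => [hw ma mb|ma mb].
  have [ab|/ltW ba] := leP a b; first exact: hw.
  by rewrite distrC (distrC a); exact: hw.
rewrite ger0_norm ?subr_ge0 ?ler_expR ?lerN2//.
rewrite (distrC a) (@ger0_norm _ (b - a)) ?subr_ge0//.
apply: (le_trans (expR_sub_le a b)).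
by rewrite ler_wpM2r ?subr_ge0// ler_expR lerN2.
Qed.

(** By convexity the error of the tangent at [b] is nonnegative and at most the product of the
    increments of the exponential and of its argument; the Lipschitz bound then yields the square.
    The factor [expR (- m)] is kept in order to beat powers of the state later. *)
Lemma expR_taylor1 m a b : m <= a -> m <= b ->
  `|expR (- a) - expR (- b) * (1 - (a - b))| <= expR (- m) * (a - b) ^+ 2.
Proof.
move=> ma mb; have h1 := expR_sub_le b a; have h2 := expR_sub_le a b.
have h3 := expR_lipschitz ma mb.
rewrite ger0_norm; last by nra.
apply: (@le_trans _ _ ((expR (- b) - expR (- a)) * (a - b))); first by nra.
apply: (le_trans (ler_norm _)); rewrite normrM distrC.
by rewrite -(@real_normK _ (a - b)) ?num_real// expr2 mulrA ler_wpM2r.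
Qed.

Lemma id_expR_le c y : 0 < c -> y * expR (- (c * y)) <= c^-1.
Proof.
move=> c0; rewrite expRN ler_pdivrMr ?expR_gt0// ler_pdivlMl//.
by have := expR_ge1Dx (c * y); lra.
Qed.

(** [id_expR_le] at half the rate, squared. In both bounds [y] plays the initial state: they turn
    the powers of [y] left by Taylor expansions into constants. *)
Lemma sqr_expR_le c y : 0 < c -> 0 <= y ->
  y ^+ 2 * expR (- (c * y)) <= 4 / c ^+ 2.
Proof.
move=> c0 y0; have c20 : 0 < c / 2 by rewrite divr_gt0.
have -> : y ^+ 2 * expR (- (c * y)) = (y * expR (- (c / 2 * y))) ^+ 2.
  by rewrite exprMn -expRM_natr; congr (_ * expR _); field.
have -> : 4 / c ^+ 2 = ((c / 2)^-1) ^+ 2 by field; rewrite gt_eqF.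
by rewrite ler_pXn2r// ?nnegrE ?mulr_ge0 ?invr_ge0 ?expR_ge0 ?(ltW c20)// id_expR_le.
Qed.

Lemma le_expR_self x : x <= expR x.
Proof. by have := expR_ge1Dx x; lra. Qed.

Lemma expR_remainder_ge0 x : 0 <= expR (- x) - 1 + x.
Proof. by have := expR_ge1Dx (- x); lra. Qed.

(** The derivative in s is z (1 - e^{-sz}), at most z and at most C z^2; the factor 1 + C serves
    both. The minimum of z and z^2 is what the Levy measure integrates. *)
Lemma expR_remainder_lipschitz (C s t : R) (z : R) :
  0 <= s <= C -> 0 <= t <= C -> 0 <= z ->
  `|(expR (- s * z) - 1 + s * z) - (expR (- t * z) - 1 + t * z)| <=
    (1 + C) * `|s - t| * Num.min z (z ^+ 2).
Proof.
wlog st : s t / s <= t => [hw hs ht z0|/andP[s0 sC] /andP[t0 tC] z0].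
  have [st|/ltW ts] := leP s t; first exact: hw.
  by rewrite distrC (distrC s); exact: hw.
rewrite !mulNr.
have sz : 0 <= s * z by rewrite mulr_ge0.
have tz : 0 <= t * z by rewrite mulr_ge0.
have h1 := @expR_sub_le (s * z) (t * z).
have h2 : expR (- (t * z)) <= expR (- (s * z)) by rewrite ler_expR lerN2 ler_wpM2r.
have h3 : expR (- (t * z)) >= 1 - t * z by have := expR_ge1Dx (- (t * z)); lra.
have h4 := @expR_sub_le (t * z) (s * z).
have h5 : expR (- (s * z)) <= 1 by rewrite expR_le1 oppr_le0.
have d0 : 0 <= t - s by lra.
have dz : 0 <= (t - s) * z by rewrite mulr_ge0.
have h6 : 0 <= (1 - expR (- (s * z))) * ((t - s) * z).
  by rewrite mulr_ge0// subr_ge0.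
rewrite ler0_norm; last by lra.
rewrite (distrC s) (@ger0_norm _ (t - s)) ?subr_ge0//.
have C0 : 0 <= C by lra.
rewrite minElt; case: ifP => _.
  have : 0 <= C * ((t - s) * z) by rewrite mulr_ge0.
  lra.
have tzC : t * z <= C * z by rewrite ler_wpM2r.
have : (t - s) * z * (1 - expR (- (t * z))) <= (t - s) * z * (C * z).
  by rewrite ler_wpM2l//; lra.
have : 0 <= (t - s) * z ^+ 2 by rewrite mulr_ge0 ?sqr_ge0.
lra.
Qed.

Lemma halving_limit a M x : (forall n, x <= (a + M / 2 ^+ n)) -> x <= a.
Proof.
move=> h; have : (fun n : nat => a + M / 2 ^+ n) @ \oo --> (a + M * 0 : R).
  apply: cvgD; first exact: cvg_cst.
  apply: cvgM; first exact: cvg_cst.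
  have := @cvg_geometric R 1 (2^-1); rewrite /geometric /=.
  under eq_fun do rewrite mul1r exprVn.
  by apply; rewrite ger0_norm; lra.
rewrite mulr0 addr0 => cv.
rewrite -(cvg_lim _ cv)//; apply: limr_ge; first by apply/cvg_ex; eexists; exact: cv.
by apply: nearW => n; exact: h.
Qed.

(* Gronwall's inequality, up to a factor 2, by repeatedly halving an a priori
   bound of the form M * exp(2Ls). *)
Lemma gronwall (L T D a : R) (delta : R -> R) : 0 < L -> 0 <= a ->
  (forall t, 0 <= t <= T -> delta t <= D) ->
  (forall M t, 0 <= M -> 0 <= t <= T ->
     (forall s, 0 <= s <= t -> delta s <= M * expR (2 * L * s)) ->
     delta t <= a + M / 2 * expR (2 * L * t)) ->
  forall t, 0 <= t <= T -> delta t <= 2 * a * expR (2 * L * t).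
Proof.
move=> L0 a0 bD step.
have e1 t : 0 <= t -> 1 <= expR (2 * L * t).
  by move=> t0; rewrite -expR0 ler_expR !mulr_ge0// ltW.
pose D' := `|D|.
have D'0 : 0 <= D' by exact: normr_ge0.
(* The map sending M to a + M / 2 has the fixed point 2a and halves the distance to it, so n rounds
   reduce the excess over 2a to [D' / 2 ^+ n]. *)
have key n : forall t, 0 <= t <= T ->
    delta t <= (2 * a + D' / 2 ^+ n) * expR (2 * L * t).
  elim: n => [t tT|n ih t tT].
    rewrite expr0 divr1; have := bD _ tT; have := ler_norm D.
    have /andP[t0 _] := tT; have := e1 _ t0.
    by rewrite -/D'; nra.
  have := step (2 * a + D' / 2 ^+ n) t; rewrite addr_ge0 ?divr_ge0 ?exprn_ge0 ?mulr_ge0//.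
  move=> /(_ isT tT) /=; have /andP[t0 tT'] := tT.
  have h s : 0 <= s <= t -> delta s <= (2 * a + D' / 2 ^+ n) * expR (2 * L * s).
    by move=> /andP[s0 st]; apply: ih; rewrite s0 (le_trans st).
  move=> /(_ h) {}h; apply: (le_trans h); rewrite exprS.
  have := e1 _ t0.
  have -> : D' / (2 * 2 ^+ n) = D' / 2 ^+ n / 2.
    by rewrite invfM mulrA mulrAC.
  move: (D' / _) (expR _) => q e e_ge1.
  have : 0 <= a * (e - 1) by rewrite mulr_ge0// subr_ge0.
  lra.
move=> t tT; apply: (@halving_limit _ (D' * expR (2 * L * t))) => n.
by apply: (le_trans (key n t tT)); rewrite mulrDl [D' * _ / _]mulrAC.
Qed.

End RealBounds.

(** * Polynomial approximation *)

Section Weierstrass.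
Context {R : realType}.
Implicit Types (f : nat -> R) (g : R -> R) (a b c d e x y : R).

(* The n-th Bernstein polynomial of a function with f k in place of g (k / n),
   through the de Casteljau recursion rather than the binomial formula. *)
Fixpoint bernstein (n : nat) f : {poly R} :=
  if n is n'.+1 then
    'X * bernstein n' (f \o succn) + (1 - 'X) * bernstein n' f
  else (f 0%N)%:P.

Lemma bernsteinS n f (x : R) : (bernstein n.+1 f).[x] =
  x * (bernstein n (f \o succn)).[x] + (1 - x) * (bernstein n f).[x].
Proof. by rewrite /= !hornerE. Qed.

Lemma le_bernstein n f f' (x : R) : 0 <= x <= 1 ->
  (forall k, (k <= n)%N -> f k <= f' k) ->
  (bernstein n f).[x] <= (bernstein n f').[x].
Proof.
move=> /andP[x0 x1]; elim: n f f' => [|n ih] f f' ff'.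
  by rewrite /= !hornerE ff'.
rewrite !bernsteinS lerD// ler_wpM2l ?subr_ge0 ?ih// => k kn.
  by apply: ff'.
by rewrite ff'// (leq_trans kn).
Qed.

(** For a binomial law with parameters n and x, [n%:R * x * (1 - x)] is the variance and the other
    square the bias. Parabolas are stable under the shift [f \o succn], which moves c to c - 1, and
    this closes the induction. *)
Lemma bernstein_parabola n (a b c x : R) :
  (bernstein n (fun k => a + b * (k%:R - c) ^+ 2)).[x] =
    a + b * (n%:R * x * (1 - x) + (n%:R * x - c) ^+ 2).
Proof.
elim: n a b c => [|n ih] a b c; first by rewrite /= !hornerE; ring.
rewrite bernsteinS ih (_ : _ \o _ = fun k => a + b * (k%:R - (c - 1)) ^+ 2).
  by rewrite ih -natr1; ring.
by apply/funext => k /=; rewrite -natr1; congr (_ + _ * _ ^+ 2); ring.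
Qed.

Lemma uniform_continuity_segment g (a b e : R) : continuous g -> 0 < e ->
  exists2 d : R, 0 < d & forall x y : R, a <= x <= b -> `|x - y| < d -> `|g x - g y| < e.
Proof.
move=> cg e0.
have := @segment_compact R a b; rewrite compact_near_coveringP => cov.
have e20 : 0 < e / 2 by rewrite divr_gt0.
pose Q (d x : R) := forall y, `|x - y| < d -> `|g x - g y| < e.
have : \forall d \near 0^'+, `[a, b] `<=` Q d.
  apply: cov => x _.
  have /cvgrPdist_lt /(_ _ e20) [r /= r0 hr] := cg x.
  exists (ball x (r / 2), [set d | d < r / 2]) => /=.
    split; first by apply: nbhsx_ballx; rewrite divr_gt0.
    by apply: nbhs_right_lt; rewrite divr_gt0.
  move=> [x' d] /= [xx' dr] y x'y.
  rewrite (splitr e) -[g x' - _](subrKA (g x)) (le_lt_trans (ler_normD _ _))//.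
  rewrite ltrD//.
    rewrite distrC; apply: hr; rewrite /ball_/= (lt_trans xx')//; lra.
  apply: hr; rewrite /ball_/=.
  rewrite -(subrKA x') (le_lt_trans (ler_normD _ _))//.
  by move: xx'; rewrite /ball/=; lra.
move=> nQ; have [d [d0 Qd]] := filter_ex (filterI (nbhs_right_gt (0 : R)) nQ).
by exists d => // x y xab; apply: Qd; rewrite /= in_itv.
Qed.

Lemma weierstrass01 g (e : R) : continuous g -> 0 < e ->
  exists p : {poly R}, forall x, 0 <= x <= 1 -> `|p.[x] - g x| <= e.
Proof.
move=> cg e0; have e20 : 0 < e / 2 by rewrite divr_gt0.
have [d d0 hd] := uniform_continuity_segment 0 1 cg e20.
have cng : {within `[0, 1], continuous (fun x => `|g x|)}.
  apply: continuous_subspaceT => x.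
  by apply: continuous_comp; [exact: cg|exact: norm_continuous].
have [c c01 hM] := EVT_max ler01 cng; set M : R := `|g c| in hM.
have M0 : 0 <= M by exact: normr_ge0.
pose n := (Num.truncn (4 * M / (d ^+ 2 * e))).+1.
have n0 : 0 < n%:R :> R by rewrite ltr0n.
have hn : 4 * M / (d ^+ 2 * e) < n%:R.
  by rewrite /n truncnS_gt// ?divr_ge0 ?mulr_ge0 ?sqr_ge0// ltW.
exists (bernstein n (fun k => g (k%:R / n%:R))) => x x01.
(* K scales a parabola that, with e / 2, dominates the error at every node: if k / n is within d of
   x, continuity gives e / 2, and farther away the square alone exceeds the oscillation 2M. The
   choice of n makes its Bernstein mean at x at most e. *)
pose K := 2 * M / (d * n%:R) ^+ 2.
have K0 : 0 <= K by rewrite divr_ge0 ?sqr_ge0 ?mulr_ge0.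
have Kn : K * (n%:R * x * (1 - x)) <= e / 2.
  have /andP[x0 x1] := x01.
  apply: (@le_trans _ _ (K * n%:R)).
    by rewrite ler_wpM2l// -mulrA ler_piMr ?ltW//; nra.
  have -> : K * n%:R = 2 * M / (d ^+ 2 * n%:R).
    by rewrite /K; field; rewrite !gt_eqF.
  rewrite ler_pdivrMr ?mulr_gt0 ?exprn_gt0//.
  move: hn; rewrite ltr_pdivrMr ?mulr_gt0 ?exprn_gt0//.
  by rewrite -!mulrA; lra.
have bd k : (k <= n)%N -> `|g (k%:R / n%:R) - g x| <=
    e / 2 + K * (k%:R - n%:R * x) ^+ 2.
  move=> kn; have kn01 : 0 <= (k%:R / n%:R : R) <= 1.
    by rewrite divr_ge0//= ler_pdivrMr// mul1r ler_nat.
  have [xk|xk] := ltP `|x - k%:R / n%:R| d.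
    rewrite distrC (le_trans (ltW (hd _ _ x01 xk)))// lerDl.
    by rewrite mulr_ge0 ?sqr_ge0.
  apply: (@le_trans _ _ (2 * M)).
    rewrite (le_trans (ler_normB _ _))//.
    have := hM x; have := hM (k%:R / n%:R); rewrite !in_itv/= x01 kn01.
    by move=> /(_ isT) h1 /(_ isT) h2; lra.
  have : 2 * M <= K * (k%:R - n%:R * x) ^+ 2; last by lra.
  rewrite /K mulrAC ler_pdivlMr ?exprn_gt0 ?mulr_gt0//.
  rewrite ler_wpM2l ?mulr_ge0// -[leRHS]real_normK ?num_real//.
  rewrite ler_pXn2r ?nnegrE ?mulr_ge0 ?(ltW d0) ?(ltW n0)//.
  have -> : k%:R - n%:R * x = - (x - k%:R / n%:R) * n%:R.
    by field; rewrite gt_eqF.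
  by rewrite normrM normrN [`|n%:R|]ger0_norm ?(ltW n0)// ler_wpM2r// ltW.
rewrite ler_distl; apply/andP; split.
  apply: le_trans; last first.
    apply: (@le_bernstein n (fun k => (g x - e / 2) + - K * (k%:R - n%:R * x) ^+ 2)) => //.
    by move=> k kn; have := bd k kn; rewrite ler_norml => /andP[+ _]; lra.
  by rewrite bernstein_parabola subrr expr0n/= addr0; lra.
apply: le_trans.
  apply: (@le_bernstein n _ (fun k => (g x + e / 2) + K * (k%:R - n%:R * x) ^+ 2)) => //.
  by move=> k kn; have := bd k kn; rewrite ler_norml => /andP[_ +]; lra.
by rewrite bernstein_parabola subrr expr0n/= addr0; lra.
Qed.

Lemma weierstrass g (E e : R) : continuous g -> 0 < E -> 0 < e ->
  exists p : {poly R}, forall x, 0 <= x <= E -> `|p.[x] - g x| <= e.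
Proof.
move=> cg E0 e0.
have cgE : continuous (fun x => g (E * x)).
  move=> x; apply: (@continuous_comp _ _ _ ( *%R E) g); last exact: cg.
  exact: mulrl_continuous.
have [p hp] := weierstrass01 cgE e0.
exists (p \Po (E^-1 *: 'X)) => x /andP[x0 xE].
have := hp (x / E); rewrite divr_ge0 ?(ltW E0)//= ler_pdivrMr// mul1r xE.
rewrite mulrCA divff ?gt_eqF// mulr1 => /(_ isT).
by rewrite horner_comp !hornerE [E^-1 * x]mulrC.
Qed.

End Weierstrass.

(** * The integral equation *)

Section IntervalIntegrals.
Context {R : realType}.
Notation mu := (@lebesgue_measure R).
Implicit Types (f g : R -> R) (a b c k t s M : R).

Lemma continuous_integrable_segment f a b :
  continuous f -> mu.-integrable `[a, b] (EFin \o f).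
Proof.
move=> cf; apply: continuous_compact_integrable; first exact: segment_compact.
exact: continuous_subspaceT.
Qed.

Lemma integrable_subsegment f a b c c' : c <= a -> b <= c' ->
  mu.-integrable `[c, c'] (EFin \o f) -> mu.-integrable `[a, b] (EFin \o f).
Proof.
move=> ca bc; apply: integrableS => //.
by apply: subset_itv; rewrite bnd_simp.
Qed.

Lemma Rintegral_segment_cst a b c : a <= b ->
  \int[mu]_(s in `[a, b]) c = c * (b - a).
Proof.
move=> ab; rewrite Rintegral_cst//= lebesgue_measure_itv/= lte_fin.
have [_//|ba] := ltP a b; have -> : b = a by lra.
by rewrite subrr.
Qed.

Lemma Rintegral_segmentB f a b c : a <= c -> c <= b ->
  mu.-integrable `[a, b] (EFin \o f) ->
  \int[mu]_(s in `[a, b]) f s - \int[mu]_(s in `[a, c]) f s =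
  \int[mu]_(s in `[c, b]) f s.
Proof.
move=> ac cb fi; rewrite Rintegral_itvB ?bnd_simp//.
rewrite Rintegral_itv_obnd_cbnd//.
by apply: integrableS fi => //; apply: subset_itv; rewrite bnd_simp.
Qed.

Lemma Rintegral_segment_le f c a b : a <= b ->
  mu.-integrable `[a, b] (EFin \o f) ->
  (forall s, a <= s <= b -> f s <= c) ->
  \int[mu]_(s in `[a, b]) f s <= c * (b - a).
Proof.
move=> ab fi fc; rewrite -Rintegral_segment_cst//; apply: le_Rintegral => //.
  by apply: continuous_integrable_segment => x; apply: cvg_cst.
Qed.

Lemma Rintegral_segment_norm_le f c a b : a <= b ->
  mu.-integrable `[a, b] (EFin \o f) ->
  (forall s, a <= s <= b -> `|f s| <= c) ->
  `|\int[mu]_(s in `[a, b]) f s| <= c * (b - a).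
Proof.
move=> ab fi fc; apply: (le_trans (le_normr_Rintegral _ fi)) => //.
by apply: Rintegral_segment_le => //; exact: integrable_norm.
Qed.

Lemma continuous_expRM k : continuous (fun s : R => expR (k * s)).
Proof.
move=> x; apply: (@continuous_comp _ _ _ ( *%R k) expR).
  exact: mulrl_continuous.
exact: continuous_expR.
Qed.

Lemma Rintegral_segment_expR k a b : k != 0 -> a <= b ->
  \int[mu]_(s in `[a, b]) expR (k * s) = (expR (k * b) - expR (k * a)) / k.
Proof.
move=> k0; rewrite le_eqVlt => /predU1P[<-|ab].
  by rewrite set_itv1 Rintegral_set1 subrr mul0r.
have dF (x : R) : is_derive x 1 (fun s => expR (k * s) / k) (expR (k * x)).
  have -> : (fun s => expR (k * s) / k) = k^-1 *: (expR \o (k *: (@id R))).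
    by apply/funext => s; rewrite [LHS]mulrC.
  apply: is_derive_eq; rewrite /GRing.scale/= mulr1.
  by rewrite mulrCA mulVf// mulr1.
rewrite /Rintegral (@continuous_FTC2 _ _ (fun s => expR (k * s) / k))//.
- by rewrite mulrBl.
- exact/continuous_subspaceT/continuous_expRM.
- have cF : continuous (fun s : R => expR (k * s) / k).
    move=> x; apply: cvgM; [exact: continuous_expRM|exact: cvg_cst].
  split; [by move=> x _; have [] := dF x|by apply: cvg_at_right_filter; exact: cF|].
  by apply: cvg_at_left_filter; exact: cF.
- by move=> x _; rewrite derive1E; have [_ ->] := dF x.
Qed.

Lemma Rintegral_segment_expR_le f k M a b : k != 0 -> a <= b ->
  mu.-integrable `[a, b] (EFin \o f) ->
  (forall s, a <= s <= b -> f s <= M * expR (k * s)) ->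
  \int[mu]_(s in `[a, b]) f s <= M * ((expR (k * b) - expR (k * a)) / k).
Proof.
move=> k0 ab fi fM; rewrite -Rintegral_segment_expR//.
have ei : mu.-integrable `[a, b] (EFin \o (fun s => expR (k * s))).
  exact/continuous_integrable_segment/continuous_expRM.
rewrite -RintegralZl//; apply: le_Rintegral => //.
  have -> : EFin \o (fun s => M * expR (k * s)) =
    (fun s => M%:E * (EFin \o (fun s => expR (k * s))) s)%E by [].
  exact: integrableZl.
Qed.

End IntervalIntegrals.

Section IntegralEquationTheory.
Context {R : realType}.
Notation mu := (@lebesgue_measure R).
Implicit Types (Phi f g : R -> R) (a d k l s t x y M N S T C L : R).

Definition lipschitz_upto C L Phi := forall x y,
  0 <= x <= C -> 0 <= y <= C -> `|Phi x - Phi y| <= L * `|x - y|.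

(** The local Lipschitz bounds govern stability and uniqueness; the one-sided bound [regular_ge]
    excludes explosion, since - Phi grows at most linearly. *)
Record regular_mechanism (a : R) Phi : Prop := RegularMechanism {
  regular_slope : 0 < a;
  regular_lipschitz : forall C, exists2 L, 0 < L & lipschitz_upto C L Phi;
  regular_ge : forall x, 0 <= x -> - (a * x) <= Phi x;
  regular0 : Phi 0 = 0
}.

Definition solution_upto T Phi g f : Prop :=
  [/\ forall t, 0 <= t <= T -> 0 <= f t,
      exists C, forall t, 0 <= t <= T -> f t <= C,
      mu.-integrable `[0, T] (EFin \o (Phi \o f))
    & forall t, 0 <= t <= T -> f t = g t - \int[mu]_(s in `[0, t]) Phi (f s)].

Lemma is_solution_upto T Phi g f : 0 <= T ->
  is_solution Phi g f -> solution_upto T Phi g f.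
Proof.
move=> T0 [f0 bf If ef]; split => [t /andP[]| |//|t /andP[t0 _]].
- by move=> t0 _; exact: f0.
- have [M [Mr hM]] := bf T T0; exists (M + 1) => t tT.
  apply: (le_trans (ler_norm _)); apply: hM; first by rewrite ltrDl.
  by rewrite /= in_itv.
- exact: If.
- exact: ef.
Qed.

Lemma upto_is_solution Phi g f :
  (forall T, 0 <= T -> solution_upto T Phi g f) -> is_solution Phi g f.
Proof.
move=> sf; have sf' t (t0 : 0 <= t) : 0 <= t <= t by rewrite t0 lexx.
split=> t t0; have [f0 [C fC] If ef] := sf t t0.
- exact/f0/sf'.
- exists C; split; first exact: num_real.
  move=> M CM s /=; rewrite in_itv/= => st.
  by rewrite ger0_norm ?f0// (le_trans (fC s st))// ltW.
- exact: If.
- exact/ef/sf'.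
Qed.

Lemma solution_upto_shorter S T Phi g f : S <= T ->
  solution_upto T Phi g f -> solution_upto S Phi g f.
Proof.
move=> ST [f0 [C fC] If ef].
have sub t : 0 <= t <= S -> 0 <= t <= T.
  by move=> /andP[-> tS]; rewrite (le_trans tS).
split; [by move=> t /sub/f0|by exists C => t /sub/fC| |by move=> t /sub/ef].
by apply: integrable_subsegment If.
Qed.

Lemma eq_solution_upto T Phi g g' f f' :
  (forall t, 0 <= t <= T -> g t = g' t) -> (forall t, 0 <= t <= T -> f t = f' t) ->
  solution_upto T Phi g f -> solution_upto T Phi g' f'.
Proof.
move=> gg ff [f0 [C fC] If ef]; split.
- by move=> t tT; rewrite -ff ?f0.
- by exists C => t tT; rewrite -ff ?fC.
- apply: eq_integrable If => // s; rewrite inE/= in_itv/= => sT.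
  by rewrite /= ff.
- move=> t tT; rewrite -ff// -gg// ef//; congr (_ - _); apply: eq_Rintegral => s.
  rewrite inE/= in_itv/= => /andP[s0 st]; rewrite ff// s0 (le_trans st)//.
  by case/andP: tT.
Qed.

(** Integrating [L * M * expR (2 * L * s)] over [0, t] gives [M / 2 * (expR (2 * L * t) - 1)]: the
    rate 2L in [gronwall] is chosen for this factor 1/2. Besides uniqueness, the lemma gives the
    continuity in k used to remove the damping. *)
Lemma solution_upto_stable C L T Phi g1 g2 f1 f2 d :
  0 < L -> 0 <= d -> lipschitz_upto C L Phi ->
  solution_upto T Phi g1 f1 -> solution_upto T Phi g2 f2 ->
  (forall t, 0 <= t <= T -> f1 t <= C /\ f2 t <= C) ->
  (forall t, 0 <= t <= T -> `|g1 t - g2 t| <= d) ->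
  forall t, 0 <= t <= T -> `|f1 t - f2 t| <= 2 * d * expR (2 * L * t).
Proof.
move=> L0 d0 lipPhi [f10 _ If1 ef1] [f20 _ If2 ef2] fC gd.
apply: (gronwall (D := 2 * C)) => // [t tT|M t M0 tT fM].
  have := f10 t tT; have := f20 t tT; have [] := fC t tT.
  by rewrite ler_norml; lra.
have /andP[t0 tT'] := tT.
rewrite ef1// ef2//.
have Ift1 : mu.-integrable `[0, t] (EFin \o (Phi \o f1)).
  exact: integrable_subsegment If1.
have Ift2 : mu.-integrable `[0, t] (EFin \o (Phi \o f2)).
  exact: integrable_subsegment If2.
have -> (p q r s : R) : (p - q) - (r - s) = (p - r) - (q - s) by ring.
rewrite (le_trans (ler_normB _ _))// lerD ?gd//.
rewrite -RintegralB//=.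
have IfB : mu.-integrable `[0, t] (EFin \o (fun s => Phi (f1 s) - Phi (f2 s))).
  exact: integrableB Ift1 Ift2.
apply: (le_trans (le_normr_Rintegral _ IfB)) => //.
apply: le_trans.
  apply: (@Rintegral_segment_expR_le _ _ (2 * L) (L * M)) => //.
  - by rewrite mulf_neq0// gt_eqF.
  - exact: integrable_norm.
  - move=> s st; have sT : 0 <= s <= T.
      by case/andP: st => -> st; rewrite (le_trans st).
    have [C1 C2] := fC s sT.
    apply: (le_trans (lipPhi _ _ _ _)); rewrite ?f10 ?f20//.
    by rewrite -mulrA ler_wpM2l ?fM// ltW.
rewrite mulr0 expR0.
have -> : L * M * ((expR (2 * L * t) - 1) / (2 * L)) =
    M / 2 * (expR (2 * L * t) - 1) by field; rewrite gt_eqF.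
by rewrite ler_wpM2l ?divr_ge0// gerBl.
Qed.

Lemma solution_upto_unique a T Phi g f1 f2 : regular_mechanism a Phi ->
  solution_upto T Phi g f1 -> solution_upto T Phi g f2 ->
  forall t, 0 <= t <= T -> f1 t = f2 t.
Proof.
move=> rPhi s1 s2 t tT; have [_ [C1 fC1] _ _] := s1; have [_ [C2 fC2] _ _] := s2.
have [L L0 lipL] := regular_lipschitz rPhi (Num.max C1 C2).
have := solution_upto_stable L0 (lexx 0) lipL s1 s2 _ _ tT.
rewrite mulr0 mul0r normr_le0 subr_eq0 => h; apply/eqP/h => s sT.
  by rewrite !le_max fC1 ?fC2// orbT.
by rewrite subrr normr0.
Qed.

(** Only the linear lower bound of Phi enters, so the estimate involves neither the bound of [f]
    itself nor a Lipschitz constant. It supplies the clamping level in the existence proof and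
    bounds uniform over bounded initial values. *)
Lemma solution_upto_le a T Phi k l f : regular_mechanism a Phi ->
  0 <= k -> 0 <= l -> solution_upto T Phi (fun t => k + l * t) f ->
  forall t, 0 <= t <= T -> f t <= 2 * (k + l * T) * expR (2 * a * T).
Proof.
move=> rPhi k0 l0 [f0 [C fC] If ef] t tT; have a0 := regular_slope rPhi.
have /andP[t0 tT'] := tT; have T0 := le_trans t0 tT'.
have klT : 0 <= k + l * T by rewrite addr_ge0 ?mulr_ge0.
apply: (@le_trans _ _ (2 * (k + l * T) * expR (2 * a * t))); last first.
  rewrite ler_wpM2l ?mulr_ge0// ler_expR ler_wpM2l ?mulr_ge0// ltW//.
apply: (gronwall (D := C) (T := T)) => // {t tT t0 tT'} M t M0 tT fM.
have /andP[t0 tT'] := tT.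
have Ift : mu.-integrable `[0, t] (EFin \o (Phi \o f)).
  exact: integrable_subsegment If.
have NIft : mu.-integrable `[0, t] (EFin \o (fun s => - Phi (f s))).
  exact: integrableN Ift.
rewrite ef//.
have -> : - (\int[mu]_(s in `[0, t]) Phi (f s)) =
    \int[mu]_(s in `[0, t]) (- Phi (f s)).
  rewrite -mulN1r -RintegralZl//; apply: eq_Rintegral => s _.
  by rewrite mulN1r.
rewrite lerD ?lerD2l ?ler_wpM2l//.
apply: le_trans.
  apply: (@Rintegral_segment_expR_le _ _ (2 * a) (a * M)) => //.
  - by rewrite mulf_neq0// gt_eqF.
  - move=> s st; have sT : 0 <= s <= T.
      by case/andP: st => -> st; rewrite (le_trans st).
    rewrite lerNl (le_trans _ (regular_ge rPhi _))// ?f0// lerN2 -mulrA.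
    by rewrite ler_wpM2l ?fM// ltW.
rewrite mulr0 expR0.
have -> : a * M * ((expR (2 * a * t) - 1) / (2 * a)) =
    M / 2 * (expR (2 * a * t) - 1) by field; rewrite gt_eqF.
by rewrite ler_wpM2l ?divr_ge0// gerBl.
Qed.

Lemma solution_uptoB T Phi k l f s t : 0 <= s -> s <= t -> t <= T ->
  solution_upto T Phi (fun t => k + l * t) f ->
  f t - f s = l * (t - s) - \int[mu]_(x in `[s, t]) Phi (f x).
Proof.
move=> s0 st tT [_ _ If ef].
have Ift : mu.-integrable `[0, t] (EFin \o (Phi \o f)).
  exact: integrable_subsegment If.
have := Rintegral_segmentB s0 st Ift => /= <-.
rewrite ef ?(le_trans s0 st) ?tT// [f s]ef ?s0 ?(le_trans st tT)//.
ring.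
Qed.

(* Running the equation backwards from t turns the upper Gronwall bound into a
   lower bound. *)
Lemma solution_upto_ge C L T Phi k l f : 0 < L -> lipschitz_upto C L Phi ->
  Phi 0 = 0 -> 0 <= l -> solution_upto T Phi (fun t => k + l * t) f ->
  (forall t, 0 <= t <= T -> f t <= C) ->
  forall t, 0 <= t <= T -> k / 2 * expR (- (2 * L * T)) <= f t.
Proof.
move=> L0 lipL Phi0 l0 sf fC t tT; have [f0 _ If ef] := sf.
have /andP[t0 tT'] := tT.
have sub s : 0 <= s <= t -> 0 <= t - s <= T.
  by move=> /andP[s0 st]; rewrite subr_ge0 st /= (le_trans _ tT')// gerBl.
have fk : f 0 = k.
  rewrite ef ?lexx ?(le_trans t0)// set_itv1 Rintegral_set1.
  by rewrite mulr0 addr0 subr0.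
(* At s = t the conclusion reads k <= 2 f(t) e^{2Lt}. *)
have := @gronwall R L t C (f t) (fun s => f (t - s)) L0 (f0 _ tT).
move=> /(_ _ _ t); rewrite t0 lexx subrr fk => h.
have : k <= 2 * f t * expR (2 * L * t).
  apply: h => // [s /sub|M s M0 st fM]; first exact: fC.
  have /andP[s0 st'] := st.
  have e := solution_uptoB (_ : 0 <= t - s) (_ : t - s <= t) tT' sf.
  rewrite -lerBlDl -opprB e ?subr_ge0 ?gerBl// opprB subKr.
  have Ist : mu.-integrable `[t - s, t] (EFin \o (Phi \o f)).
    by apply: integrable_subsegment If => //; rewrite subr_ge0.
  apply: (@le_trans _ _ (\int[mu]_(x in `[t - s, t]) Phi (f x))).
    by rewrite gerBl mulr_ge0.
  apply: le_trans.
    apply: (@Rintegral_segment_expR_le _ _ (- (2 * L)) (L * M * expR (2 * L * t))) => //.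
    - by rewrite oppr_eq0 mulf_neq0// gt_eqF.
    - by rewrite gerBl.
    - move=> x /andP[tx xt]; have xT : 0 <= x <= T.
        by rewrite (le_trans xt)// andbT (le_trans _ tx)// subr_ge0.
      have C0 : 0 <= C by apply: le_trans (f0 _ xT) (fC _ xT).
      have := lipL (f x) 0; rewrite Phi0 !subr0 lexx C0 f0//= fC// => /(_ isT isT).
      move=> /(le_trans (ler_norm _)) hx; apply: (le_trans hx).
      rewrite ger0_norm ?f0// -!mulrA ler_wpM2l ?(ltW L0)// -expRD.
      have := fM (t - x); rewrite subKr subr_ge0 xt/= => /(_ _)/le_trans; apply.
        by lra.
      by rewrite ler_wpM2l// ler_expR; lra.
  have -> : L * M * expR (2 * L * t) *
      ((expR (- (2 * L) * t) - expR (- (2 * L) * (t - s))) / - (2 * L)) =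
      M / 2 * (expR (2 * L * s) - 1).
    have -> : expR (2 * L * s) = expR (2 * L * t) * expR (- (2 * L) * (t - s)).
      by rewrite -expRD; congr expR; ring.
    have : expR (2 * L * t) * expR (- (2 * L) * t) = 1.
      by rewrite -expRD -expR0; congr expR; ring.
    move: (expR (- (2 * L) * (t - s))) (expR (- (2 * L) * t)) => y z e1.
    transitivity (M / 2 * (expR (2 * L * t) * y - expR (2 * L * t) * z)).
      by field; rewrite gt_eqF.
    by rewrite e1.
  by rewrite ler_wpM2l ?divr_ge0// gerBl.
have hT : expR (2 * L * t) <= expR (2 * L * T).
  by rewrite ler_expR ler_wpM2l ?mulr_ge0// ltW.
move=> hk; rewrite expRN ler_pdivrMr ?expR_gt0// ler_pdivrMr//.
apply: (le_trans hk).
have := ler_wpM2l (f0 _ tT) hT; lra.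
Qed.

Lemma solution_upto_lipschitz T Phi k l f N s t :
  0 <= s -> s <= t -> t <= T -> solution_upto T Phi (fun t => k + l * t) f ->
  (forall x, 0 <= x <= T -> `|l - Phi (f x)| <= N) ->
  `|f t - f s| <= N * (t - s).
Proof.
move=> s0 st tT sf bN; have [_ _ If _] := sf.
have Ist : mu.-integrable `[s, t] (EFin \o (Phi \o f)).
  exact: integrable_subsegment If.
have cI c : mu.-integrable `[s, t] (EFin \o (fun=> c : R)).
  by apply: continuous_integrable_segment => x; exact: cvg_cst.
rewrite (solution_uptoB s0 st tT sf) -Rintegral_segment_cst// -RintegralB//.
apply: Rintegral_segment_norm_le => //.
  exact: (integrableB _ (cI l) Ist).
by move=> x /andP[sx xt]; apply: bN; rewrite (le_trans s0)//= (le_trans xt).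
Qed.

(** Since [f] is N-Lipschitz in time, [Phi (f s) - Phi (f x)] is at most L N (x - s); integrating it
    gains the second power of t - s. *)
Lemma solution_upto_euler C L T Phi k l f N s t : 0 < L -> 0 <= N ->
  lipschitz_upto C L Phi ->
  0 <= s -> s <= t -> t <= T -> solution_upto T Phi (fun t => k + l * t) f ->
  (forall x, 0 <= x <= T -> f x <= C) ->
  (forall x, 0 <= x <= T -> `|l - Phi (f x)| <= N) ->
  `|f t - f s - (l - Phi (f s)) * (t - s)| <= L * N * (t - s) ^+ 2.
Proof.
move=> L0 N0 lipL s0 st tT sf fC bN; have [f0 _ If _] := sf.
have Ist : mu.-integrable `[s, t] (EFin \o (Phi \o f)).
  exact: integrable_subsegment If.
have cI c : mu.-integrable `[s, t] (EFin \o (fun=> c : R)).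
  by apply: continuous_integrable_segment => x; exact: cvg_cst.
rewrite (solution_uptoB s0 st tT sf).
have -> : l * (t - s) - (\int[mu]_(x in `[s, t]) Phi (f x)) - (l - Phi (f s)) * (t - s)
   = \int[mu]_(x in `[s, t]) (Phi (f s) - Phi (f x)).
  by rewrite RintegralB// Rintegral_segment_cst//; ring.
rewrite expr2 mulrA; apply: Rintegral_segment_norm_le => //.
  exact: (integrableB _ (cI _) Ist).
move=> x /andP[sx xt].
have xT : 0 <= x <= T by rewrite (le_trans s0)//= (le_trans xt).
have sT : 0 <= s <= T by rewrite s0/= (le_trans st).
apply: (le_trans (lipL _ _ _ _)); rewrite ?f0 ?fC//.
rewrite -mulrA ler_wpM2l ?(ltW L0)// distrC.
apply: (le_trans (solution_upto_lipschitz s0 sx _ sf bN)); first exact: le_trans tT.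
by rewrite ler_wpM2l// lerD2r.
Qed.

End IntegralEquationTheory.

(** * Existence of solutions by Picard iteration *)

Section Existence.
Context {R : realType}.
Notation mu := (@lebesgue_measure R).
Implicit Types (F Phi f g : R -> R) (a d k l s t x y K M N S T C L : R).

(** Nested intervals: the bounds w_n - 2K / 2^n increase, the bounds w_n + 2K / 2^n decrease, and a
    common point comes with its rate of convergence. *)
Lemma geometric_increments_limit (w : nat -> R) K :
  (forall n, `|w n.+1 - w n| <= K / 2 ^+ n) ->
  exists l, forall n, `|w n - l| <= 2 * K / 2 ^+ n.
Proof.
move=> hw.
have K0 : 0 <= K by have := hw 0%N; rewrite expr0 divr1; apply: le_trans.
have e0 n : 0 <= K / 2 ^+ n by rewrite divr_ge0 ?exprn_ge0.
pose lo n := w n - 2 * (K / 2 ^+ n); pose hi n := w n + 2 * (K / 2 ^+ n).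
have half n : K / 2 ^+ n.+1 = K / 2 ^+ n / 2 by rewrite exprS; field.
have loS : {homo lo : n m / (n <= m)%N >-> n <= m}.
  apply: homo_leq => [//|? ? ?|n]; first exact: le_trans.
  rewrite /lo half; have := hw n; rewrite ler_norml.
  by move=> /andP[+ _]; have := e0 n; lra.
have hiS : {homo hi : n m / (n <= m)%N >-> m <= n}.
  apply: homo_leq => [//|? ? ? ? /le_trans|n]; first exact.
  rewrite /hi half; have := hw n; rewrite ler_norml.
  by move=> /andP[_]; have := e0 n; lra.
have lohi n m : lo n <= hi m.
  apply: (@le_trans _ _ (lo (maxn n m))); first exact/loS/leq_maxl.
  apply: (@le_trans _ _ (hi (maxn n m))); last exact/hiS/leq_maxr.
  by rewrite /lo /hi; have := e0 (maxn n m); lra.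
exists (sup (range lo)) => n.
have l1 : lo n <= sup (range lo).
  by apply: ub_le_sup; [exists (hi 0%N) => _ [m _ <-]|exists n].
have l2 : sup (range lo) <= hi n.
  by apply: ge_sup => [|_ [m _ <-]//]; exists (lo 0%N); exists 0%N.
by rewrite ler_distl -mulrA; move: l1 l2; rewrite /lo /hi; lra.
Qed.

Lemma norm_lipschitz_continuous N f :
  (forall x y, `|f x - f y| <= N * `|x - y|) -> continuous f.
Proof.
move=> fN x; have N0 : 0 <= N.
  by have := fN 0 1; rewrite sub0r normrN1 mulr1; apply: le_trans.
have N1 : 0 < N + 1 by lra.
apply/cvgrPdist_le => e e0; near=> y.
apply: (le_trans (fN x y)).
apply: (@le_trans _ _ ((N + 1) * `|x - y|)); first by rewrite ler_wpM2r//; lra.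
rewrite -ler_pdivlMl// mulrC; near: y.
by apply: cvgr_dist_le => //; rewrite divr_gt0.
Unshelve. all: by end_near. Qed.

Lemma max0_lipschitz x y : `|Num.max 0 x - Num.max 0 y| <= `|x - y|.
Proof.
wlog xy : x y / x <= y => [hw|].
  have [xy|/ltW yx] := leP x y; first exact: hw.
  by rewrite distrC (distrC x); exact: hw.
rewrite (distrC x) (@ger0_norm _ (y - x)) ?subr_ge0// ler_norml.
by rewrite !maxEle; do 2 (case: ifPn; rewrite -?ltNge => ?); lra.
Qed.

Lemma min_lipschitz C x y : `|Num.min x C - Num.min y C| <= `|x - y|.
Proof.
wlog xy : x y / x <= y => [hw|].
  have [xy|/ltW yx] := leP x y; first exact: hw.
  by rewrite distrC (distrC x); exact: hw.
rewrite (distrC x) (@ger0_norm _ (y - x)) ?subr_ge0// ler_norml.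
by rewrite !minEle; do 2 (case: ifPn; rewrite -?ltNge => ?); lra.
Qed.

Section Picard.
Variables (F : R -> R) (L N k : R).
Hypothesis L0 : 0 < L.
Hypothesis lipF : forall x y, `|F x - F y| <= L * `|x - y|.
Hypothesis bndF : forall x, `|F x| <= N.

Let N0 : 0 <= N. Proof. exact: le_trans (bndF 0). Qed.

Let cF f : continuous f -> continuous (F \o f).
Proof.
move=> cf x; apply: continuous_comp; first exact: cf.
exact: (@norm_lipschitz_continuous L F lipF).
Qed.

(** [Num.max 0 t] makes the iterates constant on negative times, hence Lipschitz on the whole
    line. *)
Definition picard f t := k + \int[mu]_(s in `[0, Num.max 0 t]) F (f s).

Lemma picard_lipschitz f t s : continuous f ->
  `|picard f t - picard f s| <= N * `|t - s|.
Proof.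
wlog st : s t / s <= t => [hw cf|cf].
  have [st|/ltW ts] := leP s t; first exact: hw.
  by rewrite distrC (distrC t); exact: hw.
have st' : Num.max 0 s <= Num.max 0 t by rewrite ge_max !le_max lexx st orbT.
rewrite /picard (_ : k + _ - (k + _) = \int[mu]_(x in `[0, Num.max 0 t]) F (f x) -
  \int[mu]_(x in `[0, Num.max 0 s]) F (f x)); last by ring.
rewrite Rintegral_segmentB//; last 2 first.
  by rewrite le_max lexx.
  by apply: continuous_integrable_segment; exact: cF.
apply: (@le_trans _ _ (N * (Num.max 0 t - Num.max 0 s))).
  apply: Rintegral_segment_norm_le => //.
  by apply: continuous_integrable_segment; exact: cF.
rewrite ler_wpM2l// (@ger0_norm _ (t - s)) ?subr_ge0//.
by rewrite !maxEle; do 2 case: ifPn; rewrite -?ltNge; lra.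
Qed.

(** The weight [expR (2 * L * s)], a Bielecki norm, makes the map a contraction by 1/2 on all of [0,
    oo[ at once, without subdividing time. *)
Lemma picard_contraction f g M t : continuous f -> continuous g -> 0 <= M ->
  0 <= t -> (forall s, 0 <= s <= t -> `|f s - g s| <= M * expR (2 * L * s)) ->
  `|picard f t - picard g t| <= M / 2 * expR (2 * L * t).
Proof.
move=> cf cg M0 t0 fg; rewrite /picard max_r//.
have If : mu.-integrable `[0, t] (EFin \o (F \o f)).
  by apply: continuous_integrable_segment; exact: cF.
have Ig : mu.-integrable `[0, t] (EFin \o (F \o g)).
  by apply: continuous_integrable_segment; exact: cF.
rewrite (_ : k + _ - (k + _) = \int[mu]_(x in `[0, t]) F (f x) -
  \int[mu]_(x in `[0, t]) F (g x)); last by ring.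
rewrite -RintegralB//.
have IfB : mu.-integrable `[0, t] (EFin \o (fun s => F (f s) - F (g s))).
  exact: integrableB If Ig.
apply: (le_trans (le_normr_Rintegral _ IfB)) => //.
apply: le_trans.
  apply: (@Rintegral_segment_expR_le _ _ (2 * L) (L * M)) => //.
  - by rewrite mulf_neq0// gt_eqF.
  - exact: integrable_norm.
  - move=> s st; apply: (le_trans (lipF _ _)).
    by rewrite -mulrA ler_wpM2l ?fg// ltW.
rewrite mulr0 expR0.
have -> : L * M * ((expR (2 * L * t) - 1) / (2 * L)) =
    M / 2 * (expR (2 * L * t) - 1) by field; rewrite gt_eqF.
by rewrite ler_wpM2l ?divr_ge0// gerBl.
Qed.

Lemma picard_fixpoint : exists2 u, continuous u &
  forall t, 0 <= t -> u t = k + \int[mu]_(s in `[0, t]) F (u s).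
Proof.
pose w n := iter n picard (fun=> k).
have cw n : continuous (w n).
  elim: n => [|n ih]; first by move=> x; exact: cvg_cst.
  by apply: (@norm_lipschitz_continuous N) => x y; exact: picard_lipschitz.
pose M := N / (2 * L); have M0 : 0 <= M by rewrite divr_ge0// mulr_ge0// ltW.
have wS n t : 0 <= t -> `|w n.+1 t - w n t| <= M / 2 ^+ n * expR (2 * L * t).
  elim: n t => [|n ih] t t0.
    (* The first iterate starts at the constant k, so its distance to k is at most N t, and x <= e^x
       puts this under [M * expR (2 * L * t)]; hence the value of M. *)
    have -> : w 0%N t = w 1%N 0.
      rewrite /w/= /picard max_l// set_itv1.
      by rewrite Rintegral_set1 addr0.
    apply: (le_trans (@picard_lipschitz _ t 0 (cw 0%N))).
    rewrite subr0 ger0_norm// expr0 divr1 /M -mulrA ler_wpM2l//.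
    by rewrite ler_pdivlMl ?mulr_gt0// le_expR_self.
  have -> : M / 2 ^+ n.+1 = M / 2 ^+ n / 2 by rewrite exprS; field.
  apply: picard_contraction => //.
  - exact: (cw n.+1).
  - by rewrite divr_ge0// exprn_ge0.
  - by move=> s /andP[s0 _]; exact: ih.
pose K t := M * expR (2 * L * Num.max 0 t).
have lim t : exists l, forall n, `|w n (Num.max 0 t) - l| <= 2 * K t / 2 ^+ n.
  apply: geometric_increments_limit => n.
  by rewrite [K t / _]mulrAC; apply: wS; rewrite le_max lexx.
have [u hu] := choice lim.
have cu : continuous u.
  apply: (@norm_lipschitz_continuous N) => x y.
  apply: (@halving_limit _ _ (2 * K x + 2 * K y + N * 2)) => n.
  apply: (@le_trans _ _ (N * `|x - y| + (2 * K x / 2 ^+ n + 2 * K y / 2 ^+ n))).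
    have -> : u x - u y = (w n (Num.max 0 x) - w n (Num.max 0 y)) -
       ((w n (Num.max 0 x) - u x) - (w n (Num.max 0 y) - u y)) by ring.
    apply: (le_trans (ler_normB _ _)); rewrite lerD//.
      have : `|w n (Num.max 0 x) - w n (Num.max 0 y)| <=
             N * `|Num.max 0 x - Num.max 0 y|.
        case: n => [|n]; first by rewrite subrr normr0 mulr_ge0.
        exact: picard_lipschitz.
      move=> /le_trans; apply; rewrite ler_wpM2l//.
      exact: max0_lipschitz.
    by apply: (le_trans (ler_normB _ _)); rewrite lerD.
  rewrite lerD2l -mulrDl ler_wpM2r ?invr_ge0 ?exprn_ge0//.
  by rewrite lerDl mulr_ge0.
exists u => // t t0; apply/eqP; rewrite -subr_eq0 -normr_le0.
apply: (@halving_limit _ _ (2 * K t)) => n; rewrite add0r.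
have tm : Num.max 0 t = t by rewrite max_r.
have -> : k + \int[mu]_(s in `[0, t]) F (u s) = picard u t.
  by rewrite /picard tm.
have e2 : 2 * K t / 2 ^+ n = 2 * K t / 2 ^+ n.+1 + 2 * M / 2 ^+ n / 2 * expR (2 * L * t).
  rewrite /K tm exprS; field.
  by rewrite gt_eqF// exprn_gt0.
have -> : u t - picard u t = (picard (w n) t - picard u t) - (w n.+1 t - u t).
  by rewrite /w iterS; ring.
rewrite e2 [leRHS]addrC (le_trans (ler_normB _ _))// lerD//.
  apply: picard_contraction => //.
    by apply: divr_ge0; [exact: mulr_ge0|exact: exprn_ge0].
  move=> s /andP[s0 _]; have := hu s n; rewrite /K max_r//.
  by rewrite -!mulrA [_ * 2 ^- n]mulrC.
by have := hu t n.+1; rewrite tm.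
Qed.

End Picard.

(** Meant for the nonnegativity of solutions: after such a time the clamped equation has drift l >=
    0, so the path cannot have become negative. *)
Lemma last_nonneg_point f t : continuous f -> 0 <= t -> 0 <= f 0 ->
  exists2 s, 0 <= s <= t /\ 0 <= f s & forall x, s < x <= t -> f x < 0.
Proof.
move=> cf t0 f0; pose A := `[0, t] `&` f @^-1` [set x | 0 <= x].
have cA : compact A.
  apply: (subclosed_compact _ (@segment_compact R 0 t)) => //; last exact: subIsetl.
  apply: closedI; first exact: itv_closed.
  apply: preimage_closed; last exact: closed_ge.
  by move=> x _; exact: cf.
have A0 : A !=set0 by exists 0; split => //=; rewrite in_itv/= lexx.
have [s] := @compact_EVT_max R R id A A0 cA (continuous_subspaceT (fun x => cvg_id)).
rewrite inE => -[/=]; rewrite in_itv/= => st fs max_s.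
exists s => // x /andP[sx xt]; rewrite ltNge; apply/negP => fx.
have : x \in A.
  rewrite inE; split => //=; rewrite in_itv/= xt (le_trans _ (ltW sx))//.
  by case/andP: st.
by move=> /max_s; rewrite leNgt sx.
Qed.

(** Clamping the argument of Phi to [0, C], with C the a priori bound of [solution_upto_le], gives a
    bounded and globally Lipschitz right-hand side. The solution of the clamped equation then turns
    out to stay in [0, C], where the clamp is the identity. *)
Lemma exists_solution_upto a T Phi k l : regular_mechanism a Phi ->
  0 <= k -> 0 <= l -> 0 <= T ->
  exists f, solution_upto T Phi (fun t => k + l * t) f.
Proof.
move=> rPhi k0 l0 T0; have a0 := regular_slope rPhi.
pose C := 2 * (k + l * T) * expR (2 * a * T).
have C0 : 0 <= C by rewrite !mulr_ge0 ?expR_ge0 ?addr_ge0 ?mulr_ge0.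
pose clamp x := Num.min (Num.max 0 x) C.
have clampC x : 0 <= clamp x <= C.
  by rewrite /clamp minEle maxEle; do 2 case: ifPn; rewrite -?ltNge; lra.
have clampE x : 0 <= x <= C -> clamp x = x.
  by move=> /andP[x0 xC]; rewrite /clamp max_r// min_l.
have clamp_lip x y : `|clamp x - clamp y| <= `|x - y|.
  exact: le_trans (min_lipschitz _ _ _) (max0_lipschitz _ _).
have [L L0 lipL] := regular_lipschitz rPhi C.
pose F x := l - Phi (clamp x).
have lipF x y : `|F x - F y| <= L * `|x - y|.
  have -> : F x - F y = Phi (clamp y) - Phi (clamp x) by rewrite /F; ring.
  apply: (le_trans (lipL _ _ (clampC _) (clampC _))).
  by rewrite ler_wpM2l ?(ltW L0)// distrC.
have bndF x : `|F x| <= l + L * C.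
  rewrite /F (le_trans (ler_normB _ _))// ger0_norm// lerD2l.
  have := lipL (clamp x) 0 (clampC x); rewrite lexx C0 (regular0 rPhi) !subr0.
  move=> /(_ isT) /le_trans; apply; rewrite ler_wpM2l ?(ltW L0)//.
  by rewrite ger0_norm//; case/andP: (clampC x).
have [u cu eu] := picard_fixpoint k L0 lipF bndF.
have cF : continuous (F \o u).
  move=> x; apply: continuous_comp; first exact: cu.
  exact: (@norm_lipschitz_continuous L F lipF).
have IF t : mu.-integrable `[0, t] (EFin \o (F \o u)).
  exact: continuous_integrable_segment.
have u00 : u 0 = k by rewrite eu// set_itv1 Rintegral_set1 addr0.
have u0 t : 0 <= t -> 0 <= u t.
  move=> t0; rewrite leNgt; apply/negP => ut.
  have [|s [/andP[s0 st] us] neg] := last_nonneg_point cu t0; first by rewrite u00.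
  have : 0 <= u t - u s.
    rewrite eu// [u s]eu//.
    rewrite (_ : k + _ - (k + _) = \int[mu]_(x in `[0, t]) F (u x) -
      \int[mu]_(x in `[0, s]) F (u x)); last by ring.
    rewrite Rintegral_itvB ?bnd_simp//.
    apply: Rintegral_ge0 => x /=; rewrite in_itv/= => /neg ux.
    by rewrite /F /clamp max_l ?(ltW ux)// min_l// (regular0 rPhi) subr0.
  lra.
(* The a priori estimate survives the clamp, because F(u) - l = - Phi(clamp u) <= a * clamp u <= a *
   u. *)
have uC t : 0 <= t <= T -> u t <= C.
  move=> tT; have /andP[t0 tT'] := tT.
  apply: (@le_trans _ _ (2 * (k + l * T) * expR (2 * a * t))); last first.
    rewrite ler_wpM2l ?mulr_ge0 ?addr_ge0 ?mulr_ge0//.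
    by rewrite ler_expR ler_wpM2l ?mulr_ge0// ltW.
  apply: (gronwall (D := k + (l + L * C) * T) (T := T)) => //.
  - by rewrite addr_ge0 ?mulr_ge0.
  - move=> {t tT t0 tT'} t /andP[t0 tT]; rewrite eu// lerD2l.
    apply: (le_trans (ler_norm _)).
    apply: (@le_trans _ _ ((l + L * C) * (t - 0))).
      apply: (@Rintegral_segment_norm_le _ (F \o u)) => // s _; exact: bndF.
    have LC : 0 <= L * C by rewrite mulr_ge0// ltW.
    by rewrite subr0 ler_wpM2l//; lra.
  - move=> M {t tT t0 tT'} t M0 /andP[t0 tT] uM; rewrite eu// -addrA lerD2l.
    have Il : mu.-integrable `[0, t] (EFin \o (fun=> l)).
      by apply: continuous_integrable_segment => x; exact: cvg_cst.
    have IB : mu.-integrable `[0, t] (EFin \o (fun s => F (u s) - l)).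
      exact: integrableB (IF t) Il.
    have -> : \int[mu]_(s in `[0, t]) F (u s) =
        l * t + \int[mu]_(s in `[0, t]) (F (u s) - l).
      by rewrite RintegralB// Rintegral_segment_cst// subr0 addrC subrK.
    rewrite lerD// ?ler_wpM2l//; apply: le_trans.
      apply: (@Rintegral_segment_expR_le _ _ (2 * a) (a * M)) => //.
      + by rewrite mulf_neq0// gt_eqF.
      + move=> s st; rewrite /F addrC addKr.
        have us : 0 <= u s by apply: u0; case/andP: st.
        have /andP[c0 _] := clampC (u s).
        have := regular_ge rPhi c0; rewrite lerNl => /le_trans; apply.
        rewrite -mulrA ler_wpM2l ?(ltW a0)// (le_trans _ (uM s st))//.
        by rewrite /clamp max_r// ge_min lexx.
    rewrite mulr0 expR0.
    have -> : a * M * ((expR (2 * a * t) - 1) / (2 * a)) =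
        M / 2 * (expR (2 * a * t) - 1) by field; rewrite gt_eqF.
    by rewrite ler_wpM2l ?divr_ge0// gerBl.
have FE s : 0 <= s <= T -> F (u s) = l - Phi (u s).
  by move=> sT; rewrite /F clampE// uC// u0//; case/andP: sT.
have IPhi t : t <= T -> mu.-integrable `[0, t] (EFin \o (Phi \o u)).
  move=> tT; have Il : mu.-integrable `[0, t] (EFin \o (fun=> l)).
    by apply: continuous_integrable_segment => x; exact: cvg_cst.
  apply: eq_integrable (integrableB _ Il (IF t)) => // s.
  rewrite inE/= in_itv/= => /andP[s0 st] /=.
  by rewrite FE ?s0 ?(le_trans st)// -EFinB; congr EFin; ring.
exists u; split.
- by move=> t /andP[t0 _]; exact: u0.
- by exists C.
- exact: IPhi.
- move=> t /andP[t0 tT]; rewrite eu//.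
  have -> : \int[mu]_(s in `[0, t]) F (u s) = \int[mu]_(s in `[0, t]) (l - Phi (u s)).
    apply: eq_Rintegral => s; rewrite inE/= in_itv/= => /andP[s0 st].
    by rewrite FE// s0 (le_trans st).
  rewrite RintegralB//; last exact: IPhi.
    by rewrite Rintegral_segment_cst// subr0 addrA.
  by apply: continuous_integrable_segment => x; exact: cvg_cst.
Qed.

(** Solutions on the horizons T are glued along the diagonal: by uniqueness the value at t is the
    same for every horizon beyond t. *)
Lemma exists_unique_solution a Phi k l : regular_mechanism a Phi ->
  0 <= k -> 0 <= l ->
  exists f, is_unique_solution Phi (fun t => k + l * t) f.
Proof.
move=> rPhi k0 l0.
have ex T : exists f, 0 <= T -> solution_upto T Phi (fun t => k + l * t) f.
  have [T0|_] := leP 0 T; last by exists (fun=> 0).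
  by have [f] := exists_solution_upto rPhi k0 l0 T0; exists f.
have [u hu] := choice ex; exists (fun t => u t t).
have sol : is_solution Phi (fun t => k + l * t) (fun t => u t t).
  apply: upto_is_solution => T T0.
  apply: (eq_solution_upto _ _ (hu T T0)) => // t /andP[t0 tT].
  apply: (solution_upto_unique rPhi _ (hu t t0)); last by rewrite t0 lexx.
  exact: solution_upto_shorter tT (hu T T0).
split=> // f' sf' t t0.
apply: (solution_upto_unique rPhi (is_solution_upto t0 sf') (is_solution_upto t0 sol)).
by rewrite t0 lexx.
Qed.

End Existence.

(** * Branching mechanisms *)

Section MechanismTheory.
Context {R : realType}.
Variables (alpha beta : R).
Variable nu : {sigma_finite_measure set (measurableTypeR R) -> \bar R}.
Hypothesis triple : is_branching_triple alpha beta nu.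
Implicit Types (A D : set (measurableTypeR R)) (a b l u w x y z C r : R).

Let pos : set (measurableTypeR R) := `]0, +oo[.

Let pos_gt0 z : pos z -> 0 < z.
Proof. by rewrite /pos/= in_itv/= andbT. Qed.

Let mpos : measurable pos.
Proof. exact: measurable_itv. Qed.

Definition jump_weight z : R := Num.min z (z ^+ 2).
Definition exp_remainder l z : R := expR (- l * z) - 1 + l * z.

Lemma jump_weight_ge0 z : 0 <= z -> 0 <= jump_weight z.
Proof. by move=> z0; rewrite /jump_weight le_min z0 sqr_ge0. Qed.

Lemma measurable_jump_weight : measurable_fun setT jump_weight.
Proof. exact: measurable_minr. Qed.

Lemma measurable_expRM l : measurable_fun setT (fun z : R => expR (l * z)).
Proof. by apply: continuous_measurable_fun; exact: continuous_expRM. Qed.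

Lemma measurable_exp_remainder l : measurable_fun setT (exp_remainder l).
Proof.
apply: measurable_funD; last exact: measurable_funM.
by apply: measurable_funB => //; exact: measurable_expRM.
Qed.

Lemma jump_weight_integrable : nu.-integrable pos (EFin \o jump_weight).
Proof.
apply/integrableP; split.
  by apply/measurable_EFinP; apply: measurable_funTS; exact: measurable_jump_weight.
have [_ _ + _] := triple; apply: le_lt_trans.
rewrite le_eqVlt; apply/orP; left; apply/eqP; apply: eq_integral => z.
rewrite inE => /pos_gt0 z0.
by rewrite /= ger0_norm// jump_weight_ge0// ltW.
Qed.

Lemma jump_weight_dominated D (f : R -> R) C :
  measurable D -> D `<=` pos -> measurable_fun setT f ->
  (forall z, D z -> `|f z| <= C * jump_weight z) ->
  nu.-integrable D (EFin \o f).
Proof.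
move=> mD Dpos mf fC.
have wi : nu.-integrable D (EFin \o jump_weight).
  exact: integrableS mpos mD Dpos jump_weight_integrable.
have Cwi : nu.-integrable D (fun z => C%:E * (EFin \o jump_weight) z)%E.
  exact: integrableZl.
apply: le_integrable Cwi => //.
  by apply/measurable_EFinP; apply: measurable_funTS.
move=> z Dz /=; rewrite lee_fin (le_trans (fC z Dz))//.
exact: ler_norm.
Qed.

Lemma exp_remainder_le l z : 0 <= l -> 0 <= z ->
  `|exp_remainder l z| <= (1 + l) * l * jump_weight z.
Proof.
move=> l0 z0; have := @expR_remainder_lipschitz R l l 0 z.
rewrite !lexx l0 => /(_ isT isT z0).
by rewrite subr0 (ger0_norm l0) oppr0 !mul0r expR0 subrr addr0 subr0.
Qed.

Lemma exp_remainder_integrable D l : measurable D -> D `<=` pos -> 0 <= l ->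
  nu.-integrable D (EFin \o exp_remainder l).
Proof.
move=> mD Dpos l0; apply: jump_weight_dominated => //.
  exact: measurable_exp_remainder.
move=> z /Dpos/pos_gt0 z0.
exact: exp_remainder_le (ltW z0).
Qed.

(** Common form of both mechanisms: D is ]0, oo[ for [branching_mechanism] and ]0, oo[ without A for
    [truncated_mechanism], whose drift a is increased accordingly. *)
Definition levy_khintchine a D l : R :=
  a * l + beta * l ^+ 2 + \int[nu]_(z in D) exp_remainder l z.

Lemma levy_khintchine_regular a D : measurable D -> D `<=` pos ->
  regular_mechanism (`|a| + 1) (levy_khintchine a D).
Proof.
move=> mD Dpos; have [b0 _ _ _] := triple.
have wi : nu.-integrable D (EFin \o jump_weight).
  exact: integrableS mpos mD Dpos jump_weight_integrable.
have Dge0 z : D z -> 0 <= z.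
  by move=> /Dpos/pos_gt0/ltW.
split.
- by rewrite ltr_pwDr.
- move=> C; pose m := \int[nu]_(z in D) jump_weight z.
  have m0 : 0 <= m by apply: Rintegral_ge0 => z /Dge0/jump_weight_ge0.
  (* One summand for each term of the mechanism; the last 1 makes the constant positive. *)
  exists (`|a| + beta * (2 * `|C|) + (1 + `|C|) * m + 1).
    by rewrite ltr_pwDr// !addr_ge0 ?mulr_ge0 ?addr_ge0.
  move=> x y xC yC; have C0 : 0 <= C by lra.
  have x0 : 0 <= x by lra.
  have y0 : 0 <= y by lra.
  rewrite (ger0_norm C0).
  have -> : levy_khintchine a D x - levy_khintchine a D y =
      a * (x - y) + beta * (x ^+ 2 - y ^+ 2) +
      \int[nu]_(z in D) (exp_remainder x z - exp_remainder y z).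
    rewrite RintegralB//; last 2 first.
    - by apply: exp_remainder_integrable => //; case/andP: xC.
    - by apply: exp_remainder_integrable => //; case/andP: yC.
    by rewrite /levy_khintchine; ring.
  have -> : (`|a| + beta * (2 * C) + (1 + C) * m + 1) * `|x - y| =
     `|a| * `|x - y| + beta * (2 * C * `|x - y|) + (1 + C) * `|x - y| * m + `|x - y|.
    by ring.
  rewrite -[leLHS]addr0 lerD// (le_trans (ler_normD _ _))// lerD//.
    rewrite (le_trans (ler_normD _ _))// lerD// normrM//.
    rewrite (ger0_norm b0) ler_wpM2l// subr_sqr mulrC normrM ler_wpM2r//.
    by rewrite ger0_norm; lra.
  have ie : nu.-integrable D (EFin \o (fun z => exp_remainder x z - exp_remainder y z)).
    exact: (integrableB mD (exp_remainder_integrable mD Dpos x0)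
      (exp_remainder_integrable mD Dpos y0)).
  apply: (le_trans (le_normr_Rintegral _ ie)) => //.
  rewrite -RintegralZl//; apply: le_Rintegral => //.
  + exact: integrable_norm.
  + have := integrableZl mD ((1 + C) * `|x - y|) wi.
    exact: eq_integrable.
  + move=> z /Dge0 z0; exact: expR_remainder_lipschitz.
- move=> l l0; rewrite /levy_khintchine.
  have : 0 <= \int[nu]_(z in D) exp_remainder l z.
    apply: Rintegral_ge0 => z _.
    by rewrite /exp_remainder mulNr; exact: expR_remainder_ge0.
  have : 0 <= beta * l ^+ 2 by rewrite mulr_ge0 ?sqr_ge0.
  have : 0 <= (`|a| + a) * l.
    by rewrite mulr_ge0//; have := ler_norm (- a); rewrite normrN; lra.
  by lra.
- rewrite /levy_khintchine (_ : Rintegral _ _ _ = \int[nu]_(z in D) (0 : R)).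
    by rewrite Rintegral_cst// !mul0r mulr0 expr0n/= mulr0 !addr0.
  by apply: eq_Rintegral => z _; rewrite /exp_remainder oppr0 !mul0r expR0 subrr addr0.
Qed.

Lemma branching_regular : regular_mechanism (`|alpha| + 1)
  (branching_mechanism alpha beta nu).
Proof. exact: (@levy_khintchine_regular alpha pos). Qed.

Section Tail.
Variables (A : set (measurableTypeR R)) (r : R).
Hypotheses (mA : measurable A) (r0 : 0 < r) (Ar : A `<=` `[r, +oo[).

Lemma tail_pos : A `<=` pos.
Proof.
by move=> z /Ar; rewrite /pos/= !in_itv/= !andbT; exact: lt_le_trans.
Qed.

Lemma truncated_regular : exists a, regular_mechanism a
  (truncated_mechanism alpha beta nu A).
Proof.
eexists; apply: (@levy_khintchine_regular (alpha + \int[nu]_(z in A) z) (pos `\` A)).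
  exact: measurableD.
exact: subDsetl.
Qed.

(** Above r one has 1 <= z / r, hence 1 + z <= (1 + 1/r) z and z <= z^2 / r: the jump weight
    dominates 1 + z up to the factor (1 + 1/r)^2. *)
Lemma tail_dominated (f : R -> R) C : 0 <= C -> measurable_fun setT f ->
  (forall z, A z -> `|f z| <= C * (1 + z)) -> nu.-integrable A (EFin \o f).
Proof.
move=> C0 mf fC.
apply: (@jump_weight_dominated _ _ (C * ((1 + r^-1) * (1 + r^-1)))) => //.
  exact: tail_pos.
move=> z Az; apply: (le_trans (fC z Az)); rewrite -!mulrA ler_wpM2l//.
have rz : r <= z by have := Ar Az; rewrite /= in_itv/= andbT.
have z0 : 0 < z by exact: lt_le_trans rz.
have h1 : 1 <= r^-1 * z by rewrite ler_pdivlMl// mulr1.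
have h0 : 0 < r^-1 by rewrite invr_gt0.
have h2 : 1 + z <= (1 + r^-1) * z by nra.
rewrite /jump_weight minElt; case: ifPn => _; last first.
  apply: (le_trans h2); rewrite ler_wpM2l//; first by lra.
  by nra.
apply: (le_trans h2); rewrite ler_wpM2l//; first by lra.
by nra.
Qed.

Lemma tail_cst_integrable (c : R) : nu.-integrable A (EFin \o (fun=> c)).
Proof.
apply: (@tail_dominated _ `|c|) => // z /tail_pos/pos_gt0 z0.
by rewrite ler_peMr// lerDl ltW.
Qed.

Lemma tail_id_integrable : nu.-integrable A (EFin \o (fun z => z)).
Proof.
apply: (@tail_dominated _ 1) => // z /tail_pos/pos_gt0 z0.
by rewrite mul1r gtr0_norm// lerDr.
Qed.

Lemma tail_measure_lty : (nu A < +oo)%E.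
Proof.
have /integrableP[_] := tail_cst_integrable 1.
rewrite (eq_integral (cst 1%E)); last by move=> z _ /=; rewrite normr1.
by rewrite integral_cst// mul1e.
Qed.

Lemma tail_expR_integrable l : 0 <= l ->
  nu.-integrable A (EFin \o (fun z => expR (- l * z))).
Proof.
move=> l0; apply: (@tail_dominated _ 1) => //; first exact: measurable_expRM.
move=> z /tail_pos/pos_gt0 z0.
rewrite mul1r ger0_norm ?expR_ge0//.
apply: (@le_trans _ _ 1); last by lra.
by rewrite expR_le1 mulNr oppr_le0 mulr_ge0// ltW.
Qed.

(** On A each piece of the compensated integrand is integrable by itself, so the linear part cancels
    against the additional drift of the truncated mechanism. *)
Lemma truncated_mechanismE l : 0 <= l ->
  truncated_mechanism alpha beta nu A l =
  branching_mechanism alpha beta nu l + fine (nu A) -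
    \int[nu]_(z in A) expR (- l * z).
Proof.
move=> l0; rewrite /truncated_mechanism /branching_mechanism.
have Apos := tail_pos.
have -> : \int[nu]_(z in `]0, +oo[) (expR (- l * z) - 1 + l * z) =
    \int[nu]_(z in A) (expR (- l * z) - 1 + l * z) +
    \int[nu]_(z in `]0, +oo[ `\` A) (expR (- l * z) - 1 + l * z).
  have e : `]0, +oo[%classic = A `|` (`]0, +oo[ `\` A) :> set (measurableTypeR R).
    by rewrite setUDr setDv setD0; apply/esym/setUidPr.
  rewrite [in LHS]e Rintegral_setU//.
  - exact: measurableD.
  - by rewrite -e; exact: (@exp_remainder_integrable pos).
  - by apply/disj_setPS => z [Az []].
have -> : \int[nu]_(z in A) (expR (- l * z) - 1 + l * z) =
    \int[nu]_(z in A) expR (- l * z) - fine (nu A) + l * \int[nu]_(z in A) z.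
  rewrite RintegralD//; last 2 first.
  - by have := integrableB mA (tail_expR_integrable l0) (tail_cst_integrable 1).
  - by have := integrableZl mA l tail_id_integrable.
  rewrite RintegralB//; last 2 first.
  - exact: tail_expR_integrable.
  - exact: tail_cst_integrable.
  rewrite RintegralZl//; last exact: tail_id_integrable.
  by rewrite Rintegral_cst// mul1r.
ring.
Qed.

End Tail.

End MechanismTheory.

(** * Second differences of mechanisms in the Laplace parameter *)

Section SecondDifference.
Context {R : realType}.
Implicit Types (l w z : R).

(* Second differences in lambda kill the affine part of a mechanism and turn the
   exponentials e^{-lambda z} into e^{-lambda z} (1 - e^{-z})^2, an integrable
   function for the Levy measure. *)
Definition second_difference (f : R -> R) w : R := f w - 2 * f (w + 1) + f (w + 2).

Definition rho z : R := (1 - expR (- z)) ^+ 2.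

Lemma rho_ge0 z : 0 <= rho z. Proof. exact: sqr_ge0. Qed.

Lemma second_difference_expR w z :
  second_difference (fun l => expR (- l * z)) w = rho z * expR (- w * z).
Proof.
rewrite /second_difference /rho.
have -> : expR (- (w + 1) * z) = expR (- w * z) * expR (- z).
  by rewrite -expRD; congr expR; ring.
have -> : expR (- (w + 2) * z) = expR (- w * z) * expR (- z) ^+ 2.
  by rewrite expr2 -!expRD; congr expR; ring.
by ring.
Qed.

Lemma second_difference_exp_remainder w z :
  second_difference (fun l => exp_remainder l z) w = rho z * expR (- w * z).
Proof.
by rewrite -second_difference_expR /second_difference /exp_remainder; ring.
Qed.

Variables (alpha beta : R).
Variable nu : {sigma_finite_measure set (measurableTypeR R) -> \bar R}.
Hypothesis triple : is_branching_triple alpha beta nu.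

Let pos : set (measurableTypeR R) := `]0, +oo[.
Let mpos : measurable pos. Proof. exact: measurable_itv. Qed.

Definition rho_integral w : R := \int[nu]_(z in pos) (rho z * expR (- w * z)).

Lemma rho_expR_integrable w : 0 <= w ->
  nu.-integrable pos (EFin \o (fun z => rho z * expR (- w * z))).
Proof.
move=> w0; have i l : 0 <= l -> nu.-integrable pos (EFin \o exp_remainder l).
  exact: (exp_remainder_integrable triple mpos (@subset_refl _ pos)).
have i0 := i w w0; have i1 := i (w + 1) (addr_ge0 w0 ler01).
have i2 := i (w + 2) (addr_ge0 w0 (ler0n _ 2)).
have := integrableD mpos (integrableB mpos i0 (integrableZl mpos 2 i1)) i2.
apply: eq_integrable => // z _ /=.
by rewrite -second_difference_exp_remainder.
Qed.

Lemma rho_integral_ge0 w : 0 <= rho_integral w.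
Proof. by apply: Rintegral_ge0 => z _; rewrite mulr_ge0 ?rho_ge0 ?expR_ge0. Qed.

(** The quadratic term leaves the constant 2 beta, which acts as a point mass at z = 0; it reappears
    as [2 * beta * p.[1]] in [small_time_limit]. *)
Lemma second_difference_branching w : 0 <= w ->
  second_difference (branching_mechanism alpha beta nu) w =
    2 * beta + rho_integral w.
Proof.
move=> w0; have i l : 0 <= l -> nu.-integrable pos (EFin \o exp_remainder l).
  exact: (exp_remainder_integrable triple mpos (@subset_refl _ pos)).
have i0 := i w w0; have i1 := i (w + 1) (addr_ge0 w0 ler01).
have i2 := i (w + 2) (addr_ge0 w0 (ler0n _ 2)).
have -> : rho_integral w = second_difference
    (fun l => \int[nu]_(z in pos) exp_remainder l z) w.
  have e1 := RintegralZl 2 mpos i1.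
  have j1 : nu.-integrable pos (EFin \o (fun z => 2 * exp_remainder (w + 1) z)).
    by apply: eq_integrable (integrableZl mpos 2 i1) => // z _ /=; rewrite EFinM.
  have e2 := RintegralB mpos i0 j1.
  have e3 := RintegralD mpos (integrableB mpos i0 j1) i2.
  rewrite /second_difference -e1 -e2 -e3.
  by apply: eq_Rintegral => z _; rewrite -second_difference_exp_remainder.
rewrite /second_difference /branching_mechanism /exp_remainder -/pos.
by ring.
Qed.

End SecondDifference.

(** * Jumps and increments of rcll paths *)

Section RcllPaths.
Context {R : realType}.
Implicit Types (f : R -> R) (a b c d e r s t x h : R).

Definition rcll_path f :=
  (forall t, 0 <= t -> f s @[s --> t^'+] --> f t) /\
  (forall t, 0 < t -> cvg (f s @[s --> t^'-])).

Definition path_jump f s := f s - lim (f u @[u --> s^'-]).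

Lemma rcll_right f t e : rcll_path f -> 0 <= t -> 0 < e ->
  exists2 d, 0 < d & forall x, t <= x -> x < t + d -> `|f t - f x| < e.
Proof.
move=> [rc _] t0 e0; have /cvgrPdist_lt /(_ _ e0) [d /= d0 hd] := rc t t0.
exists d => // x; rewrite le_eqVlt => /predU1P[<- _|tx xd].
  by rewrite subrr normr0.
by apply: hd => //=; rewrite distrC ger0_norm; lra.
Qed.

Lemma rcll_left f t e : rcll_path f -> 0 < t -> 0 < e ->
  exists2 d, 0 < d & forall x, t - d < x -> x < t ->
    `|lim (f u @[u --> t^'-]) - f x| < e.
Proof.
move=> [_ ll] t0 e0; have /cvgrPdist_lt /(_ _ e0) [d /= d0 hd] := ll t t0.
by exists d => // x xd xt; apply: hd => //=; rewrite ger0_norm; lra.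
Qed.

(** Close to a fixed time t an increment costs at most two oscillations e, plus a jump of at most r
    if it straddles t; compactness of [0, T] makes the radius uniform. The bound r >= 0 serves the
    increments that stay on one side of t. *)
Lemma small_jumps_small_increments f T r c : rcll_path f -> 0 <= r -> r < c ->
  (forall s, 0 < s <= T -> path_jump f s <= r) ->
  exists2 d, 0 < d &
    forall a b, 0 <= a -> a <= b -> b <= T -> b - a < d -> f b - f a <= c.
Proof.
move=> rf r0 rc jr; pose e := (c - r) / 4.
have e0 : 0 < e by rewrite /e; lra.
have := @segment_compact R 0 T; rewrite compact_near_coveringP => cov.
pose Q d a := forall b, 0 <= a -> a <= b -> b <= T -> b - a < d -> f b - f a <= c.
have nQ : \forall d \near 0^'+, `[0, T] `<=` Q d.
  apply: cov => t; rewrite /= in_itv/= => /andP[t0 tT].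
  have [dr dr0 hr] := rcll_right rf t0 e0.
  have [dl dl0 hl] : exists2 dl, 0 < dl & forall a b, 0 <= a -> t - dl < a -> a < t ->
      b < t + dr -> a <= b -> f b - f a <= c.
    have [t_gt0|t_le0] := ltP 0 t; last by exists 1 => // a b *; lra.
    have [dl dl0 hl] := rcll_left rf t_gt0 e0.
    exists dl => // a b _ ta at' bt ab.
    have := hl a ta at'; rewrite ltr_norml => /andP[h1 h2].
    have [bt'|tb] := ltP b t.
      have := hl b (lt_le_trans ta ab) bt'; rewrite ltr_norml => /andP[].
      by move: h1 h2; rewrite /e; lra.
    have := hr b tb bt; rewrite ltr_norml => /andP[].
    have := jr t; rewrite t_gt0 tT /path_jump => /(_ isT).
    by move: h1 h2; rewrite /e; lra.
  pose d := Num.min dl dr.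
  have d0 : 0 < d by rewrite lt_min dl0.
  have ddl : d <= dl by rewrite ge_min lexx.
  have ddr : d <= dr by rewrite ge_min lexx orbT.
  exists (ball t (d / 2), [set x | x < d / 2]) => /=.
    by split; [apply: nbhsx_ballx; lra|apply: nbhs_right_lt; lra].
  move=> [a x] /= [/ltr_normlP[h1 h2] xd] b a0 ab bT bax.
  have [at'|ta] := ltP a t; first by apply: hl => //; lra.
  have := hr a ta; have := hr b (le_trans ta ab).
  rewrite !ltr_norml => /(_ _)/andP[|h3 h4]; first by lra.
  move=> /(_ _)/andP[|h5 h6]; first by lra.
  by move: h3 h4 h5 h6; rewrite /e; lra.
have [d [d0 Qd]] := filter_ex (filterI (nbhs_right_gt (0 : R)) nQ).
exists d => // a b a0 ab bT bad; apply: Qd => //.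
by rewrite /= in_itv/= a0 (le_trans ab).
Qed.

Lemma big_jump_big_increment f s c : rcll_path f -> 0 < s -> c < path_jump f s ->
  exists2 d, 0 < d &
    forall a b, a < s -> s <= b -> b - a < d -> c < f b - f a.
Proof.
move=> rf s0 cj; pose e := (path_jump f s - c) / 2.
have e0 : 0 < e by rewrite /e; lra.
have [dr dr0 hr] := rcll_right rf (ltW s0) e0.
have [dl dl0 hl] := rcll_left rf s0 e0.
exists (Num.min dl dr); first by rewrite lt_min dl0.
move=> a b as' sb; rewrite lt_min => /andP[bl br].
have := hl a _ as'; have := hr b sb.
rewrite !ltr_norml => /(_ _)/andP[|h1 h2]; first by lra.
move=> /(_ _)/andP[|h3 h4]; first by lra.
by move: cj h1 h2 h3 h4; rewrite /e /path_jump; lra.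
Qed.

(** The index n stands for n + 1 intervals, so the mesh is always defined. *)
Definition small_increments f t c (n : nat) := forall k : nat, (k <= n)%N ->
  f (k.+1%:R * (t / n.+1%:R)) - f (k%:R * (t / n.+1%:R)) <= c.

Lemma mesh_lt t d : 0 < t -> 0 < d -> \forall n \near \oo, t / n.+1%:R < d.
Proof.
move=> t0 d0; near=> n; rewrite ltr_pdivrMr// mulrC -ltr_pdivrMr//.
rewrite (@lt_trans _ _ n%:R) ?ltr_nat//.
by near: n; exact: nbhs_infty_gtr.
Unshelve. all: by end_near. Qed.

Lemma small_jumps_near f t r c : rcll_path f -> 0 < t -> 0 <= r -> r < c ->
  (forall s, 0 < s <= t -> path_jump f s <= r) ->
  \forall n \near \oo, small_increments f t c n.
Proof.
move=> rf t0 r0 rc jr.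
have [d d0 hd] := small_jumps_small_increments rf r0 rc jr.
have := mesh_lt t0 d0; apply: filterS => n nd k kn.
have h0 : 0 < t / n.+1%:R by rewrite divr_gt0.
apply: hd.
- by rewrite mulr_ge0// ltW.
- by rewrite ler_wpM2r ?(ltW h0)// ler_nat.
- by rewrite mulrCA ler_piMr ?(ltW t0)// ler_pdivrMr// mul1r ler_nat.
- by rewrite -mulrBl -natrB// subSnn mul1r.
Qed.

Lemma big_jump_near f t s c : rcll_path f -> 0 < s <= t -> c < path_jump f s ->
  \forall n \near \oo, ~ small_increments f t c n.
Proof.
move=> rf /andP[s0 st] cj; have t0 := lt_le_trans s0 st.
have [d d0 hd] := big_jump_big_increment rf s0 cj.
have := mesh_lt t0 d0; apply: filterS => n nd si.
set h := t / n.+1%:R in nd si.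
have h0 : 0 < h by rewrite divr_gt0.
(* The least such k is a successor because s > 0; the interval ending at k h is the one that
   contains the jump. *)
have ex : exists k : nat, s <= k%:R * h.
  by exists n.+1; rewrite /h mulrC divfK// pnatr_eq0.
case: (ex_minnP ex) => -[|k] sk mink; first by move: sk; rewrite mul0r leNgt s0.
have kn : (k <= n)%N.
  by rewrite -ltnS; apply: mink; rewrite /h mulrC divfK// pnatr_eq0.
have ks : k%:R * h < s.
  by rewrite ltNge; apply/negP => /mink; rewrite ltnn.
have := hd _ _ ks sk; rewrite -mulrBl -natrB// subSnn mul1r => /(_ nd).
by rewrite ltNge si.
Qed.

End RcllPaths.

Section JumpEvents.
Context {R : realType} {d : measure_display} {T : measurableType d}.
Variable X : R -> T -> R.
Hypothesis rX : rcll X.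
Hypothesis mX : forall s, 0 <= s -> measurable_fun setT (X s).
Implicit Types (r c t : R) (w : T).

Lemma sup_jump_leP r t w :
  (sup_jump X t w <= r%:E)%E <-> forall s, 0 < s <= t -> path_jump (X ^~ w) s <= r.
Proof.
split=> [h s st|h].
  rewrite -lee_fin; apply: le_trans h; apply: ereal_sup_ubound.
  by exists s => //=; rewrite in_itv/=.
apply: ge_ereal_sup => y [s /=]; rewrite in_itv/= => st <-.
by rewrite lee_fin; exact: h.
Qed.

Definition incr_event t c n : set T := [set w | small_increments (X ^~ w) t c n].

Lemma measurable_incr_event t c n : 0 <= t -> measurable (incr_event t c n).
Proof.
move=> t0; rewrite (_ : incr_event t c n = \bigcap_(k < n.+1)
  [set w | X (k.+1%:R * (t / n.+1%:R)) w - X (k%:R * (t / n.+1%:R)) w <= c]); last first.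
  apply/seteqP; split=> w h.
    by move=> k kn; exact: (h k kn).
  by move=> k kn; exact: (h k kn).
apply: bigcap_measurable => [|k _]; first by exists 0%N.
have mD : measurable_fun setT
    (X (k.+1%:R * (t / n.+1%:R)) \- X (k%:R * (t / n.+1%:R))).
  by apply: measurable_funB; apply: mX; rewrite mulr_ge0 ?divr_ge0.
rewrite -[X in measurable X]setTI.
have := mD measurableT `]-oo, c]%classic (measurable_itv _).
by rewrite set_itvNyc.
Qed.

Lemma small_jumps_incr_event t r c w : 0 < t -> 0 <= r -> r < c ->
  (sup_jump X t w <= r%:E)%E -> \forall n \near \oo, incr_event t c n w.
Proof.
move=> t0 r0 rc /sup_jump_leP h; exact: small_jumps_near (rX w) t0 r0 rc h.
Qed.

Lemma big_jump_incr_event t c w : 0 < t ->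
  ~ (sup_jump X t w <= c%:E)%E -> \forall n \near \oo, ~ incr_event t c n w.
Proof.
move=> t0 /sup_jump_leP/existsNP[s /not_implyP[st /negP]]; rewrite -ltNge => cj.
exact: big_jump_near (rX w) st cj.
Qed.

(** The supremum runs over uncountably many times, so measurability is borrowed from the increments:
    no jump exceeds r exactly when, for each level c = r + 1 / (m + 1), all sufficiently fine
    partitions have increments at most c. *)
Lemma measurable_sup_jump_le t r : 0 < t -> 0 <= r ->
  measurable [set w | (sup_jump X t w <= r%:E)%E].
Proof.
move=> t0 r0.
have -> : [set w | (sup_jump X t w <= r%:E)%E] = \bigcap_m \bigcup_N
    \bigcap_(n in [set n | (N <= n)%N]) incr_event t (r + m.+1%:R^-1) n.
  apply/seteqP; split=> w /=.
    move=> h m _; have : r < r + m.+1%:R^-1 by rewrite ltrDl invr_gt0.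
    move=> /(small_jumps_incr_event t0 r0)/(_ h)[N _ hN].
    by exists N => // n Nn; exact: hN.
  move=> h; apply/sup_jump_leP => s st; rewrite leNgt; apply/negP => rj.
  have /ltr_add_invr[m hm] := rj.
  have [N _ hN] := h m Logic.I.
  have : ~ (sup_jump X t w <= (r + m.+1%:R^-1)%:E)%E.
    by move=> /sup_jump_leP/(_ s st); rewrite leNgt hm.
  move=> /(big_jump_incr_event t0)[N' _ hN'].
  apply: (hN' (maxn N N')); first exact: leq_maxr.
  by apply: hN; exact: leq_maxl.
apply: bigcap_measurable => [|m _]; first by exists 0%N.
apply: bigcup_measurable => N _.
apply: bigcap_measurable => [|n _]; first by exists N => /=.
by apply: measurable_incr_event; exact: ltW.
Qed.

(** The levels r - r / (m + 2) are positive, as [measurable_sup_jump_le] requires, and increase to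
    r. *)
Lemma sup_jump_ltE t r : 0 < t -> 0 < r ->
  [set w | (sup_jump X t w < r%:E)%E] =
  \bigcup_m [set w | (sup_jump X t w <= (r - r / m.+2%:R)%:E)%E].
Proof.
move=> t0 r0; apply/seteqP; split=> w /=; last first.
  move=> [m _ /= h]; apply: (le_lt_trans h).
  by rewrite lte_fin ltrBlDr ltrDl divr_gt0.
move=> h; case E : (sup_jump X t w) h => [b| |]//=; last first.
  by move=> _; exists 0%N => //=; rewrite E leNye.
rewrite lte_fin -subr_gt0 => br.
have : 0 < (r - b) / r by rewrite divr_gt0.
move=> /ltr_add_invr[m]; rewrite add0r => hm.
exists m => //=; rewrite E lee_fin.
have : m.+2%:R^-1 < (r - b) / r.
  by apply: le_lt_trans hm; rewrite lef_pV2 ?posrE// ler_nat.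
rewrite ltr_pdivlMr// mulrC => hm'.
by rewrite lerBrDr -lerBrDl ltW.
Qed.

Lemma measurable_sup_jump_lt t r : 0 < t -> 0 < r ->
  measurable [set w | (sup_jump X t w < r%:E)%E].
Proof.
move=> t0 r0; rewrite sup_jump_ltE//; apply: bigcup_measurable => m _.
apply: measurable_sup_jump_le => //.
by rewrite subr_ge0 ler_pdivrMr// ler_peMr ?ltW// ltr1n.
Qed.

End JumpEvents.

(** * The Markov property *)

Section Disintegration.
Context {R : realType} {d1 d2 : measure_display}.
Context {S : measurableType d1} {E : measurableType d2}.
Variables (mu : giry S R) (k : S -> giry E R) (m : giry (S * E)%type R).
Hypothesis mk : measurable_fun setT k.
Hypothesis mE : forall (A : set S) (B : set E), measurable A -> measurable B ->
  m (A `*` B) = (\int[mu]_(w in A) k w B)%E.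

(** The product of the Dirac mass at w with [k w]; averaged over [mu] it gives the law with which
    [m] is identified. *)
Let f (w : S) : giry (S * E)%type R := giry_prod (giry_ret w, k w).

Let mf : measurable_fun setT f.
Proof.
apply: (measurableT_comp measurable_giry_prod).
exact: measurable_fun_pair measurable_giry_ret mk.
Qed.

Let int_f (h : S * E -> \bar R) w : measurable_fun setT h ->
  (forall z, 0 <= h z)%E -> giry_int (f w) h = (\int[k w]_y h (w, y))%E.
Proof.
move=> mh h0; rewrite giry_int_prod2//; apply: eq_integral => y _.
by rewrite giry_int_ret//; exact: measurable_fun_pair1.
Qed.

Lemma measurable_disintegration (h : S * E -> \bar R) : measurable_fun setT h ->
  (forall z, 0 <= h z)%E -> measurable_fun setT (fun w => \int[k w]_y h (w, y))%E.
Proof.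
move=> mh h0; rewrite (_ : (fun w => _) = (giry_int ^~ h) \o f).
  by apply: measurableT_comp => //; exact: measurable_giry_int.
by apply/funext => w /=; rewrite int_f.
Qed.

(** Rectangles form a pi-system generating the product sigma-algebra, so agreement on them
    identifies [m] with a Giry bind, whose integrals are iterated integrals. *)
Lemma integral_disintegration (h : S * E -> \bar R) : measurable_fun setT h ->
  (forall z, 0 <= h z)%E ->
  (\int[m]_z h z = \int[mu]_w \int[k w]_y h (w, y))%E.
Proof.
move=> mh h0.
have e : forall C, measurable C -> m C = giry_bind mu mf C.
  pose G : set (set (S * E)) := [set A `*` B | A in measurable & B in measurable].
  apply: (measure_unique G (fun=> setT)).
  - exact: measurable_prod_measurableType.
  - move=> _ _ [A1 mA1 [B1 mB1 <-]] [A2 mA2 [B2 mB2 <-]].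
    exists (A1 `&` A2); first exact: measurableI.
    by exists (B1 `&` B2); [exact: measurableI|rewrite setXI].
  - by move=> _; exists setT => //; exists setT => //; rewrite setXTT.
  - by apply/seteqP; split => // z _; exists 0%N.
  - move=> _ [A mA [B mB <-]]; apply: (etrans (mE mA mB)).
    transitivity (giry_int (giry_map mf mu) (giry_ev ^~ (A `*` B))) => //.
    rewrite giry_int_map; last 2 first.
    - by apply: measurable_giry_ev; exact: measurableX.
    - by move=> ?; exact: measure_ge0.
    rewrite /giry_int integral_mkcond; apply: eq_integral => w _ /=.
    rewrite /patch /giry_ev /f /giry_prod /= product_measure1E//.
    rewrite /giry_ret /= diracE.
    by case: (w \in A); rewrite ?mul1e ?mul0e.
  - by move=> _; apply: (le_lt_trans (@sprobability_setT _ _ _ m)); exact: ltry.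
transitivity (giry_int (giry_bind mu mf) h).
  rewrite /giry_int; apply: eq_measure_integral => C mC _; exact: e.
rewrite giry_int_bind//; apply: eq_integral => w _; exact: int_f.
Qed.

End Disintegration.

Section MarkovProperty.
Context {R : realType} {d : measure_display} {T : measurableType d}.
Variables (P : R -> probability T R) (X : R -> T -> R).
Hypothesis markov : is_markov P X.
Implicit Types (c h s t u x : R) (w : T).

(* The sample space carrying the sigma-algebra natural_filtration X s, so that
   adaptedness becomes plain measurability. *)
Definition past s : Type := g_sigma_algebraType
  (\bigcup_(u in `[0, s]) preimage_set_system setT (X u) measurable).

HB.instance Definition _ s := Measurable.on (past s).

Lemma markov_measurable s : 0 <= s -> measurable_fun setT (X s).
Proof. by have [/(_ s) mX _ _ _] := markov => /mX[]. Qed.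

Lemma markov_ge0 s w : 0 <= s -> 0 <= X s w.
Proof. by have [/(_ s) mX _ _ _] := markov => /mX[]. Qed.

Lemma natural_filtration_measurable s A : natural_filtration X s A -> measurable A.
Proof.
apply: smallest_sub; first exact: sigma_algebra_measurable.
move=> _ [u /= us [B mB <-]]; apply: markov_measurable => //.
by move: us; rewrite in_itv/= => /andP[].
Qed.

Lemma measurable_past_id s : measurable_fun setT (id : T -> past s).
Proof. by move=> _ A mA; rewrite setTI; exact: natural_filtration_measurable mA. Qed.

Lemma measurable_past s u : 0 <= u <= s ->
  measurable_fun setT (X u : past s -> R).
Proof.
move=> us _ B mB; apply: sub_sigma_algebra; exists u; first by rewrite /= in_itv.
by exists B.
Qed.

Section Step.
Variables (x s h : R).
Hypotheses (x0 : 0 <= x) (s0 : 0 <= s) (h0 : 0 <= h).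

Let mXh := markov_measurable h0.
Let mXsh := markov_measurable (addr_ge0 s0 h0).

Let transition (w : past s) : giry R R :=
  giry_map mXh (P (X s w) : giry T R).

Let measurable_transition : measurable_fun setT transition.
Proof.
apply: measurable_giry_codensity => // B mB.
have [_ _ mP _] := markov.
(* The kernel is assumed measurable on [0, oo[ only, which is where [X s] takes its values. *)
apply: (@measurable_comp _ _ _ _ _ _ (`[0, +oo[%classic : set (R))
    (fun y => P y (X h @^-1` B)) setT (X s : past s -> R)).
- exact: measurable_itv.
- by move=> _ [w _ <-] /=; rewrite in_itv/= andbT; exact: markov_ge0.
- exact: mP.
- by apply: measurable_past; rewrite s0 lexx.
Qed.

Let pair_future (w : T) : (past s * R)%type := (w, X (s + h) w).

Let measurable_pair_future : measurable_fun setT pair_future.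
Proof.
exact: (@measurable_fun_pair _ _ _ _ _ _ (id : T -> past s) (X (s + h))
  (@measurable_past_id s) mXsh).
Qed.

Let mu : giry (past s) R := giry_map (@measurable_past_id s) (P x : giry T R).
Let joint : giry (past s * R)%type R :=
  giry_map measurable_pair_future (P x : giry T R).

Let joint_rectangle (A : set (past s)) (B : set (R)) :
  measurable A -> measurable B ->
  joint (A `*` B) = (\int[mu]_(w in A) transition w B)%E.
Proof.
move=> mA mB; have [_ _ _ mk] := markov.
transitivity (P x (A `&` X (s + h) @^-1` B)); first by [].
rewrite mk//; rewrite integral_mkcond [RHS]integral_mkcond.
have mf : measurable_fun setT ((fun w : past s => transition w B) \_ A).
  apply/(measurable_restrictT _ _).1 => //; apply: measurable_funTS.
  exact: (measurableT_comp (measurable_giry_ev mB) measurable_transition).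
have := @giry_int_map _ _ _ _ R _ (@measurable_past_id s) (P x : giry T R) _ mf.
rewrite /giry_int => ->// w; rewrite /patch; case: ifP => // _; exact: measure_ge0.
Qed.

Variable g : (past s * R)%type -> \bar R.
Hypotheses (mg : measurable_fun setT g) (g0 : forall z, (0 <= g z)%E).

Let int_transition (w : past s) :
  (\int[transition w]_y g (w, y) = \int[P (X s w)]_w' g (w, X h w'))%E.
Proof.
have mgw : measurable_fun setT (fun y => g (w, y)) by exact: measurable_fun_pair2.
exact: (@giry_int_map _ _ _ _ R _ mXh (P (X s w) : giry T R) _ mgw).
Qed.

Lemma measurable_markov_integral :
  measurable_fun setT (fun w : T => \int[P (X s w)]_w' g (w, X h w'))%E.
Proof.
have := measurable_disintegration measurable_transition mg g0.
move=> /measurableT_comp/(_ (@measurable_past_id s)).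
by congr (measurable_fun _ _); apply/funext => w /=; rewrite int_transition.
Qed.

(** The definition of the Markov property treats rectangles, a past event and an event for X_{s+h}.
    Increments couple X_s with X_{s+h}, so a joint function of the past and of X_{s+h} is needed. *)
Lemma markov_integral :
  (\int[P x]_w g (w, X (s + h) w) =
   \int[P x]_w \int[P (X s w)]_w' g (w, X h w'))%E.
Proof.
have := integral_disintegration measurable_transition joint_rectangle mg g0.
rewrite -[LHS]/(giry_int joint g) giry_int_map// => e; apply: (etrans e).
have mi := measurable_disintegration measurable_transition mg g0.
have := @giry_int_map _ _ _ _ R _ (@measurable_past_id s) (P x : giry T R) _ mi.
move=> /(_ (fun w => integral_ge0 _ _)) e'; apply: (etrans (e' _)) => [w y _|].
  exact: g0.
by apply: eq_integral => w _ /=; rewrite int_transition.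
Qed.

End Step.

End MarkovProperty.

(** * Small-time behaviour of the transition laws *)

Section SmallTime.
Context {R : realType}.
Implicit Types (c h l u w y C D N : R).

(** One constant serves all l up to Lam, because [solution_upto_le] confines all these flows to the
    same [0, M] up to time 1. *)
Lemma flow_expansion a (Phi : R -> R) (Lam : R) : regular_mechanism a Phi ->
  exists2 C, 0 <= C & forall l f, 0 <= l <= Lam ->
    solution_upto 1 Phi (fun=> l) f -> forall h, 0 <= h <= 1 ->
    `|f h - l| <= C * h /\ `|f h - l + h * Phi l| <= C * h ^+ 2.
Proof.
move=> rPhi; have a0 := regular_slope rPhi.
pose M := 2 * `|Lam| * expR (2 * a).
have M0 : 0 <= M by rewrite !mulr_ge0 ?expR_ge0.
have [L L0 lipL] := regular_lipschitz rPhi M.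
have LM : 0 <= L * M by rewrite mulr_ge0// ltW.
exists (L * M + L * (L * M)); first by rewrite addr_ge0// mulr_ge0// ltW.
move=> l f /andP[l0 lLam] sf h /andP[h0 h1].
have sf' : solution_upto 1 Phi (fun t => l + 0 * t) f.
  by apply: eq_solution_upto sf => // t _; rewrite mul0r addr0.
have fM x : 0 <= x <= 1 -> f x <= M.
  move=> x01; have := solution_upto_le rPhi l0 (lexx 0) sf' x01.
  rewrite mul0r addr0 mulr1 => /le_trans; apply.
  by rewrite ler_wpM2r ?expR_ge0// ler_wpM2l// (le_trans lLam)// ler_norm.
have [f0 _ _ ef] := sf.
have f00 : f 0 = l.
  by rewrite (ef 0) ?lexx ?ler01// set_itv1 Rintegral_set1 subr0.
have bN x : 0 <= x <= 1 -> `|0 - Phi (f x)| <= L * M.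
  move=> x01; rewrite sub0r normrN.
  have := lipL (f x) 0; rewrite f0// fM// lexx M0 (regular0 rPhi) !subr0.
  move=> /(_ isT isT)/le_trans; apply; rewrite ler_wpM2l ?(ltW L0)//.
  by rewrite ger0_norm ?f0// fM.
have h20 : 0 <= h ^+ 2 by rewrite sqr_ge0.
split.
  have := solution_upto_lipschitz (lexx 0) h0 h1 sf' bN.
  rewrite f00 subr0 => /le_trans; apply; rewrite ler_wpM2r// lerDl.
  by rewrite mulr_ge0// ltW.
have := solution_upto_euler L0 LM lipL (lexx 0) h0 h1 sf' fM bN.
rewrite f00 subr0 sub0r mulNr opprK [Phi l * h]mulrC => /le_trans; apply.
by rewrite ler_wpM2r// lerDr.
Qed.

(** [expR_taylor1] with m = c y. The quadratic error carries y^2 and the error on w - w' carries y;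
    the factor e^{-cy} absorbs both, so the bound is free of [y]. *)
Lemma exp_taylor c y h w w' D N : 0 < c -> 0 <= y -> 0 <= h ->
  c <= w -> c <= w' -> 0 <= N -> `|w - w'| <= N * h -> `|w - w' - h * D| <= N * h ^+ 2 ->
  `|expR (- (y * w)) - expR (- (y * w')) * (1 - y * h * D)| <=
    (4 * N ^+ 2 / c ^+ 2 + N / c) * h ^+ 2.
Proof.
move=> c0 y0 h0 cw cw' N0 h1 h2.
have m1 : c * y <= y * w by rewrite mulrC ler_wpM2l.
have m2 : c * y <= y * w' by rewrite mulrC ler_wpM2l.
have -> : expR (- (y * w)) - expR (- (y * w')) * (1 - y * h * D) =
  (expR (- (y * w)) - expR (- (y * w')) * (1 - (y * w - y * w'))) -
  expR (- (y * w')) * (y * (w - w' - h * D)) by ring.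
rewrite (le_trans (ler_normB _ _))// mulrDl lerD//.
  apply: (le_trans (expR_taylor1 m1 m2)).
  have -> : (y * w - y * w') ^+ 2 = y ^+ 2 * `|w - w'| ^+ 2.
    by rewrite -mulrBr exprMn real_normK ?num_real.
  have hh : `|w - w'| ^+ 2 <= (N * h) ^+ 2.
    by rewrite ler_pXn2r ?nnegrE ?mulr_ge0.
  apply: (@le_trans _ _ ((y ^+ 2 * expR (- (c * y))) * (N * h) ^+ 2)).
    rewrite mulrA [expR _ * _]mulrC ler_wpM2l//.
    by rewrite mulr_ge0 ?sqr_ge0 ?expR_ge0.
  apply: (@le_trans _ _ (4 / c ^+ 2 * (N * h) ^+ 2)).
    by rewrite ler_wpM2r ?sqr_ge0// sqr_expR_le.
  by rewrite exprMn le_eqVlt; apply/orP; left; apply/eqP; ring.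
rewrite !normrM (ger0_norm y0) (ger0_norm (expR_ge0 _)) mulrA.
apply: (@le_trans _ _ (c^-1 * (N * h ^+ 2))).
  apply: ler_pM => //; first by rewrite mulr_ge0 ?expR_ge0.
  apply: le_trans (id_expR_le y c0).
  by rewrite mulrC ler_wpM2l// ler_expR lerN2.
by rewrite mulrA [c^-1 * _]mulrC.
Qed.

End SmallTime.

Lemma integrable_affine {R : realType} {d : measure_display} {T : measurableType d}
    (mu : {measure set T -> \bar R}) (D : set T) (a : R) (f g : T -> R) :
  measurable D -> mu.-integrable D (EFin \o f) -> mu.-integrable D (EFin \o g) ->
  mu.-integrable D (EFin \o (fun w => a * f w + g w)).
Proof.
by move=> mD fi gi; apply: eq_integrable (integrableD mD (integrableZl mD a fi) gi).
Qed.

(** * Polynomials in e^{-z} as test functions of an increment *)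

Section PolynomialTest.
Context {R : realType} {d : measure_display} {T : measurableType d}.
Variables (P : R -> probability T R) (X : R -> T -> R) (alpha beta : R).
Variable nu : {sigma_finite_measure set (measurableTypeR R) -> \bar R}.
Variable v : R -> R -> R.
Hypothesis triple : is_branching_triple alpha beta nu.
Hypothesis markov : is_markov P X.
Hypothesis sol_v : forall l, 0 <= l ->
  is_unique_solution (branching_mechanism alpha beta nu) (fun=> l) (v ^~ l).
Hypothesis laplace_v : forall x t l, 0 <= x -> 0 <= t -> 0 <= l ->
  'E_(P x)[fun w => expR (- l * X t w)]%E = (expR (- x * v t l))%:E.
Implicit Types (c h l t u x y z C D N : R) (p q : {poly R}) (i j : nat) (w : T).

Let Phi := branching_mechanism alpha beta nu.
Let pos : set (measurableTypeR R) := `]0, +oo[.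
Let mpos : measurable pos. Proof. exact: measurable_itv. Qed.

Let mX h : 0 <= h -> measurable_fun setT (X h).
Proof. exact: (markov_measurable markov). Qed.

Let X_ge0 h w : 0 <= h -> 0 <= X h w.
Proof. exact: (markov_ge0 markov). Qed.

Lemma measurable_exp_state h l : 0 <= h ->
  measurable_fun setT (fun w => expR (- l * X h w)).
Proof.
move=> h0; apply: (@measurableT_comp _ _ _ _ _ _ expR) => //.
by apply: measurable_funM => //; exact: mX.
Qed.

Lemma integrable_exp_state y h l : 0 <= h -> 0 <= l ->
  (P y).-integrable setT (EFin \o (fun w => expR (- l * X h w))).
Proof.
move=> h0 l0; apply: measurable_bounded_integrable => //.
- by rewrite (le_lt_trans (probability_le1 (P y) measurableT))// ltry.
- exact: measurable_exp_state.
- exists 1; split; first exact: num_real.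
  move=> M M1 w _ /=; rewrite ger0_norm ?expR_ge0//.
  by rewrite (le_trans _ (ltW M1))// expR_le1 mulNr oppr_le0 mulr_ge0// X_ge0.
Qed.

Lemma Rintegral_exp_state y h l : 0 <= y -> 0 <= h -> 0 <= l ->
  \int[P y]_w expR (- l * X h w) = expR (- y * v h l).
Proof.
by move=> y0 h0 l0; have := laplace_v y0 h0 l0; rewrite unlock /Rintegral => ->.
Qed.

(** This is e^{-j (X_h - y)} e^{-u X_h}, arranged so that its mean is a Laplace transform of X_h. *)
Definition tilted j y u h w : R := expR (j%:R * y) * expR (- (u + j%:R) * X h w).

Lemma tiltedE j y u h w :
  tilted j y u h w = expR (- (X h w - y)) ^+ j * expR (- u * X h w).
Proof. by rewrite /tilted -expRM_natl -!expRD; congr expR; ring. Qed.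

Lemma tilted_integrable j y u h : 0 <= u -> 0 <= h ->
  (P y).-integrable setT (EFin \o tilted j y u h).
Proof.
move=> u0 h0; have uj : 0 <= u + j%:R by rewrite addr_ge0.
apply: eq_integrable (integrableZl measurableT (expR (j%:R * y))
  (integrable_exp_state y h0 uj)) => //.
Qed.

(** The mean is exactly exp(- y (v_h(u + j) - j)), and v_h(u + j) - j equals u - h Phi(u + j) up to
    order h^2. *)
Lemma tilted_estimate j c (C0 : R) : 0 < c -> exists C h0, [/\ 0 <= C, 0 < h0 &
  forall h u y, 0 <= h <= h0 -> c <= u <= C0 -> 0 <= y ->
  `|\int[P y]_w tilted j y u h w - expR (- (y * u)) * (1 + y * h * Phi (u + j%:R))|
    <= C * h ^+ 2].
Proof.
move=> c0; have [N N0 hN] := flow_expansion (C0 + j%:R) (branching_regular triple).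
have c20 : 0 < c / 2 by rewrite divr_gt0.
(* The bound on h keeps v_h(u + j) - j above c / 2, whence the rate c / 2 in the constant. *)
exists (4 * N ^+ 2 / (c / 2) ^+ 2 + N / (c / 2)), (Num.min 1 (c / 2 / (N + 1))).
split.
- by rewrite addr_ge0// divr_ge0 ?mulr_ge0 ?sqr_ge0// ltW.
- by rewrite lt_min ltr01 divr_gt0// ltr_wpDl.
move=> h u y /andP[h0]; rewrite le_min => /andP[h1 hc] /andP[cu uC] y0.
have u0 : 0 <= u by lra.
have uj0 : 0 <= u + j%:R by rewrite addr_ge0.
have ujC : 0 <= u + j%:R <= C0 + j%:R by rewrite uj0 lerD2r.
have s1 : solution_upto 1 Phi (fun=> u + j%:R) (v ^~ (u + j%:R)).
  by apply: is_solution_upto => //; have [] := sol_v uj0.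
have h01 : 0 <= h <= 1 by rewrite h0.
have [e1 e2] := hN _ _ ujC s1 h h01.
have -> : \int[P y]_w tilted j y u h w =
    expR (- (y * (v h (u + j%:R) - j%:R))).
  have ie := integrable_exp_state y h0 uj0.
  by rewrite RintegralZl// Rintegral_exp_state// -expRD; congr expR; ring.
rewrite -[Phi _]opprK mulrN.
have e1' : `|v h (u + j%:R) - j%:R - u| <= N * h.
  by rewrite -addrA -opprD [j%:R + u]addrC.
have e2' : `|v h (u + j%:R) - j%:R - u - h * - Phi (u + j%:R)| <= N * h ^+ 2.
  by rewrite mulrN opprK -[X in X + _]addrA -opprD [j%:R + u]addrC.
have hNc : N * h <= c / 2.
  have : (N + 1) * h <= c / 2 by rewrite mulrC -ler_pdivlMr// ltr_wpDl.
  by lra.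
apply: exp_taylor e1' e2' => //; last by lra.
by move: e1; rewrite ler_norml => /andP[]; lra.
Qed.

Definition weighted p y u h w : R :=
  rho (X h w - y) * p.[expR (- (X h w - y))] * expR (- u * X h w).

Definition levy_weighted p u z : R := rho z * p.[expR (- z)] * expR (- u * z).

Definition small_time_limit p u : R :=
  2 * beta * p.[1] + \int[nu]_(z in pos) levy_weighted p u z.

(** Stated as a property of [p] stable under linear combinations, which reduces polynomials to
    monomials; integrability belongs to it because the integrals have to be split. *)
Definition small_time_test p := [/\
  forall y u h, 0 <= u -> 0 <= h -> (P y).-integrable setT (EFin \o weighted p y u h),
  forall u, 0 <= u -> nu.-integrable pos (EFin \o levy_weighted p u) &
  forall c (C0 : R), 0 < c -> exists C h0, [/\ 0 <= C, 0 < h0 &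
    forall h u y, 0 <= h <= h0 -> c <= u <= C0 -> 0 <= y ->
    `|\int[P y]_w weighted p y u h w -
      y * h * expR (- (y * u)) * small_time_limit p u| <= C * h ^+ 2]].

(** The weight [rho] turns the monomial into a second difference of [tilted] in j. The leading term
    e^{-yu} does not depend on j and cancels, while the terms in h form the second difference of Phi
    at u + i. *)
Lemma small_time_test_Xn i : small_time_test 'X^i.
Proof.
have wE y u h : weighted 'X^i y u h =
    fun w => tilted i y u h w - 2 * tilted i.+1 y u h w + tilted i.+2 y u h w.
  by apply/funext => w; rewrite /weighted !tiltedE hornerXn /rho !exprS; ring.
have lE u z : levy_weighted 'X^i u z = rho z * expR (- (u + i%:R) * z).
  rewrite /levy_weighted hornerXn -expRM_natl -mulrA -expRD.
  by congr (_ * expR _); ring.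
split.
- move=> y u h u0 h0; rewrite wE.
  have i0 := tilted_integrable i y u0 h0.
  have i1 := tilted_integrable i.+1 y u0 h0.
  have i2 := tilted_integrable i.+2 y u0 h0.
  apply: eq_integrable (integrable_affine (-2) measurableT i1
    (integrable_affine 1 measurableT i0 i2)) => // w _ /=.
  by congr EFin; ring.
- move=> u u0; have := rho_expR_integrable triple (addr_ge0 u0 (ler0n R i)).
  by apply: eq_integrable => // z _ /=; rewrite lE.
- move=> c C0 c0.
  have [D0 [h0 [D00 h00 e0]]] := tilted_estimate i C0 c0.
  have [D1 [h1 [D10 h10 e1]]] := tilted_estimate i.+1 C0 c0.
  have [D2 [h2 [D20 h20 e2]]] := tilted_estimate i.+2 C0 c0.
  exists (D0 + 2 * D1 + D2), (Num.min h0 (Num.min h1 h2)); split.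
  + by rewrite !addr_ge0// mulr_ge0.
  + by rewrite !lt_min h00 h10.
  move=> h u y; rewrite !le_min => /and4P[h_ge0 hh0 hh1 hh2] cu y0.
  have u0 : 0 <= u by lra.
  have := e0 h u y; rewrite h_ge0 hh0 => /(_ isT cu y0) {}e0.
  have := e1 h u y; rewrite h_ge0 hh1 => /(_ isT cu y0) {}e1.
  have := e2 h u y; rewrite h_ge0 hh2 => /(_ isT cu y0) {}e2.
  have i0 := tilted_integrable i y u0 h_ge0.
  have i1 := tilted_integrable i.+1 y u0 h_ge0.
  have i2 := tilted_integrable i.+2 y u0 h_ge0.
  have i1' : (P y).-integrable setT (EFin \o (fun w => 2 * tilted i.+1 y u h w)).
    by apply: eq_integrable (integrableZl measurableT 2 i1).
  have iB := integrableB measurableT i0 i1'.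
  have -> : \int[P y]_w weighted 'X^i y u h w = \int[P y]_w tilted i y u h w -
      2 * \int[P y]_w tilted i.+1 y u h w + \int[P y]_w tilted i.+2 y u h w.
    by rewrite wE RintegralD// RintegralB// RintegralZl.
  have -> : small_time_limit 'X^i u = Phi (u + i%:R) - 2 * Phi (u + i.+1%:R) +
      Phi (u + i.+2%:R).
    rewrite /small_time_limit hornerXn expr1n mulr1.
    have -> : \int[nu]_(z in pos) levy_weighted 'X^i u z = rho_integral nu (u + i%:R).
      by apply: eq_Rintegral => z _; rewrite lE.
    rewrite -(second_difference_branching triple) ?addr_ge0//.
    rewrite /second_difference -!addrA !natr1 -[i.+2%:R]natr1 -[i.+1%:R]natr1.
    by rewrite -addrA.
  move: (\int[P y]_w tilted i y u h w) (\int[P y]_w tilted i.+1 y u h w)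
    (\int[P y]_w tilted i.+2 y u h w) e0 e1 e2 => t0 t1 t2.
  rewrite !ler_norml => /andP[a1 a2] /andP[b1 b2] /andP[c1 c2].
  by apply/andP; split; lra.
Qed.

Lemma small_time_test_linear (a : R) p q :
  small_time_test p -> small_time_test q -> small_time_test (a *: p + q).
Proof.
move=> [ip lp ep] [iq lq eq].
have wE y u h : weighted (a *: p + q) y u h =
    fun w => a * weighted p y u h w + weighted q y u h w.
  by apply/funext => w; rewrite /weighted hornerD hornerZ; ring.
have lE u : levy_weighted (a *: p + q) u =
    fun z => a * levy_weighted p u z + levy_weighted q u z.
  by apply/funext => z; rewrite /levy_weighted hornerD hornerZ; ring.
split.
- move=> y u h u0 h0; rewrite wE.
  exact: integrable_affine measurableT (ip y u h u0 h0) (iq y u h u0 h0).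
- move=> u u0; rewrite lE.
  exact: integrable_affine mpos (lp u u0) (lq u u0).
- move=> c C0 c0.
  have [D1 [h1 [D10 h10 e1]]] := ep c C0 c0.
  have [D2 [h2 [D20 h20 e2]]] := eq c C0 c0.
  exists (`|a| * D1 + D2), (Num.min h1 h2); split.
  + by rewrite !addr_ge0// mulr_ge0.
  + by rewrite !lt_min h10.
  move=> h u y; rewrite !le_min => /and3P[h_ge0 hh1 hh2] cu y0.
  have u0 : 0 <= u by lra.
  have := e1 h u y; rewrite h_ge0 hh1 => /(_ isT cu y0) {}e1.
  have := e2 h u y; rewrite h_ge0 hh2 => /(_ isT cu y0) {}e2.
  have iap : (P y).-integrable setT (EFin \o (fun w => a * weighted p y u h w)).
    by apply: eq_integrable (integrableZl measurableT a (ip y u h u0 h_ge0)).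
  have lap : nu.-integrable pos (EFin \o (fun z => a * levy_weighted p u z)).
    by apply: eq_integrable (integrableZl mpos a (lp u u0)).
  have -> : \int[P y]_w weighted (a *: p + q) y u h w =
      a * \int[P y]_w weighted p y u h w + \int[P y]_w weighted q y u h w.
    by rewrite wE RintegralD// ?RintegralZl//; [exact: ip|exact: iq].
  have -> : small_time_limit (a *: p + q) u =
      a * small_time_limit p u + small_time_limit q u.
    rewrite /small_time_limit lE RintegralD// ?RintegralZl//.
    - by rewrite hornerD hornerZ; ring.
    - exact: lp.
    - exact: lq.
  have -> (r s t l l' : R) : a * r + s - t * (a * l + l') = a * (r - t * l) + (s - t * l').
    by ring.
  rewrite (le_trans (ler_normD _ _))// mulrDl lerD//.
  by rewrite normrM -[leRHS]mulrA ler_wpM2l.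
Qed.

Lemma small_time_test_poly p : small_time_test p.
Proof.
rewrite -[p]coefK poly_def; elim: (size p) => [|n ih].
  (* The zero polynomial, obtained as - 1 + 1. *)
  have := small_time_test_linear (-1) (small_time_test_Xn 0) (small_time_test_Xn 0).
  by rewrite big_ord0 scaleN1r addNr.
by rewrite big_ord_recr/= addrC; exact: small_time_test_linear (small_time_test_Xn n) ih.
Qed.

End PolynomialTest.

(** * Weighted polynomial approximation of a step *)

Section PolynomialStep.
Context {R : realType}.
Implicit Types (a b e x E : R).

Lemma polynomial_step a b e E : b < a -> a < 1 -> 0 < e -> 1 <= E ->
  exists p : {poly R}, `|p.[1]| <= e /\ forall x, 0 <= x <= E ->
    (x <= b)%R%:R - e * (1 - x) ^+ 2 <= (1 - x) ^+ 2 * p.[x] <=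
    (x < a)%R%:R + e * (1 - x) ^+ 2.
Proof.
move=> ba a1 e0 E1.
pose ramp x := Num.min (Num.max 0 ((a - x) / (a - b))) 1.
pose dl := (1 - a) ^+ 2.
have dl0 : 0 < dl by rewrite exprn_gt0// subr_gt0.
pose den x := Num.max 0 ((1 - x) ^+ 2 - dl) + dl.
have den0 x : 0 < den x by rewrite ltr_wpDl// le_max lexx.
have cmax : continuous (fun x : R => Num.max 0 x).
  apply: (@norm_lipschitz_continuous _ 1) => x y.
  by rewrite mul1r; exact: max0_lipschitz.
have cmin : continuous (fun x : R => Num.min x 1).
  apply: (@norm_lipschitz_continuous _ 1) => x y.
  by rewrite mul1r; exact: min_lipschitz.
have cramp : continuous ramp.
  move=> x; apply: (@continuous_comp _ _ _ (fun x => Num.max 0 ((a - x) / (a - b)))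
    (fun x => Num.min x 1)); last exact: cmin.
  apply: (@continuous_comp _ _ _ (fun x => (a - x) / (a - b)) (fun x => Num.max 0 x));
    last exact: cmax.
  apply: cvgM; last exact: cvg_cst.
  by apply: cvgB; [exact: cvg_cst|exact: cvg_id].
have cden : continuous den.
  move=> x; apply: cvgD; last exact: cvg_cst.
  apply: (@continuous_comp _ _ _ (fun x => (1 - x) ^+ 2 - dl) (fun x => Num.max 0 x));
    last exact: cmax.
  apply: cvgB; last exact: cvg_cst.
  by apply: cvgM; apply: cvgB; [exact: cvg_cst|exact: cvg_id|exact: cvg_cst|exact: cvg_id].
have cpsi : continuous (fun x => ramp x / den x).
  move=> x; apply: cvgM; first exact: cramp.
  by apply: cvgV; [rewrite gt_eqF|exact: cden].
have ramp01 x : 0 <= ramp x <= 1.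
  by rewrite /ramp le_min ler01 le_max lexx ge_min lexx orbT.
have ab0 : 0 < a - b by rewrite subr_gt0.
have ramp0 x : a <= x -> ramp x = 0.
  move=> ax; rewrite /ramp max_l ?min_l// ler_pdivrMr// mul0r; lra.
have ramp1 x : x <= b -> ramp x = 1.
  move=> xb; have h : 1 <= (a - x) / (a - b) by rewrite ler_pdivlMr// mul1r; lra.
  by rewrite /ramp max_r ?min_r// (le_trans _ h).
have psiE x : (1 - x) ^+ 2 * (ramp x / den x) = ramp x.
  have [ax|xa] := leP a x; first by rewrite ramp0// mul0r mulr0.
  have dx : dl <= (1 - x) ^+ 2 by rewrite ler_pXn2r// ?nnegrE; lra.
  rewrite /den max_r ?subr_ge0// subrK mulrCA divff ?mulr1//.
  by rewrite gt_eqF// (lt_le_trans dl0).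
have [p hp] := weierstrass cpsi (lt_le_trans ltr01 E1) e0.
exists p; split.
  by have := hp 1; rewrite ler01 E1 ramp0 ?(ltW a1)// mul0r subr0; apply.
move=> x xE; have := hp x xE; rewrite ler_distl => /andP[h1 h2].
have s0 : 0 <= (1 - x) ^+ 2 by rewrite sqr_ge0.
have k1 := ler_wpM2l s0 h1; have k2 := ler_wpM2l s0 h2.
rewrite mulrBr psiE [_ * e]mulrC in k1; rewrite mulrDr psiE [_ * e]mulrC in k2.
apply/andP; split.
  apply: le_trans k1; rewrite lerD2r.
  by case: (leP x b) => [/ramp1 ->//|_]; case/andP: (ramp01 x).
apply: (le_trans k2); rewrite lerD2r.
by case: (ltP x a) => [_|/ramp0 ->//]; case/andP: (ramp01 x).
Qed.

Lemma expR_step a b e E : 0 < a -> a < b -> 0 < e -> 1 <= E ->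
  exists p : {poly R}, `|p.[1]| <= e /\ forall z, expR (- z) <= E ->
    (b <= z)%R%:R - e * rho z <= rho z * p.[expR (- z)] <= (a < z)%R%:R + e * rho z.
Proof.
move=> a0 ab e0 E1; have := @polynomial_step (expR (- a)) (expR (- b)) e E.
rewrite ltr_expR ltrN2 ab expR_lt1 oppr_lt0 a0 => /(_ isT isT e0 E1)[p [p1 hp]].
exists p; split=> // z zE; have := hp (expR (- z)).
by rewrite expR_ge0 zE ler_expR ltr_expR lerN2 ltrN2; apply.
Qed.

End PolynomialStep.

Section ExpRStepBounds.
Context {R : realType}.
Implicit Types (a b e z E : R).

(** Adding e / 2 makes the lower inequality exact, so the indicator of a large increment is
    dominated pointwise under P_y; the error then appears only in the Levy integral of [rho], which
    is finite. *)
Lemma expR_step_above a b e E : 0 < a -> a < b -> 0 < e -> 1 <= E ->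
  exists q : {poly R}, q.[1] <= e /\ forall z, expR (- z) <= E ->
    (b <= z)%R%:R <= rho z * q.[expR (- z)] <= (a < z)%R%:R + e * rho z.
Proof.
move=> a0 ab e0 E1; have e20 : 0 < e / 2 by rewrite divr_gt0.
have [p [p1 hp]] := expR_step a0 ab e20 E1.
exists (p + (e / 2)%:P); split.
  by rewrite hornerD hornerC; move: p1; rewrite ler_norml => /andP[]; lra.
move=> z /hp /andP[h1 h2]; rewrite hornerD hornerC mulrDr.
by apply/andP; split; lra.
Qed.

Lemma expR_step_below a b e E : 0 < a -> a < b -> 0 < e -> 1 <= E ->
  exists q : {poly R}, - e <= q.[1] /\ forall z, expR (- z) <= E ->
    (b <= z)%R%:R - e * rho z <= rho z * q.[expR (- z)] <= (a < z)%R%:R.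
Proof.
move=> a0 ab e0 E1; have e20 : 0 < e / 2 by rewrite divr_gt0.
have [p [p1 hp]] := expR_step a0 ab e20 E1.
exists (p - (e / 2)%:P); split.
  by rewrite hornerD hornerN hornerC; move: p1; rewrite ler_norml => /andP[]; lra.
move=> z /hp /andP[h1 h2]; rewrite hornerD hornerN hornerC mulrDr.
by apply/andP; split; lra.
Qed.

End ExpRStepBounds.

(** * Levy integrals of the test polynomials against the tail on A *)

Section LevyBounds.
Context {R : realType}.
Variables (alpha beta : R).
Variable nu : {sigma_finite_measure set (measurableTypeR R) -> \bar R}.
Hypothesis triple : is_branching_triple alpha beta nu.
Variables (A B : set (measurableTypeR R)) (r a b : R).
Hypotheses (mA : measurable A) (mB : measurable B) (r0 : 0 < r).
Hypotheses (Ar : A `<=` `[r, +oo[) (Br : B `<=` `[r, +oo[).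
(** Outside B, a < z implies A z, which in turn implies b <= z: the transition zone between a and b
    is contained in B. *)
Hypothesis aAB : forall z, a < z -> A z \/ B z.
Hypothesis Abb : forall z, A z -> b <= z \/ B z.
Implicit Types (u z e : R) (q : {poly R}).

Let pos : set (measurableTypeR R) := `]0, +oo[.
Let mpos : measurable pos. Proof. exact: measurable_itv. Qed.

Definition tail_integral (D : set (measurableTypeR R)) u : R :=
  \int[nu]_(z in D) expR (- u * z).

Lemma tail_indic (D : set (measurableTypeR R)) u :
  measurable D -> D `<=` `[r, +oo[ -> 0 <= u ->
  nu.-integrable pos (EFin \o (fun z => \1_D z * expR (- u * z))) /\
  \int[nu]_(z in pos) (\1_D z * expR (- u * z)) = tail_integral D u.
Proof.
move=> mD Dr u0; have Dpos := tail_pos r0 Dr.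
have e : (fun z => \1_D z * expR (- u * z)) = (fun z => expR (- u * z)) \_ D.
  apply/funext => z; rewrite /patch indicE; case: (z \in D); first by rewrite mul1r.
  by rewrite mul0r.
have pD : pos `&` D = D by apply/setIidPr.
split.
  rewrite e -restrict_EFin; apply/integrable_restrict => //.
  by rewrite pD; exact: (tail_expR_integrable triple mD r0 Dr u0).
by rewrite e -Rintegral_mkcondr pD.
Qed.

Lemma tail_integral_ge0 D u : 0 <= tail_integral D u.
Proof. by apply: Rintegral_ge0 => z _; exact: expR_ge0. Qed.

Lemma tail_integral_le D u : measurable D -> D `<=` `[r, +oo[ -> 0 <= u ->
  tail_integral D u <= fine (nu D).
Proof.
move=> mD Dr u0; rewrite -[leRHS]mul1r -Rintegral_cst//.
apply: le_Rintegral => //.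
- exact: (tail_expR_integrable triple mD r0 Dr u0).
- exact: (tail_cst_integrable triple mD r0 Dr).
- move=> z /Dr; rewrite /= in_itv/= andbT => rz.
  by rewrite expR_le1 mulNr oppr_le0 mulr_ge0// ltW// (lt_le_trans r0).
Qed.

Let rho_exp_le u : 0 <= u ->
  \int[nu]_(z in pos) (rho z * expR (- u * z)) <= rho_integral nu 0.
Proof.
move=> u0; apply: le_Rintegral => //.
- exact: (rho_expR_integrable triple u0).
- exact: (rho_expR_integrable triple (lexx 0)).
- move=> z; rewrite /pos/= in_itv/= andbT => z0.
  rewrite ler_wpM2l ?rho_ge0// ler_expR !mulNr mul0r oppr0 oppr_le0.
  by rewrite mulr_ge0// ltW.
Qed.

Let expR_pos_le1 z : pos z -> expR (- z) <= 1.
Proof. by rewrite /pos/= in_itv/= andbT => z0; rewrite expR_le1 oppr_le0 ltW. Qed.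

Lemma small_time_limit_le q u e : 0 <= e -> 0 <= u ->
  nu.-integrable pos (EFin \o levy_weighted q u) ->
  q.[1] <= e -> (forall z, expR (- z) <= 1 ->
    rho z * q.[expR (- z)] <= (a < z)%R%:R + e * rho z) ->
  small_time_limit beta nu q u <=
    tail_integral A u + fine (nu B) + e * (2 * beta + rho_integral nu 0).
Proof.
move=> e0 u0 iq q1 hq; have [b0 _ _ _] := triple.
have [iA EA] := tail_indic mA Ar u0; have [iB EB] := tail_indic mB Br u0.
have ir := rho_expR_integrable triple u0.
have ier : nu.-integrable pos (EFin \o (fun z => e * (rho z * expR (- u * z)))).
  by apply: eq_integrable (integrableZl mpos e ir).
have iBer := integrable_affine 1 mpos iB ier.
have iABer := integrable_affine 1 mpos iA iBer.
have : \int[nu]_(z in pos) levy_weighted q u z <= \int[nu]_(z in pos)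
   (1 * (\1_A z * expR (- u * z)) + (1 * (\1_B z * expR (- u * z)) +
      e * (rho z * expR (- u * z)))).
  apply: le_Rintegral => // z /expR_pos_le1/hq h.
  rewrite !mul1r /levy_weighted mulrA -!mulrDl ler_wpM2r ?expR_ge0//.
  apply: (le_trans h); rewrite addrA lerD2r.
  have [az|_] := ltP a z; last by rewrite addr_ge0// indicE.
  by rewrite !indicE; have [/mem_set -> | /mem_set ->] := aAB az;
    rewrite ?lerDl ?lerDr.
rewrite RintegralD//; last by apply: eq_integrable (integrableZl mpos 1 iA).
rewrite RintegralD//; last by apply: eq_integrable (integrableZl mpos 1 iB).
rewrite !RintegralZl// !mul1r EA EB => hi.
have := tail_integral_le mB Br u0; have := rho_exp_le u0.
rewrite /small_time_limit -/pos.
have : 2 * beta * q.[1] <= 2 * beta * e by rewrite ler_wpM2l ?mulr_ge0.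
move=> h1 /(ler_wpM2l e0) h2 h3.
by lra.
Qed.

Lemma small_time_limit_ge q u e : 0 <= e -> 0 <= u ->
  nu.-integrable pos (EFin \o levy_weighted q u) ->
  - e <= q.[1] -> (forall z, expR (- z) <= 1 ->
    (b <= z)%R%:R - e * rho z <= rho z * q.[expR (- z)]) ->
  tail_integral A u - fine (nu B) - e * (2 * beta + rho_integral nu 0) <=
  small_time_limit beta nu q u.
Proof.
move=> e0 u0 iq q1 hq; have [b0 _ _ _] := triple.
have [iA EA] := tail_indic mA Ar u0; have [iB EB] := tail_indic mB Br u0.
have ir := rho_expR_integrable triple u0.
have ier : nu.-integrable pos (EFin \o (fun z => - e * (rho z * expR (- u * z)))).
  by apply: eq_integrable (integrableZl mpos (- e) ir).
have iBer := integrable_affine (-1) mpos iB ier.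
have iABer := integrable_affine 1 mpos iA iBer.
have : \int[nu]_(z in pos)
   (1 * (\1_A z * expR (- u * z)) + (-1 * (\1_B z * expR (- u * z)) +
      - e * (rho z * expR (- u * z)))) <= \int[nu]_(z in pos) levy_weighted q u z.
  apply: le_Rintegral => // z /expR_pos_le1/hq h.
  rewrite /levy_weighted (_ : 1 * _ + _ =
    (\1_A z - \1_B z - e * rho z) * expR (- u * z)); last by ring.
  rewrite ler_wpM2r ?expR_ge0//; apply: le_trans h; rewrite lerD2r.
  rewrite !indicE; have [/set_mem Az|_] := boolP (z \in A); last first.
    by rewrite sub0r (@le_trans _ _ 0)// oppr_le0.
  by have [->|/mem_set ->] := Abb Az; rewrite ?gerBl// subrr.
rewrite RintegralD//; last by apply: eq_integrable (integrableZl mpos 1 iA).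
rewrite RintegralD//; last by apply: eq_integrable (integrableZl mpos (-1) iB).
rewrite !RintegralZl// mul1r mulN1r EA EB => hi.
have := tail_integral_le mB Br u0; have := rho_exp_le u0.
rewrite /small_time_limit -/pos.
have : 2 * beta * (- e) <= 2 * beta * q.[1] by rewrite ler_wpM2l ?mulr_ge0.
move=> h1 /(ler_wpM2l e0) h2 h3.
by lra.
Qed.

End LevyBounds.

Section Arithmetic.
Context {R : realType}.
Implicit Types (I W h g J n k q e s L : R).

(** These lemmas collect the error terms of [big_increment_estimate]. There I is the mean of
    [big_increment], W that of a test polynomial and L its small-time limit, J the tail integral
    over A, g = y e^{-yu}, and n the mass of B or, in the tail lemmas, of A. *)
Lemma error_above I W h g J n n' k e e' s L : I <= W -> W - h * g * L <= s ->
  s <= h * e' -> h * g * L <= h * g * (J + n + k) ->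
  h * (g * n) <= h * n' -> h * (g * k) <= h * e' -> h * e' + h * e' <= h * e ->
  I - h * g * J <= h * (e + n').
Proof. lra. Qed.

Lemma error_below I W h g J n n' k e e' s L : W <= I -> - s <= W - h * g * L ->
  s <= h * e' -> h * g * (J - n - k) <= h * g * L ->
  h * (g * n) <= h * n' -> h * (g * k) <= h * e' -> h * e' + h * e' <= h * e ->
  - (h * (e + n')) <= I - h * g * J.
Proof. lra. Qed.

Lemma le_of_errors I L L' h g s e : I - h * g * L <= s ->
  h * g * L <= h * g * L' -> s <= e -> I <= h * g * L' + e.
Proof. lra. Qed.

Lemma tail_below I h g q n n' J e e' : 0 <= I -> h * (g * (q + n)) <= h * e' ->
  h * g * J <= h * g * n -> 0 <= h * g * q -> 0 <= h * n' -> 0 <= h * e' ->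
  h * e' + h * e' <= h * e -> - (h * (e + n')) <= I - h * g * J.
Proof. lra. Qed.

Lemma tail_above I h g q n n' J e e' : I <= h * g * q + h * e' ->
  h * (g * (q + n)) <= h * e' -> 0 <= h * g * J -> 0 <= h * g * n ->
  0 <= h * n' -> 0 <= h * e' ->
  h * e' + h * e' <= h * e -> I - h * g * J <= h * (e + n').
Proof. lra. Qed.

End Arithmetic.

(** * Rate of large increments over a short time *)

Section BigIncrements.
Context {R : realType} {d : measure_display} {T : measurableType d}.
Variables (P : R -> probability T R) (X : R -> T -> R) (alpha beta : R).
Variable nu : {sigma_finite_measure set (measurableTypeR R) -> \bar R}.
Variable v : R -> R -> R.
Hypothesis triple : is_branching_triple alpha beta nu.
Hypothesis markov : is_markov P X.
Hypothesis sol_v : forall l, 0 <= l ->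
  is_unique_solution (branching_mechanism alpha beta nu) (fun=> l) (v ^~ l).
Hypothesis laplace_v : forall x t l, 0 <= x -> 0 <= t -> 0 <= l ->
  'E_(P x)[fun w => expR (- l * X t w)]%E = (expR (- x * v t l))%:E.
Implicit Types (h l t u x y z C D N : R) (p q : {poly R}) (w : T).

Variables (A B : set (measurableTypeR R)) (r a c b : R).
Hypotheses (mA : measurable A) (mB : measurable B) (r0 : 0 < r).
Hypotheses (Ar : A `<=` `[r, +oo[) (Br : B `<=` `[r, +oo[).
Hypotheses (a0 : 0 < a) (ac : a < c) (cb : c < b).
Hypothesis aAB : forall z, a < z -> A z \/ B z.
Hypothesis Abb : forall z, A z -> b <= z \/ B z.

Definition big_increment y u h w : R :=
  (c < X h w - y)%R%:R * expR (- u * X h w).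

Lemma measurable_increment_lt h y : 0 <= h ->
  measurable_fun setT (fun w => (c < X h w - y)%R%:R : R).
Proof.
move=> h0; rewrite (_ : (fun w => _) = \1_[set w | c < X h w - y]); last first.
  by apply/funext => w; rewrite indicE; congr (nat_of_bool _)%:R; apply/idP/idP; rewrite inE.
apply: measurable_indic.
have mXy : measurable_fun setT (fun w => X h w - y).
  by apply: measurable_funB => //; exact: (markov_measurable markov).
have := mXy measurableT `]c, +oo[%classic (measurable_itv _).
by rewrite setTI (_ : _ @^-1` _ = [set w | c < X h w - y])//; apply/seteqP; split=> w /=;
  rewrite in_itv/= andbT.
Qed.

Lemma big_increment_integrable y u h : 0 <= u -> 0 <= h ->
  (P y).-integrable setT (EFin \o big_increment y u h).
Proof.
move=> u0 h0; apply: le_integrable (integrable_exp_state markov y h0 u0) => //.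
  apply/measurable_EFinP; apply: measurable_funM.
    exact: measurable_increment_lt.
  exact: (measurable_exp_state markov).
move=> w _ /=; rewrite lee_fin normrM ler_piMl//.
by case: ltP; rewrite ?normr1 ?normr0.
Qed.

Let test := small_time_test_poly triple markov sol_v laplace_v.

Let J0 := rho_integral nu 0.

(** The rate is proportional to y e^{-yu} <= 1 / u <= 1 / c0. Multiplied by the mass of B, where the
    polynomial bounds need not match A, this gives the part of the error that e does not cover. *)
Lemma big_increment_estimate (c0 C0 e : R) : 0 < c0 -> 0 < e ->
  exists2 h0, 0 < h0 & forall h u y, 0 <= h <= h0 -> c0 <= u <= C0 -> 0 <= y ->
  `|\int[P y]_w big_increment y u h w - y * h * expR (- (y * u)) * tail_integral nu A u|
    <= h * (e + fine (nu B) / c0).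
Proof.
move=> c00 e0; have [b0 _ _ _] := triple.
have c_gt0 : 0 < c by exact: lt_trans ac.
have J00 : 0 <= J0 by exact: rho_integral_ge0.
pose K := 2 * beta + J0; have K0 : 0 <= K by rewrite addr_ge0// mulr_ge0.
have rho_c : 0 < rho c by rewrite exprn_gt0// subr_gt0 expR_lt1 oppr_lt0.
have nuA0 : 0 <= fine (nu A) by rewrite fine_ge0.
have nuB0 : 0 <= fine (nu B) by rewrite fine_ge0.
pose e1 := e / 4.
have e10 : 0 < e1 by rewrite divr_gt0.
have e1e : e1 + e1 <= e by rewrite /e1; lra.
pose K1 := K / rho c + fine (nu A) + 1.
have K10 : 0 < K1 by rewrite ltr_wpDl// addr_ge0// divr_ge0// ltW.
(* Since y^2 e^{-uy} <= 4 / c0^2, any y > M has y e^{-uy} <= e1 / K1, where K1 dominates the sum of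
   the two rates to be compared. *)
pose M := 4 / c0 ^+ 2 * K1 / e1.
have M0 : 0 < M by rewrite !(mulr_gt0, divr_gt0, exprn_gt0)// invr_gt0// exprn_gt0.
(* The Levy integral of the weighted error is at most eps K, and the factor y e^{-uy} <= 1 / c0
   brings it below e1. *)
pose eps := e1 * c0 / (K + 1).
have eps0 : 0 < eps by rewrite divr_gt0 ?mulr_gt0// ltr_wpDl.
have epsK0 : 0 <= eps * K by rewrite mulr_ge0// ltW.
have E1 : 1 <= expR M by rewrite -expR0 ler_expR ltW.
have [q1 [q11 hq1]] := expR_step_above a0 ac eps0 E1.
have [q2 [q21 hq2]] := expR_step_below c_gt0 cb eps0 E1.
have [_ il1 /(_ c0 C0 c00)[C1 [h1 [C10 h10 est1]]]] := test q1.
have [_ il2 /(_ c0 C0 c00)[C2 [h2 [C20 h20 est2]]]] := test q2.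
have [_ il3 /(_ c0 C0 c00)[C3 [h3 [C30 h30 est3]]]] := test 1.
pose CC := C1 + C2 + C3 / rho c + 1.
have C3r : 0 <= C3 / rho c by rewrite divr_ge0// ltW.
have CC0 : 0 < CC by rewrite ltr_wpDl// !addr_ge0.
have C1C : C1 <= CC by rewrite /CC; lra.
have C2C : C2 <= CC by rewrite /CC; lra.
have C3C : C3 / rho c <= CC by rewrite /CC; lra.
exists (Num.min (Num.min h1 h2) (Num.min h3 (e1 / CC))).
  by rewrite !lt_min h10 h20 h30 divr_gt0.
move=> h u y /andP[h_ge0]; rewrite !le_min => /andP[/andP[hh1 hh2] /andP[hh3 hCC]] cu y0.
have /andP[c0u uC] := cu; have u_gt0 : 0 < u by exact: lt_le_trans c0u.
have u0 : 0 <= u by exact: ltW.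
have hC D : 0 <= D -> D <= CC -> D * h ^+ 2 <= h * e1.
  move=> D0 DC; rewrite expr2 mulrCA ler_wpM2l//.
  apply: (@le_trans _ _ (CC * h)); first by rewrite ler_wpM2r.
  by rewrite mulrC -ler_pdivlMr.
pose g := y * expR (- (y * u)).
have g0 : 0 <= g by rewrite mulr_ge0 ?expR_ge0.
have gc : g <= c0^-1.
  rewrite /g [y * u]mulrC (le_trans (id_expR_le y u_gt0))//.
  by rewrite lef_pV2 ?posrE.
have gE : y * h * expR (- (y * u)) = h * g by rewrite /g; ring.
rewrite gE; set JA := tail_integral nu A u.
have JA0 : 0 <= JA by exact: tail_integral_ge0.
have JAn : JA <= fine (nu A) by exact: (tail_integral_le triple r0 mA Ar u0).
(* Polynomial approximation needs e^{-(X_h - y)} to stay in a compact set, hence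
   y <= M; for y > M the damping e^{-uy} makes both terms negligible. *)
have [yM|My] := leP y M.
  have ze w : expR (- (X h w - y)) <= expR M.
    by rewrite ler_expR; have := markov_ge0 markov w h_ge0; lra.
  have z1 z : expR (- z) <= 1 -> expR (- z) <= expR M.
    by move=> /le_trans; apply.
  have up : \int[P y]_w big_increment y u h w <=
      \int[P y]_w weighted X q1 y u h w.
    apply: le_Rintegral => //; first exact: big_increment_integrable.
      by have [+ _ _] := test q1; apply.
    move=> w _; rewrite /weighted ler_wpM2r ?expR_ge0//.
    have /andP[+ _] := hq1 _ (ze w); apply: le_trans.
    by case: (ltP c) => [/ltW ->|_]//; rewrite ler0n.
  have lo : \int[P y]_w weighted X q2 y u h w <=
      \int[P y]_w big_increment y u h w.
    apply: le_Rintegral => //; last first.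
    + move=> w _; rewrite /weighted ler_wpM2r ?expR_ge0//.
      by have /andP[_ +] := hq2 _ (ze w).
    + exact: big_increment_integrable.
    + by have [+ _ _] := test q2; apply.
  have l1 := small_time_limit_le triple mA mB r0 Ar Br aAB (ltW eps0) u0 (il1 u u0) q11
    (fun z hz => proj2 (andP (hq1 z (z1 z hz)))).
  have l2 := small_time_limit_ge triple mA mB r0 Ar Br Abb (ltW eps0) u0 (il2 u u0) q21
    (fun z hz => proj1 (andP (hq2 z (z1 z hz)))).
  have := est1 h u y; rewrite h_ge0 hh1 => /(_ isT cu y0).
  have := est2 h u y; rewrite h_ge0 hh2 => /(_ isT cu y0).
  rewrite gE !ler_norml => /andP[s1 _] /andP[_ s2].
  have k1 : C1 * h ^+ 2 <= h * e1 by exact: hC.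
  have k2 : C2 * h ^+ 2 <= h * e1 by exact: hC.
  have hg0 : 0 <= h * g by rewrite mulr_ge0.
  have m1 := ler_wpM2l hg0 l1; have m2 := ler_wpM2l hg0 l2.
  have n1 : g * fine (nu B) <= fine (nu B) / c0 by rewrite mulrC ler_wpM2l.
  have n2 : g * (eps * K) <= e1.
    apply: (@le_trans _ _ (c0^-1 * (eps * K))); first by rewrite ler_wpM2r.
    have -> : c0^-1 * (eps * K) = e1 * (K / (K + 1)).
      by rewrite /eps; field; rewrite !gt_eqF// ltr_wpDl.
    by rewrite ler_piMr ?(ltW e10)// ler_pdivrMr ?ltr_wpDl// mul1r lerDl.
  have n3 := ler_wpM2l h_ge0 n1; have n4 := ler_wpM2l h_ge0 n2.
  have ee : h * e1 + h * e1 <= h * e by rewrite -mulrDr ler_wpM2l.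
  move: m1 m2; rewrite -/JA -/J0 -/K => m1 m2.
  apply/andP; split.
    exact: error_below lo s1 k2 m2 n3 n4 ee.
  exact: error_above up s2 k1 m1 n3 n4 ee.
have gM : g <= e1 / K1.
  have : y * g <= 4 / c0 ^+ 2.
    rewrite /g mulrA -expr2; apply: le_trans (sqr_expR_le c00 y0).
    by rewrite ler_wpM2l ?sqr_ge0// ler_expR lerN2 mulrC ler_wpM2l.
  have : M * g <= y * g by rewrite ler_wpM2r// ltW.
  move=> /le_trans/[apply]; rewrite /M.
  have -> : 4 / c0 ^+ 2 * K1 / e1 * g = 4 / c0 ^+ 2 * (g * K1 / e1) by ring.
  rewrite -ler_pdivlMl ?divr_gt0 ?exprn_gt0// mulVf ?gt_eqF ?divr_gt0 ?exprn_gt0//.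
  by rewrite ler_pdivrMr// mul1r -ler_pdivlMr.
have w3E w : weighted X 1 y u h w = rho (X h w - y) * expR (- u * X h w).
  by rewrite /weighted hornerC mulr1.
(* A Chebyshev bound: [rho] increases on [0, oo[, so the indicator of z > c is at most rho(z) /
   rho(c), and the constant polynomial 1 suffices. *)
have up : \int[P y]_w big_increment y u h w <=
    (rho c)^-1 * \int[P y]_w weighted X 1 y u h w.
  have i3 : (P y).-integrable setT (EFin \o weighted X 1 y u h).
    by have [+ _ _] := test 1; apply.
  rewrite -RintegralZl//; apply: le_Rintegral => //.
  - exact: big_increment_integrable.
  - by apply: eq_integrable (integrableZl measurableT (rho c)^-1 i3).
  move=> w _; rewrite w3E mulrA ler_wpM2r ?expR_ge0//.
  case: (ltP c) => [cz|_]; last by rewrite mulr_ge0 ?rho_ge0// invr_ge0 ltW.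
  rewrite ler_pdivlMl// mulr1 /rho ler_pXn2r ?nnegrE ?subr_ge0 ?expR_le1 ?oppr_le0//.
  - by rewrite lerD2l lerN2 ler_expR lerN2 ltW.
  - exact: ltW.
  - by rewrite (le_trans (ltW c_gt0))// ltW.
have lo : 0 <= \int[P y]_w big_increment y u h w.
  by apply: Rintegral_ge0 => w _; rewrite mulr_ge0 ?expR_ge0// ler0n.
have lim1 : small_time_limit beta nu 1 u <= K.
  rewrite /small_time_limit hornerC mulr1 lerD2l.
  apply: le_Rintegral => //; [exact: il3|exact: (rho_expR_integrable triple (lexx 0))|].
  move=> z; rewrite /= in_itv/= andbT => z0.
  rewrite /levy_weighted hornerC mulr1 ler_wpM2l ?rho_ge0// ler_expR.
  by rewrite !mulNr mul0r oppr0 oppr_le0 mulr_ge0// ltW.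
have := est3 h u y; rewrite h_ge0 hh3 => /(_ isT cu y0).
rewrite gE ler_norml => /andP[_ s3].
have k3 : C3 / rho c * h ^+ 2 <= h * e1 by exact: hC.
have hg0 : 0 <= h * g by rewrite mulr_ge0.
have m3 := ler_wpM2l hg0 lim1.
have up' : \int[P y]_w big_increment y u h w <= h * g * (K / rho c) + h * e1.
  apply: (le_trans up); rewrite ler_pdivrMl//.
  have -> : rho c * (h * g * (K / rho c) + h * e1) = h * g * K + rho c * (h * e1).
    by field; rewrite gt_eqF.
  have : C3 * h ^+ 2 <= rho c * (h * e1).
    by rewrite -ler_pdivrMl// mulrC mulrAC.
  exact: le_of_errors s3 m3.
have n1 : g * (K / rho c + fine (nu A)) <= e1.
  apply: (@le_trans _ _ (e1 / K1 * K1)); last by rewrite divfK// gt_eqF.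
  by apply: ler_pM => //; rewrite ?addr_ge0 ?divr_ge0 ?(ltW rho_c)// /K1 lerDl.
have n2 := ler_wpM2l h_ge0 n1.
have n3 : h * g * JA <= h * g * fine (nu A) by rewrite ler_wpM2l.
have n4 : 0 <= h * g * (K / rho c) by rewrite mulr_ge0// divr_ge0// ltW.
have n5 : 0 <= h * g * JA by rewrite mulr_ge0.
have n6 : 0 <= h * (fine (nu B) / c0) by rewrite mulr_ge0// divr_ge0// ltW.
have ee : h * e1 + h * e1 <= h * e by rewrite -mulrDr ler_wpM2l.
have n7 : 0 <= h * e1 by rewrite mulr_ge0// ltW.
have n8 : 0 <= h * g * fine (nu A) by rewrite mulr_ge0.
rewrite ler_norml; apply/andP; split.
  exact: tail_below lo n2 n3 n4 n6 n7 ee.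
exact: tail_above up' n2 n5 n8 n6 n7 ee.
Qed.

End BigIncrements.

(** * One step of the partition, restricted to small increments *)

Section KernelEstimate.
Context {R : realType} {d : measure_display} {T : measurableType d}.
Implicit Types (h k l s t x y z C D L N : R) (w : T).
Variables (P : R -> probability T R) (X : R -> T -> R) (alpha beta : R).
Variable nu : {sigma_finite_measure set (measurableTypeR R) -> \bar R}.
Variable v : R -> R -> R.
Hypothesis triple : is_branching_triple alpha beta nu.
Hypothesis markov : is_markov P X.
Hypothesis sol_v : forall l, 0 <= l ->
  is_unique_solution (branching_mechanism alpha beta nu) (fun=> l) (v ^~ l).
Hypothesis laplace_v : forall x t l, 0 <= x -> 0 <= t -> 0 <= l ->
  'E_(P x)[fun w => expR (- l * X t w)]%E = (expR (- x * v t l))%:E.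

Variables (A B : set (measurableTypeR R)) (r a c b : R).
Hypotheses (mA : measurable A) (mB : measurable B) (r0 : 0 < r).
Hypotheses (Ar : A `<=` `[r, +oo[) (Br : B `<=` `[r, +oo[).
Hypotheses (a0 : 0 < a) (ac : a < c) (cb : c < b).
Hypothesis aAB : forall z, a < z -> A z \/ B z.
Hypothesis Abb : forall z, A z -> b <= z \/ B z.

Let Phi := branching_mechanism alpha beta nu.
Let PhiA := truncated_mechanism alpha beta nu A.

Definition small_increment_laplace l h y : R :=
  \int[P y]_w ((X h w - y <= c)%R%:R * expR (- l * X h w)).

Lemma small_increment_laplaceE l h y : 0 <= l -> 0 <= h ->
  small_increment_laplace l h y =
    \int[P y]_w expR (- l * X h w) - \int[P y]_w big_increment X c y l h w.
Proof.
move=> l0 h0; rewrite -RintegralB//; last 2 first.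
- exact: (integrable_exp_state markov y h0 l0).
- exact: (big_increment_integrable markov).
apply: eq_Rintegral => w _; rewrite /big_increment.
by case: (leP (X h w - y) c) => _; rewrite ?mul1r ?mul0r ?subr0 ?subrr.
Qed.

(** Both terms have the expansion e^{-yu} (1 - y h (J - Phi(u))), with J the tail integral over A at
    u: the first as an unrestricted mean minus the large increments, the second because u' = nu(A) -
    Phi^A(u) = J - Phi(u). *)
Lemma kernel_estimate k t u (c0 C0 : R) e : 0 < c0 -> 0 < e ->
  solution_upto t PhiA (fun s => k + fine (nu A) * s) u ->
  (forall s, 0 <= s <= t -> c0 <= u s <= C0) ->
  exists2 h0, 0 < h0 & forall h s y, 0 <= h <= h0 -> 0 <= s -> s + h <= t -> 0 <= y ->
  `|small_increment_laplace (u s) h y - expR (- (y * u (s + h)))|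
    <= h * (e + fine (nu B) / c0).
Proof.
move=> c00 e0 su uc.
have e20 : 0 < e / 2 by rewrite divr_gt0.
have [h1 h10 est1] := big_increment_estimate triple markov sol_v laplace_v
  mA mB r0 Ar Br a0 ac cb aAB Abb C0 c00 e20.
have [C2 [h2 [C20 h20 est2]]] := tilted_estimate triple markov sol_v laplace_v 0 C0 c00.
have [aA rA] := truncated_regular triple mA.
have [L L0 lipL] := regular_lipschitz rA C0.
pose N' := fine (nu A) + L * `|C0|.
have nuA0 : 0 <= fine (nu A) by rewrite fine_ge0.
have N'0 : 0 <= N' by rewrite addr_ge0// mulr_ge0// ltW.
have uC s : 0 <= s <= t -> u s <= C0 by move=> /uc/andP[].
have bN s : 0 <= s <= t -> `|fine (nu A) - PhiA (u s)| <= N'.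
  move=> st; have /andP[cs sC] := uc s st.
  rewrite (le_trans (ler_normB _ _))// lerD//; first by rewrite ger0_norm.
  have := lipL (u s) 0; rewrite (regular0 rA) !subr0 lexx sC.
  rewrite (le_trans (ltW c00) cs) (le_trans (le_trans (ltW c00) cs) sC).
  move=> /(_ isT isT)/le_trans; apply; rewrite ler_wpM2l ?(ltW L0)//.
  rewrite ger0_norm ?(le_trans (ltW c00) cs)// (le_trans sC)//.
  exact: ler_norm.
pose N := N' + L * N'.
have N0 : 0 <= N by rewrite addr_ge0// mulr_ge0// ltW.
pose C3 := 4 * N ^+ 2 / c0 ^+ 2 + N / c0.
have C30 : 0 <= C3 by rewrite addr_ge0// divr_ge0 ?mulr_ge0 ?sqr_ge0// ltW.
have CC0 : 0 < C2 + C3 + 1 by rewrite ltr_wpDl// addr_ge0.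
exists (Num.min (Num.min h1 h2) (e / 2 / (C2 + C3 + 1))).
  by rewrite !lt_min h10 h20 divr_gt0.
move=> h s y /andP[h0]; rewrite !le_min => /andP[/andP[hh1 hh2] hC] s0 sht y0.
have ss : s <= s + h by rewrite lerDl.
have st : 0 <= s <= t by rewrite s0 (le_trans ss).
have sht' : 0 <= s + h <= t by rewrite addr_ge0.
have us0 : 0 <= u s by have /andP[+ _] := uc s st; apply: le_trans; exact: ltW.
have := est1 h (u s) y; rewrite h0 hh1 => /(_ isT (uc s st) y0) {}est1.
have := est2 h (u s) y; rewrite h0 hh2 => /(_ isT (uc s st) y0) {}est2.
have e1 : `|u (s + h) - u s| <= N * h.
  have := solution_upto_lipschitz s0 ss sht su bN.
  rewrite [s + h - s]addrC addKr => /le_trans; apply; rewrite ler_wpM2r// lerDl.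
  by rewrite mulr_ge0// ltW.
have e2 : `|u (s + h) - u s - h * (fine (nu A) - PhiA (u s))| <= N * h ^+ 2.
  have := solution_upto_euler L0 N'0 lipL s0 ss sht su uC bN.
  rewrite [s + h - s]addrC addKr [h * _]mulrC => /le_trans; apply.
  by rewrite ler_wpM2r ?sqr_ge0// lerDr.
have /andP[cs _] := uc s st; have /andP[csh _] := uc _ sht'.
have est3 := exp_taylor c00 y0 h0 csh cs N0 e1 e2.
have PE : fine (nu A) - PhiA (u s) = tail_integral nu A (u s) - Phi (u s).
  rewrite /PhiA (truncated_mechanismE triple mA r0 Ar us0) /Phi /tail_integral.
  by ring.
rewrite PE -/C3 in est3.
have tE : \int[P y]_w tilted X 0 y (u s) h w = \int[P y]_w expR (- u s * X h w).
  by apply: eq_Rintegral => w _; rewrite tiltedE expr0 mul1r.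
rewrite tE addr0 -/Phi in est2.
rewrite small_increment_laplaceE//.
move: (\int[P y]_w expR _) (\int[P y]_w big_increment _ _ _ _ _ _) est1 est2 est3
  => I0 I1 est1 est2 est3.
have hh : C2 * h ^+ 2 + C3 * h ^+ 2 <= h * (e / 2).
  rewrite -mulrDl expr2 mulrCA ler_wpM2l//.
  apply: (@le_trans _ _ ((C2 + C3 + 1) * h)); first by rewrite ler_wpM2r// lerDl.
  by rewrite mulrC -ler_pdivlMr.
set J := tail_integral nu A (u s) in est1 est3.
set E0 := expR (- (y * u s)) in est1 est2 est3.
have -> : I0 - I1 - expR (- (y * u (s + h))) =
  (I0 - E0 * (1 + y * h * Phi (u s))) - (I1 - y * h * E0 * J) -
  (expR (- (y * u (s + h))) - E0 * (1 - y * h * (J - Phi (u s)))) by ring.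
rewrite (le_trans (ler_normB _ _))//.
have -> : h * (e + fine (nu B) / c0) =
  h * (e / 2) + h * (e / 2 + fine (nu B) / c0) by field; rewrite gt_eqF.
apply: (@le_trans _ _ (C2 * h ^+ 2 + h * (e / 2 + fine (nu B) / c0) + C3 * h ^+ 2)).
  by rewrite lerD// (le_trans (ler_normB _ _))// lerD.
by rewrite addrAC lerD2r.
Qed.

End KernelEstimate.

Lemma measurable_le_cst {R : realType} {d : measure_display} {T : measurableType d}
    (f : T -> R) (c : R) : measurable_fun setT f ->
  measurable_fun setT (fun w => (f w <= c)%R%:R : R).
Proof.
move=> mf; rewrite (_ : (fun w => _) = \1_[set w | f w <= c]); last first.
  by apply/funext => w; rewrite indicE; congr (nat_of_bool _)%:R; apply/idP/idP; rewrite inE.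
apply: measurable_indic.
have := mf measurableT `]-oo, c]%classic (measurable_itv _).
by rewrite setTI set_itvNyc.
Qed.

Lemma le1_integrable {R : realType} {d : measure_display} {T : measurableType d}
    (Q : probability T R) (f : T -> R) : measurable_fun setT f ->
  (forall w, 0 <= f w <= 1) -> Q.-integrable setT (EFin \o f).
Proof.
move=> mf f01; apply: measurable_bounded_integrable => //.
  by rewrite (le_lt_trans (probability_le1 Q measurableT))// ltry.
exists 1; split; first exact: num_real.
move=> M M1 w _ /=; have /andP[f0 f1] := f01 w.
by rewrite ger0_norm// (le_trans f1)// ltW.
Qed.

Lemma Rintegral_probability_cst {R : realType} {d : measure_display}
    {T : measurableType d} (Q : probability T R) (z : R) : \int[Q]_w z = z.
Proof.
rewrite Rintegral_cst//; have -> : fine (Q setT) = 1 by rewrite probability_setT.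
by rewrite mulr1.
Qed.

(** * Telescoping along the partition *)

Section MarkovStep.
Context {R : realType} {d : measure_display} {T : measurableType d}.
Implicit Types (h l s t x y z : R) (w : T).
Variables (P : R -> probability T R) (X : R -> T -> R) (c : R).
Hypothesis markov : is_markov P X.

(** Measurability is part of the conclusion because the state enters the kernel twice, through [P y]
    and through the increment. *)
Lemma markov_step x s h l (A : set T) : 0 <= x -> 0 <= s -> 0 <= h -> 0 <= l ->
  natural_filtration X s A ->
  measurable_fun setT (fun w => small_increment_laplace P X c l h (X s w)) /\
  \int[P x]_w (\1_A w * ((X (s + h) w - X s w <= c)%R%:R * expR (- l * X (s + h) w))) =
  \int[P x]_w (\1_A w * small_increment_laplace P X c l h (X s w)).
Proof.
move=> x0 s0 h0 l0 FA.
have mXs : measurable_fun setT (X s : past X s -> R).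
  by apply: measurable_past; rewrite s0 lexx.
pose f (w : T) z : R := (z - X s w <= c)%R%:R * expR (- l * z).
have mf : measurable_fun setT (fun q : past X s * R => f q.1 q.2).
  apply: measurable_funM.
    apply: (@measurable_le_cst _ _ _ (fun q : past X s * R => q.2 - X s q.1)).
    apply: measurable_funB => //.
    exact: (measurableT_comp mXs measurable_fst).
  apply: (measurableT_comp (@measurable_expRM _ (- l))).
  exact: measurable_snd.
have f0 w z : 0 <= f w z by rewrite mulr_ge0 ?expR_ge0 ?ler0n.
have f01 w w' u : 0 <= u -> 0 <= f w (X u w') <= 1.
  move=> u0; rewrite f0 /=; apply: (@le_trans _ _ (1 * 1)); last by rewrite mulr1.
  apply: ler_pM => //; rewrite ?ler0n ?expR_ge0//; first by case: (_ <= c).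
  by rewrite expR_le1 mulNr oppr_le0 mulr_ge0// (markov_ge0 markov).
have intf w : (\int[P (X s w)]_w' (f w (X h w'))%:E =
    (small_increment_laplace P X c l h (X s w))%:E)%E.
  rewrite /small_increment_laplace /Rintegral fineK//.
  apply: integrable_fin_num => //; apply: le1_integrable; last by move=> w'; exact: f01.
  apply: measurable_funM; last exact: (measurable_exp_state markov).
  apply: measurable_le_cst; apply: measurable_funB => //.
  exact: (markov_measurable markov).
split.
  have := @measurable_markov_integral _ _ _ P X markov s h s0 h0
    (fun q => (f q.1 q.2)%:E).
  have mfE : measurable_fun setT (fun q : past X s * R => (f q.1 q.2)%:E).
    exact/measurable_EFinP.
  move=> /(_ mfE (fun q => f0 _ _)).
  rewrite (_ : (fun w => _) = EFin \o (fun w => small_increment_laplace P X c l h (X s w))).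
    by move/measurable_EFinP.
  by apply/funext => w; exact: intf.
pose g (q : past X s * R) : \bar R := (\1_A (q.1 : T) * f q.1 q.2)%:E.
have mg : measurable_fun setT g.
  apply/measurable_EFinP; apply: measurable_funM => //.
  have mA : measurable_fun setT (\1_(A : set (past X s)) : past X s -> R).
    exact: measurable_indic.
  exact: (measurableT_comp mA measurable_fst).
have g0 q : (0 <= g q)%E by rewrite lee_fin mulr_ge0.
have e := markov_integral markov x0 s0 h0 mg g0.
congr fine; rewrite -[LHS]/(\int[P x]_w g (w, X (s + h)%R w))%E e.
apply: eq_integral => w _; rewrite /g/= indicE.
case: (w \in A); last first.
  rewrite mul0r (eq_integral (cst 0%E)) ?integral0// => w' _.
  by rewrite mul0r.
by rewrite mul1r -intf; apply: eq_integral => w' _; rewrite mul1r.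
Qed.

(** Constrains the first n increments only, hence is an event of the past of n h; at n + 1 with h =
    t / (n + 1) it is [incr_event X t c n]. *)
Definition small_past h (n : nat) : set T :=
  [set w | forall i : nat, (i < n)%N -> X (i.+1%:R * h) w - X (i%:R * h) w <= c].

Lemma small_pastS h n w : \1_(small_past h n.+1) w =
  \1_(small_past h n) w * (X (n.+1%:R * h) w - X (n%:R * h) w <= c)%R%:R :> R.
Proof.
rewrite !indicE -natrM mulnb; congr (nat_of_bool _)%:R.
apply/idP/andP; rewrite !inE.
  by move=> hw; split; [move=> i ni; apply: hw; exact: ltnW|exact: hw].
by move=> [hw hn] i; rewrite ltnS leq_eqVlt => /predU1P[->|/hw].
Qed.

Lemma small_past_filtration h n : 0 <= h ->
  natural_filtration X (n%:R * h) (small_past h n).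
Proof.
move=> h0.
have : measurable (small_past h n : set (past X (n%:R * h))); last by [].
rewrite (_ : small_past h n = \bigcap_(i < n)
  [set w | X (i.+1%:R * h) w - X (i%:R * h) w <= c]); last first.
  by apply/seteqP; split=> w hw i ni; exact: (hw i ni).
apply: bigcap_measurableType => i /= ni.
have mD : measurable_fun setT
    ((fun w => X (i.+1%:R * h) w - X (i%:R * h) w) : past X (n%:R * h) -> R).
  apply: measurable_funB; apply: measurable_past; rewrite mulr_ge0//= ler_wpM2r// ler_nat//.
  exact: ltnW.
have := mD measurableT `]-oo, c]%classic (measurable_itv _).
by rewrite setTI set_itvNyc.
Qed.

Lemma telescoping_estimate x t (u : R -> R) (n : nat) (dl : R) : 0 <= x -> 0 < t ->
  (forall s, 0 <= s <= t -> 0 <= u s) ->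
  (forall s y, 0 <= s -> s + t / n.+1%:R <= t -> 0 <= y ->
    `|small_increment_laplace P X c (u s) (t / n.+1%:R) y -
      expR (- (y * u (s + t / n.+1%:R)))| <= t / n.+1%:R * dl) ->
  `|\int[P x]_w (\1_(incr_event X t c n) w * expR (- u 0 * X t w)) -
    expR (- (x * u t))| <= t * dl.
Proof.
move=> x0 t0 u0 est; set h := t / n.+1%:R in est *.
have h0 : 0 <= h by rewrite divr_ge0// ltW.
have nh : n.+1%:R * h = t by rewrite /h mulrC divfK// pnatr_eq0.
(* S 0 is e^{-x u(t)}, as X_0 = x almost surely and nothing is constrained yet; S (n + 1) is the
   damped probability, as the remaining time is 0. *)
pose S k := \int[P x]_w (\1_(small_past h k) w * expR (- u (t - k%:R * h) * X (k%:R * h) w)).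
have tk k : (k <= n.+1)%N -> 0 <= t - k%:R * h <= t.
  move=> kn; rewrite subr_ge0 -{1}nh ler_wpM2r ?ler_nat//= gerBl.
  by rewrite mulr_ge0.
have mX s : 0 <= s -> measurable_fun setT (X s) by exact: (markov_measurable markov).
have key k : (k <= n.+1)%N -> `|S k - expR (- (x * u t))| <= k%:R * (h * dl).
  elim: k => [_|k ih kn].
    rewrite mul0r normr_le0 subr_eq0 /S mul0r subr0.
    have [_ PX0 _ _] := markov; have X0 := PX0 x x0.
    have mX0 : measurable (X 0 @^-1` [set x]).
      by have := mX 0 (lexx 0) measurableT [set x] (measurable_set1 x); rewrite setTI.
    apply/eqP.
    rewrite /Rintegral (ae_eq_integral (cst (expR (- (x * u t)))%:E))//.
    - by rewrite integral_cst//= [P x setT]probability_setT mule1.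
    - apply/measurable_EFinP; apply: measurable_funM.
        apply: measurable_indic; apply: (natural_filtration_measurable markov).
        exact: small_past_filtration.
      exact: (measurable_exp_state markov).
    - exists (~` (X 0 @^-1` [set x])); split.
      + exact: measurableC.
      + by rewrite [LHS](probability_setC (P x) mX0) X0 subee.
      + move=> w /= nw Xw; apply: nw => _.
        rewrite indicE mem_set ?mul1r; last by move=> i.
        by rewrite Xw mulNr mulrC.
  have kn' : (k <= n)%N by [].
  set s := t - k.+1%:R * h.
  have s0 : 0 <= s by have /andP[] := tk k.+1 kn.
  have sh : s + h = t - k%:R * h by rewrite /s -natr1; ring.
  have FA : natural_filtration X (k%:R * h) (small_past h k).
    exact: small_past_filtration.
  have kh0 : 0 <= k%:R * h by rewrite mulr_ge0.
  have us0 : 0 <= u s by apply: u0; exact: tk.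
  have [mG eG] := markov_step x0 kh0 h0 us0 FA.
  have kh : k%:R * h + h = k.+1%:R * h by rewrite -natr1; ring.
  have ES : S k.+1 = \int[P x]_w (\1_(small_past h k) w *
      small_increment_laplace P X c (u s) h (X (k%:R * h) w)).
    rewrite -eG kh /S; apply: eq_Rintegral => w _.
    by rewrite small_pastS -mulrA.
  have mI : measurable_fun setT (\1_(small_past h k) : T -> R).
    by apply: measurable_indic; exact: (natural_filtration_measurable markov FA).
  have I01 w : 0 <= (\1_(small_past h k) w : R) <= 1.
    by rewrite indicE; case: (_ \in _); rewrite /= ?lexx ?ler01.
  have G01 w : 0 <= small_increment_laplace P X c (u s) h (X (k%:R * h) w) <= 1.
    have f01 w' : 0 <= (X h w' - X (k%:R * h) w <= c)%R%:R * expR (- u s * X h w') <= 1.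
      rewrite mulr_ge0 ?expR_ge0 ?ler0n//=.
      apply: (@le_trans _ _ (1 * 1)); last by rewrite mulr1.
      apply: ler_pM => //; rewrite ?ler0n ?expR_ge0//; first by case: (_ <= c).
      by rewrite expR_le1 mulNr oppr_le0 mulr_ge0// (markov_ge0 markov).
    rewrite Rintegral_ge0 => [/=|w' _]; last by have /andP[] := f01 w'.
    have e1 : \int[P (X (k%:R * h) w)]_w' 1 = 1 :> R.
      exact: Rintegral_probability_cst.
    rewrite -[leRHS]e1; apply: le_Rintegral => //; last first.
    - by move=> w' _; have /andP[] := f01 w'.
    - by apply: le1_integrable => // w'; rewrite ler01 lexx.
    apply: le1_integrable => //; apply: measurable_funM.
      by apply: measurable_le_cst; apply: measurable_funB => //; exact: mX.
    exact: (measurable_exp_state markov).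
  have prod01 (p q : R) : 0 <= p <= 1 -> 0 <= q <= 1 -> 0 <= p * q <= 1.
    move=> /andP[p0 p1] /andP[q0 q1]; rewrite mulr_ge0//=.
    by rewrite (le_trans _ p1)// ler_piMr.
  have ush0 : 0 <= u (t - k%:R * h) by apply: u0; apply: tk; exact: ltnW.
  have E01 w : 0 <= expR (- u (t - k%:R * h) * X (k%:R * h) w) <= 1.
    by rewrite expR_ge0 expR_le1 mulNr oppr_le0 mulr_ge0// (markov_ge0 markov).
  have i1 : (P x).-integrable setT (EFin \o (fun w => \1_(small_past h k) w *
      small_increment_laplace P X c (u s) h (X (k%:R * h) w))).
    by apply: le1_integrable => [|w]; [exact: measurable_funM|exact: prod01].
  have i2 : (P x).-integrable setT (EFin \o (fun w => \1_(small_past h k) w *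
      expR (- u (t - k%:R * h) * X (k%:R * h) w))).
    apply: le1_integrable => [|w]; last exact: prod01.
    by apply: measurable_funM => //; exact: (measurable_exp_state markov).
  have stepE : `|S k.+1 - S k| <= h * dl.
    rewrite ES /S -RintegralB//.
    have iB : (P x).-integrable setT (EFin \o (fun w => \1_(small_past h k) w *
        small_increment_laplace P X c (u s) h (X (k%:R * h) w) -
        \1_(small_past h k) w * expR (- u (t - k%:R * h) * X (k%:R * h) w))).
      exact: (integrableB measurableT i1 i2).
    apply: (le_trans (le_normr_Rintegral _ iB)) => //.
    have e1 : \int[P x]_w (h * dl) = h * dl.
      exact: Rintegral_probability_cst.
    rewrite -[leRHS]e1; apply: le_Rintegral => //.
    - exact: integrable_norm.
    - exact: finite_measure_integrable_cst.
    move=> w _; rewrite -mulrBr normrM.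
    have Xk0 : 0 <= X (k%:R * h) w by exact: (markov_ge0 markov).
    have := est s (X (k%:R * h) w) s0 _ Xk0; rewrite sh.
    have /andP[_ tk2] := tk k (leqW kn'); move=> /(_ tk2).
    rewrite mulNr [u _ * X _ _]mulrC; apply: le_trans.
    by rewrite ler_piMl// ger0_norm; have /andP[] := I01 w.
  have -> : S k.+1 - expR (- (x * u t)) = (S k.+1 - S k) + (S k - expR (- (x * u t))).
    by ring.
  rewrite (le_trans (ler_normD _ _))// -natr1 mulrDl mul1r addrC lerD// ih//.
  exact: leqW.
have := key n.+1 (leqnn _); rewrite mulrA nh.
by rewrite /S nh subrr.
Qed.

End MarkovStep.

(** * Passage to the limit *)

Section BoundedConvergence.
Context {R : realType} {d : measure_display} {T : measurableType d}.
Variables (mu : {measure set T -> \bar R}) (D : set T).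
Hypotheses (mD : measurable D) (finD : (mu D < +oo)%E).

Lemma bounded_convergence (f_ : nat -> T -> R) (f : T -> R) :
  (forall n, measurable_fun D (f_ n)) -> measurable_fun D f ->
  (forall n w, D w -> `|f_ n w| <= 1) ->
  (forall w, D w -> f_ n w @[n --> \oo] --> f w) ->
  \int[mu]_(w in D) f_ n w @[n --> \oo] --> \int[mu]_(w in D) f w.
Proof.
move=> mf_ mf f1 ff.
have ic : mu.-integrable D (EFin \o (fun=> 1 : R)).
  apply: measurable_bounded_integrable => //.
  by exists 1; split; [exact: num_real|move=> M M1 w _ /=; rewrite normr1 ltW].
have h1 n : measurable_fun D (EFin \o f_ n) by exact/measurable_EFinP.
have h2 : measurable_fun D (EFin \o f) by exact/measurable_EFinP.
have h3 : {ae mu, forall w, D w ->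
    (fun n => (EFin \o f_ n) w) @ \oo --> (EFin \o f) w}.
  by apply: aeW => w Dw; apply/fine_cvgP; split; [exact: nearW|exact: ff].
have h4 : {ae mu, forall w n, D w -> (`|(EFin \o f_ n) w| <= (EFin \o (fun=> 1%R : R)) w)%E}.
  by apply: aeW => w n Dw /=; rewrite lee_fin f1.
have [i1 _ cv] := dominated_convergence mD h1 h2 h3 ic h4.
by apply/fine_cvg; rewrite fineK; [exact: cv|exact: integrable_fin_num].
Qed.

(** Continuity from above without monotonicity: every point leaves the sets eventually, and the
    indicators are dominated by 1 on a set of finite measure. *)
Lemma vanishing_sets (H : nat -> set T) : (forall n, measurable (H n)) ->
  (forall n, H n `<=` D) -> (forall w, D w -> \forall n \near \oo, ~ H n w) ->
  fine (mu (H n)) @[n --> \oo] --> (0 : R).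
Proof.
move=> mH HD nH.
have e n : fine (mu (H n)) = \int[mu]_(w in D) \1_(H n) w.
  by rewrite /Rintegral integral_indic// setIidl.
rewrite (_ : (fun n => _) = (fun n => \int[mu]_(w in D) \1_(H n) w)); last exact/funext.
have -> : (0 : R) = \int[mu]_(w in D) 0 by rewrite Rintegral_cst// mul0r.
apply: bounded_convergence => //.
- by move=> n; apply: measurable_funTS; exact: measurable_indic.
- by move=> n w _; rewrite indicE; case: (_ \in _); rewrite ?normr1 ?normr0.
- move=> w /nH nHw; apply: cvg_near_cst; move: nHw.
  by apply: filterS => n nHn; rewrite indicE memNset.
Qed.

End BoundedConvergence.

Section DampedEvents.
Context {R : realType} {d : measure_display} {T : measurableType d}.
Implicit Types (h k l s t x y z : R) (w : T) (E G H : set T).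
Variables (P : R -> probability T R) (X : R -> T -> R).
Hypothesis markov : is_markov P X.

Definition damped x t k E : R := \int[P x]_w (\1_E w * expR (- k * X t w)).

Lemma measurable_damped t k E : 0 <= t -> measurable E ->
  measurable_fun setT (fun w => \1_E w * expR (- k * X t w)).
Proof.
move=> t0 mE; apply: measurable_funM; first exact: measurable_indic.
exact: (measurable_exp_state markov).
Qed.

Lemma damped01 t k E w : 0 <= t -> 0 <= k -> 0 <= \1_E w * expR (- k * X t w) <= 1.
Proof.
move=> t0 k0; rewrite indicE; case: (w \in E); last by rewrite mul0r lexx ler01.
by rewrite mul1r expR_ge0 expR_le1 mulNr oppr_le0 mulr_ge0// (markov_ge0 markov).
Qed.

Lemma damped_integrable x t k E : 0 <= t -> 0 <= k -> measurable E ->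
  (P x).-integrable setT (EFin \o (fun w => \1_E w * expR (- k * X t w))).
Proof.
move=> t0 k0 mE; apply: le1_integrable; first exact: measurable_damped.
by move=> w; exact: damped01.
Qed.

Lemma damped_le x t k E G : 0 <= t -> 0 <= k -> measurable E -> measurable G ->
  damped x t k E <= damped x t k G + fine (P x (E `\` G)).
Proof.
move=> t0 k0 mE mG; have mEG : measurable (E `\` G) by exact: measurableD.
have -> : fine (P x (E `\` G)) = \int[P x]_w \1_(E `\` G) w.
  by rewrite /Rintegral integral_indic// setIT.
have i1 := damped_integrable x t0 k0 mG.
have i2 : (P x).-integrable setT (EFin \o (\1_(E `\` G) : T -> R)).
  exact: integrable_indic.
rewrite -RintegralD//; apply: le_Rintegral => //.
- exact: damped_integrable.
- by apply: eq_integrable (integrableD measurableT i1 i2).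
move=> w _; have h1 := @damped01 t k setT w t0 k0.
rewrite indicT mul1r in h1; have /andP[e0 e1] := h1.
rewrite !indicE in_setD.
by case: (w \in E); case: (w \in G); rewrite /= ?mul1r ?mul0r ?addr0 ?add0r.
Qed.

Lemma damped_mono x t k E G : 0 <= t -> 0 <= k -> measurable E -> measurable G ->
  E `<=` G -> damped x t k E <= damped x t k G.
Proof.
move=> t0 k0 mE mG EG; have := @damped_le x t k E G t0 k0 mE mG.
by rewrite setDE ((subsets_disjoint E G).1 EG) measure0 addr0.
Qed.

Lemma damped_cvg x t E : 0 <= t -> measurable E ->
  damped x t n.+1%:R^-1 E @[n --> \oo] --> fine (P x E).
Proof.
move=> t0 mE; have -> : fine (P x E) = \int[P x]_w \1_E w.
  by rewrite /Rintegral integral_indic// setIT.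
apply: bounded_convergence => //.
- by rewrite (le_lt_trans (probability_le1 (P x) measurableT))// ltry.
- by move=> n; exact: measurable_damped.
- move=> n w _; have n0 : 0 <= n.+1%:R^-1 :> R by rewrite invr_ge0.
  by have /andP[? ?] := damped01 E w t0 n0; rewrite ger0_norm.
- move=> w _; rewrite -[X in _ --> X]mulr1; apply: cvgM; first exact: cvg_cst.
  rewrite -[X in _ --> X]expR0; apply: continuous_cvg; first exact: continuous_expR.
  have -> : (0 : R) = - 0 * X t w by rewrite oppr0 mul0r.
  apply: cvgM; last exact: cvg_cst.
  by apply: cvgN; exact: cvg_harmonic.
Qed.

End DampedEvents.

Lemma cvg_lower_bound {R : realType} (y z : R) (b : nat -> R) :
  b n @[n --> \oo] --> (0 : R) -> (forall n, y <= z + b n) -> y <= z.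
Proof.
move=> b0 h; have cv : z + b n @[n --> \oo] --> z.
  by rewrite -[X in _ --> X]addr0; apply: cvgD => //; exact: cvg_cst.
rewrite -(cvg_lim _ cv)//; apply: limr_ge; first by apply/cvg_ex; eexists; exact: cv.
exact: nearW.
Qed.

Lemma squeeze_errors {R : realType} (p q K : R) (b s : nat -> R) :
  b n @[n --> \oo] --> (0 : R) -> s n @[n --> \oo] --> (0 : R) ->
  (forall n, p <= q + K * b n + s n) -> (forall n, q - K * b n <= p + s n) ->
  p = q.
Proof.
move=> b0 s0 h1 h2.
have cv : K * b n + s n @[n --> \oo] --> (0 : R).
  have -> : (0 : R) = K * 0 + 0 by rewrite mulr0 addr0.
  by apply: cvgD => //; apply: cvgM => //; exact: cvg_cst.
apply/eqP; rewrite eq_le; apply/andP; split.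
  by apply: (cvg_lower_bound cv) => n; rewrite addrA.
by apply: (cvg_lower_bound cv) => n; have := h2 n; lra.
Qed.

(** * The law of the largest jump *)

Section JumpLaw.
Context {R : realType} {d : measure_display} {T : measurableType d}.
Implicit Types (h k l r s t y z e : R) (w : T) (f : R -> R).
Variables (P : R -> probability T R) (X : R -> T -> R) (alpha beta : R).
Variable nu : {sigma_finite_measure set (measurableTypeR R) -> \bar R}.
Variable v : R -> R -> R.
Hypothesis triple : is_branching_triple alpha beta nu.
Hypothesis rX : rcll X.
Hypothesis markov : is_markov P X.
Hypothesis sol_v : forall l, 0 <= l ->
  is_unique_solution (branching_mechanism alpha beta nu) (fun=> l) (v ^~ l).
Hypothesis laplace_v : forall y t l, 0 <= y -> 0 <= t -> 0 <= l ->
  'E_(P y)[fun w => expR (- l * X t w)]%E = (expR (- y * v t l))%:E.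
Variable x : R.
Hypothesis x0 : 0 <= x.

Let mX s : 0 <= s -> measurable_fun setT (X s).
Proof. exact: (markov_measurable markov). Qed.

Let jumps_le t z : set T := [set w | (sup_jump X t w <= z%:E)%E].
Let jumps_lt t z : set T := [set w | (sup_jump X t w < z%:E)%E].

Let mjumps_le t z : 0 < t -> 0 <= z -> measurable (jumps_le t z).
Proof. exact: (measurable_sup_jump_le rX mX). Qed.

Let mjumps_lt t z : 0 < t -> 0 < z -> measurable (jumps_lt t z).
Proof. exact: (measurable_sup_jump_lt rX mX). Qed.

Let finP y : (P y setT < +oo)%E.
Proof. by rewrite (le_lt_trans (probability_le1 (P y) measurableT))// ltry. Qed.

Section Tail.
Variables (A : set (measurableTypeR R)) (r : R).
Hypotheses (mA : measurable A) (r0 : 0 < r) (Ar : A `<=` `[r, +oo[).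

Let PhiA := truncated_mechanism alpha beta nu A.
Let lA := fine (nu A).
Let lA0 : 0 <= lA. Proof. exact: fine_ge0. Qed.

(* B collects the jump sizes on which membership in A and the test X_h - y > c
   may disagree. *)
Lemma damped_sandwich k t f : 0 < k -> 0 < t ->
  solution_upto t PhiA (fun s => k + lA * s) f ->
  exists2 K, 0 <= K & forall (B : set (measurableTypeR R)) (a c b : R),
    measurable B -> B `<=` `[r, +oo[ -> 0 < a -> a < c -> c < b ->
    (forall z, a < z -> A z \/ B z) -> (forall z, A z -> b <= z \/ B z) ->
    (forall z, 0 <= z -> z < c ->
      damped P X x t k (jumps_le t z) <= expR (- (x * f t)) + K * fine (nu B)) /\
    expR (- (x * f t)) - K * fine (nu B) <= damped P X x t k (jumps_le t c).
Proof.
move=> k0 t0 sf; have [aA rA] := truncated_regular triple mA.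
have [f0 [C fC] _ ef] := sf.
have [L L0 lipL] := regular_lipschitz rA C.
pose c0 := k / 2 * expR (- (2 * L * t)).
have c00 : 0 < c0 by rewrite !mulr_gt0 ?expR_gt0.
have fc s : 0 <= s <= t -> c0 <= f s <= C.
  by move=> st; rewrite fC// (solution_upto_ge L0 lipL (regular0 rA) lA0 sf fC st).
have fk : f 0 = k.
  by rewrite (ef 0) ?lexx ?(ltW t0)// set_itv1 Rintegral_set1 mulr0 addr0 subr0.
(* Neither c0 nor this constant involves [B], [a], [c] or [b], so it stays fixed while B shrinks. *)
exists (t / c0); first by rewrite divr_ge0// ltW.
move=> B a c b mB Br a0 ac cb aAB Abb.
have nuB0 : 0 <= fine (nu B) by exact: fine_ge0.
have c_gt0 : 0 < c by exact: lt_trans ac.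
have near_est e : 0 < e -> \forall n \near \oo,
    `|damped P X x t k (incr_event X t c n) - expR (- (x * f t))| <=
      t * (e + fine (nu B) / c0).
  move=> e0; have [h0 h00 est] := kernel_estimate triple markov sol_v laplace_v
    mA mB r0 Ar Br a0 ac cb aAB Abb c00 e0 sf fc.
  have := mesh_lt t0 h00; apply: filterS => n hn.
  have hn0 : 0 <= t / n.+1%:R by rewrite divr_ge0// ltW.
  rewrite /damped -{1}fk; apply: (telescoping_estimate markov x0 t0 f0) => s y s0 st y0.
  by apply: est => //; rewrite hn0 ltW.
have mI n : measurable (incr_event X t c n).
  by apply: (measurable_incr_event mX); exact: ltW.
have eps e : 0 < e -> t * (e / 2 / t + fine (nu B) / c0) + e / 2 = e + t / c0 * fine (nu B).
  by move=> e0; field; rewrite !gt_eqF.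
split=> [z z0 zc|].
  apply/ler_addgt0Pr => e e0; have e2 : 0 < e / 2 by rewrite divr_gt0.
  have mz := mjumps_le t0 z0.
  have mH n : measurable (jumps_le t z `\` incr_event X t c n) by exact: measurableD.
  have := vanishing_sets measurableT (finP x) mH (fun n => @subsetT _ _).
  have nH w : setT w -> \forall n \near \oo, ~ (jumps_le t z `\` incr_event X t c n) w.
    move=> _; have [wz|nz] := pselect (jumps_le t z w); last by apply: nearW => n [].
    have := small_jumps_incr_event rX t0 z0 zc wz; apply: filterS => n ? [_].
    exact.
  move=> /(_ nH) /cvgrPdist_le /(_ _ e2) h1.
  have h2 := near_est (e / 2 / t) (divr_gt0 e2 t0).
  have [n [h1n h2n]] := filter_ex (filterI h1 h2).
  apply: (le_trans (damped_le markov x (ltW t0) (ltW k0) mz (mI n))).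
  move: h1n h2n; rewrite sub0r normrN ler_norml => /andP[_ h1n].
  rewrite ler_norml => /andP[_ h2n].
  have := eps e e0.
  lra.
apply/ler_addgt0Pr => e e0; have e2 : 0 < e / 2 by rewrite divr_gt0.
have mc := mjumps_le t0 (ltW c_gt0).
have mH n : measurable (incr_event X t c n `\` jumps_le t c) by exact: measurableD.
have := vanishing_sets measurableT (finP x) mH (fun n => @subsetT _ _).
have nH w : setT w -> \forall n \near \oo, ~ (incr_event X t c n `\` jumps_le t c) w.
  move=> _; have [wz|nz] := pselect (jumps_le t c w); first by apply: nearW => n [].
  have := big_jump_incr_event rX t0 nz; apply: filterS => n ? [+ _].
  exact.
move=> /(_ nH) /cvgrPdist_le /(_ _ e2) h1.
have h2 := near_est (e / 2 / t) (divr_gt0 e2 t0).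
have [n [h1n h2n]] := filter_ex (filterI h1 h2).
have := damped_le markov x (ltW t0) (ltW k0) (mI n) mc.
move: h1n h2n; rewrite sub0r normrN ler_norml => /andP[_ h1n].
rewrite ler_norml => /andP[h2n _].
have := eps e e0.
lra.
Qed.

(** The lower bound of the solutions degenerates with k, so k tends to 0 only here, where the damped
    identity is already exact. Stability carries the initial values 1 / (n + 1) to 0, under a bound
    C common to all of them since they are at most 1. *)
Lemma law_of_damped t f (E : set T) : 0 < t -> measurable E ->
  (forall k g, 0 < k -> solution_upto t PhiA (fun s => k + lA * s) g ->
    damped P X x t k E = expR (- (x * g t))) ->
  solution_upto t PhiA (fun s => 0 + lA * s) f ->
  P x E = (expR (- x * f t))%:E.
Proof.
move=> t0 mE dE sf; have [aA rA] := truncated_regular triple mA.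
have ex n : exists g, solution_upto t PhiA (fun s => n.+1%:R^-1 + lA * s) g.
  by apply: (exists_solution_upto rA) => //; rewrite ?invr_ge0// ltW.
have [g sg] := choice ex.
have a0 := regular_slope rA.
pose C := 2 * (1 + lA * t) * expR (2 * aA * t).
have [L L0 lipL] := regular_lipschitz rA C.
have gC n s : 0 <= s <= t -> g n s <= C.
  move=> st; have n0 : 0 <= n.+1%:R^-1 :> R by rewrite invr_ge0.
  apply: (le_trans (solution_upto_le rA n0 lA0 (sg n) st)).
  rewrite /C ler_wpM2r ?expR_ge0// ler_wpM2l// lerD2r.
  by rewrite invf_le1// ler1n.
have fC s : 0 <= s <= t -> f s <= C.
  move=> st; apply: (le_trans (solution_upto_le rA (lexx 0) lA0 sf st)).
  by rewrite /C ler_wpM2r ?expR_ge0// ler_wpM2l// lerD2r.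
have gf : g n t @[n --> \oo] --> f t.
  apply/cvgrPdist_le => e e0.
  have tt : 0 <= t <= t by rewrite lexx ltW.
  pose M := 2 * expR (2 * L * t).
  have M0 : 0 < M by rewrite mulr_gt0 ?expR_gt0.
  have := @cvg_harmonic R => /cvgrPdist_le /(_ _ (divr_gt0 e0 M0)).
  apply: filterS => n; rewrite sub0r normrN ger0_norm ?invr_ge0// => hn.
  have n0 : 0 <= n.+1%:R^-1 :> R by rewrite invr_ge0.
  have st := solution_upto_stable L0 n0 lipL sf (sg n)
    (fun s hs => conj (fC s hs) (gC n s hs)) _ tt.
  apply: le_trans (st _) _ => [s _|].
    by rewrite opprD addrACA subrr addr0 sub0r normrN ger0_norm.
  by rewrite mulrAC -/M mulrC -ler_pdivlMr.
have cv1 : damped P X x t n.+1%:R^-1 E @[n --> \oo] --> expR (- (x * f t)).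
  rewrite (_ : (fun n => _) = (fun n => expR (- (x * g n t)))); last first.
    by apply/funext => n; apply: (dE _ _ _ (sg n)); rewrite invr_gt0.
  apply: continuous_cvg; first exact: continuous_expR.
  by apply: cvgN; apply: cvgM => //; exact: cvg_cst.
have cv2 : damped P X x t n.+1%:R^-1 E @[n --> \oo] --> fine (P x E).
  exact: (damped_cvg markov (ltW t0) mE).
have := cvg_unique _ cv1 cv2; rewrite mulNr => ->//.
by rewrite fineK// fin_num_measure.
Qed.

End Tail.

(** The level c = r + dl / 2 comes down to r while B = ]r, r + dl] shrinks to the empty set: an atom
    at r lies outside both A and B, and jumps of size r remain allowed. *)
Lemma damped_jumps_le r t k f : 0 < r -> 0 < t -> 0 < k ->
  solution_upto t (truncated_mechanism alpha beta nu `]r, +oo[%classic)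
    (fun s => k + fine (nu `]r, +oo[%classic) * s) f ->
  damped P X x t k (jumps_le t r) = expR (- (x * f t)).
Proof.
move=> r0 t0 k0 sf; pose A : set (measurableTypeR R) := `]r, +oo[%classic.
have mA : measurable A by exact: measurable_itv.
have Ar : A `<=` `[r, +oo[ by apply: subset_itvr; rewrite bnd_simp.
have [K K0 sandwich] := damped_sandwich mA r0 Ar k0 t0 sf.
have mr := mjumps_le t0 (ltW r0).
pose dl (n : nat) : R := n.+1%:R^-1.
have dl0 n : 0 < dl n by rewrite invr_gt0.
pose B n : set (measurableTypeR R) := `]r, r + dl n]%classic.
have mB n : measurable (B n) by exact: measurable_itv.
have BA n : B n `<=` A by apply: subset_itvl; rewrite bnd_simp.
have Br n : B n `<=` `[r, +oo[ := subset_trans (@BA n) Ar.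
have sand n := @sandwich (B n) r (r + dl n / 2) (r + dl n) (mB n) (Br n) r0.
have h1 n : damped P X x t k (jumps_le t r) <=
    expR (- (x * f t)) + K * fine (nu (B n)) /\
    expR (- (x * f t)) - K * fine (nu (B n)) <=
    damped P X x t k (jumps_le t (r + dl n / 2)).
  have d0 := dl0 n; have d2 : r < r + dl n / 2 by lra.
  have [||z rz|z Az|h2 h3] := sand n => //; first by lra.
  - by left; rewrite /A/= in_itv/= rz.
  - have [zr|rz] := ltP (r + dl n) z; first by left; exact: ltW.
    by right; rewrite /B/= in_itv/= rz andbT; move: Az; rewrite /A/= in_itv/= andbT.
  by split=> //; apply: h2 => //; exact: ltW.
have vB : fine (nu (B n)) @[n --> \oo] --> (0 : R).
  apply: (vanishing_sets mA (tail_measure_lty triple mA r0 Ar) mB BA) => z.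
  rewrite /A/= in_itv/= andbT -subr_gt0 => rz.
  have := @cvg_harmonic R => /cvgrPdist_lt /(_ _ rz); apply: filterS => n.
  rewrite sub0r normrN ger0_norm ?invr_ge0// => hn.
  by rewrite /B/= in_itv/= => /andP[_ hz]; move: hn; rewrite ltNge lerBlDl hz.
have mH n : measurable (jumps_le t (r + dl n / 2) `\` jumps_le t r).
  apply: measurableD => //; apply: mjumps_le => //.
  by rewrite addr_ge0 ?(ltW r0)// divr_ge0// ltW.
have vP : fine (P x (jumps_le t (r + dl n / 2) `\` jumps_le t r)) @[n --> \oo] --> (0 : R).
  apply: (vanishing_sets measurableT (finP x) mH (fun n => @subsetT _ _)) => w _.
  have [wr|nr] := pselect (jumps_le t r w); first by apply: nearW => n [].
  move: (nr); rewrite /jumps_le/= => /negP; rewrite -ltNge => rw.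
  (* A real level between r and the supremum is needed because the latter could be infinite. *)
  have [z rz zw] : exists2 z, r < z & (z%:E < sup_jump X t w)%E.
    move: rw; case: (sup_jump X t w) => [z|_|]//.
      by rewrite lte_fin => rz; exists ((r + z) / 2); rewrite ?lte_fin; lra.
    by exists (r + 1); [rewrite ltrDl|exact: ltry].
  move: rz; rewrite -subr_gt0 => rz.
  have := @cvg_harmonic R => /cvgrPdist_lt /(_ _ rz); apply: filterS => n.
  rewrite sub0r normrN ger0_norm ?invr_ge0// => hn [+ _].
  rewrite /jumps_le/= leNgt => /negP; apply; apply: le_lt_trans zw.
  rewrite lee_fin; move: (dl0 n); have : dl n < z - r by exact: hn.
  by move: (dl n) => q; lra.
apply: (squeeze_errors (K := K) vB vP) => n; have [h1n h2n] := h1 n.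
  by rewrite (le_trans h1n)// lerDl fine_ge0.
apply: (le_trans h2n).
apply: (damped_le markov x (ltW t0) (ltW k0)) => //.
apply: mjumps_le => //; rewrite addr_ge0 ?(ltW r0)// divr_ge0// ltW//.
Qed.

(** The level c = r - dl / 2 now rises to r while B = ]r - dl, r[ shrinks to the empty set: an atom
    at r lies in A, so jumps of size r are forbidden. *)
Lemma damped_jumps_lt r t k f : 0 < r -> 0 < t -> 0 < k ->
  solution_upto t (truncated_mechanism alpha beta nu `[r, +oo[%classic)
    (fun s => k + fine (nu `[r, +oo[%classic) * s) f ->
  damped P X x t k (jumps_lt t r) = expR (- (x * f t)).
Proof.
move=> r0 t0 k0 sf; pose A : set (measurableTypeR R) := `[r, +oo[%classic.
have mA : measurable A by exact: measurable_itv.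
have r20 : 0 < r / 2 by rewrite divr_gt0.
have Ar : A `<=` `[r / 2, +oo[ by apply: subset_itvr; rewrite bnd_simp; lra.
have [K K0 sandwich] := damped_sandwich mA r20 Ar k0 t0 sf.
have mr := mjumps_lt t0 r0.
(* With n + 2 in the denominator, all levels and all sets B stay above r / 2, where [nu] is
   finite. *)
pose dl (n : nat) : R := r / n.+2%:R.
have dl0 n : 0 < dl n by rewrite divr_gt0.
have dlr n : dl n <= r / 2 by rewrite ler_wpM2l ?(ltW r0)// lef_pV2 ?posrE// ler_nat.
pose B n : set (measurableTypeR R) := `]r - dl n, r[%classic.
have mB n : measurable (B n) by exact: measurable_itv.
pose D : set (measurableTypeR R) := `[r / 2, +oo[%classic.
have mD : measurable D by exact: measurable_itv.
have BD n : B n `<=` D.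
  by move=> z; rewrite /B /D/= !in_itv/= andbT => /andP[h _]; have := dlr n; lra.
have mle n : measurable (jumps_le t (r - dl n)).
  by apply: mjumps_le => //; have := dlr n; lra.
have h1 n : damped P X x t k (jumps_le t (r - dl n)) <=
    expR (- (x * f t)) + K * fine (nu (B n)) /\
    expR (- (x * f t)) - K * fine (nu (B n)) <=
    damped P X x t k (jumps_lt t r).
  have d0 := dl0 n; have dr := dlr n.
  have c0 : 0 <= r - dl n / 2 by lra.
  have [|||z az|z Az|h2 h3] := sandwich (B n) (r - dl n) (r - dl n / 2)
    (r - dl n / 4) (mB n) (@BD n); try by lra.
  - have [rz|zr] := leP r z; first by left; rewrite /A/= in_itv/= rz.
    by right; rewrite /B/= in_itv/= az.
  - by left; move: Az; rewrite /A/= in_itv/= andbT; lra.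
  split; first by apply: h2; lra.
  apply: (le_trans h3); apply: (damped_mono markov x (ltW t0) (ltW k0)) => //.
    exact: mjumps_le.
  by move=> w /= /le_lt_trans; apply; rewrite lte_fin; lra.
have small e : 0 < e -> \forall n \near \oo, dl n < e.
  move=> e0; have := @cvg_harmonic R => /cvgrPdist_lt /(_ _ (divr_gt0 e0 r0)).
  apply: filterS => n; rewrite sub0r normrN ger0_norm ?invr_ge0// => hn.
  rewrite /dl mulrC -ltr_pdivlMr//; apply: le_lt_trans hn.
  by rewrite lef_pV2 ?posrE// ler_nat.
have vB : fine (nu (B n)) @[n --> \oo] --> (0 : R).
  apply: (vanishing_sets mD (tail_measure_lty triple mD r20 (@subset_refl _ _)) mB BD) => z _.
  have [rz|zr] := leP r z.
    by apply: nearW => n; rewrite /B/= in_itv/= => /andP[_]; rewrite ltNge rz.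
  move: zr; rewrite -subr_gt0 => zr; have := small _ zr; apply: filterS => n hn.
  by rewrite /B/= in_itv/= => /andP[hz _]; lra.
have mH n : measurable (jumps_lt t r `\` jumps_le t (r - dl n)) by exact: measurableD.
have vP : fine (P x (jumps_lt t r `\` jumps_le t (r - dl n))) @[n --> \oo] --> (0 : R).
  apply: (vanishing_sets measurableT (finP x) mH (fun n => @subsetT _ _)) => w _.
  have [wr|nr] := pselect (jumps_lt t r w); last by apply: nearW => n [].
  move: wr; rewrite [X in X w](sup_jump_ltE X t0 r0) => -[m _ /= wm].
  have := small _ (dl0 m); apply: filterS => n hn [_]; apply.
  rewrite /jumps_le/=; apply: (le_trans wm); rewrite lee_fin lerD2l lerN2.
  exact: ltW.
apply: (squeeze_errors (K := K) vB vP) => n; have [h1n h2n] := h1 n.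
  apply: (@le_trans _ _ (damped P X x t k (jumps_le t (r - dl n)) +
    fine (P x (jumps_lt t r `\` jumps_le t (r - dl n))))).
    exact: (damped_le markov x (ltW t0) (ltW k0)).
  by rewrite lerD2r.
by rewrite (le_trans h2n)// lerDl fine_ge0.
Qed.

Lemma law_jumps_le r t f : 0 < r -> 0 < t ->
  solution_upto t (truncated_mechanism alpha beta nu `]r, +oo[%classic)
    (fun s => 0 + fine (nu `]r, +oo[%classic) * s) f ->
  P x [set w | (sup_jump X t w <= r%:E)%E] = (expR (- x * f t))%:E.
Proof.
move=> r0 t0 sf; pose A : set (measurableTypeR R) := `]r, +oo[%classic.
have mA : measurable A by exact: measurable_itv.
apply: (law_of_damped mA t0 _ _ sf); first exact: (mjumps_le t0 (ltW r0)).
by move=> k g k0; exact: damped_jumps_le.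
Qed.

Lemma law_jumps_lt r t f : 0 < r -> 0 < t ->
  solution_upto t (truncated_mechanism alpha beta nu `[r, +oo[%classic)
    (fun s => 0 + fine (nu `[r, +oo[%classic) * s) f ->
  P x [set w | (sup_jump X t w < r%:E)%E] = (expR (- x * f t))%:E.
Proof.
move=> r0 t0 sf; pose A : set (measurableTypeR R) := `[r, +oo[%classic.
have mA : measurable A by exact: measurable_itv.
apply: (law_of_damped mA t0 _ _ sf); first exact: (mjumps_lt t0 r0).
by move=> k g k0; exact: damped_jumps_lt.
Qed.

End JumpLaw.

Lemma eq_unique_solution {R : realType} (Phi g g' f : R -> R) :
  (forall t, 0 <= t -> g t = g' t) ->
  is_unique_solution Phi g f -> is_unique_solution Phi g' f.
Proof.
move=> gg; have e h h' f' : (forall t, 0 <= t -> h t = h' t) ->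
    is_solution Phi h f' -> is_solution Phi h' f'.
  by move=> hh [f0 fb fi fe]; split=> // t t0; rewrite -hh ?fe.
move=> [sf uf]; split; first exact: e sf.
by move=> f' sf'; apply: uf; apply: e sf' => t t0; rewrite gg.
Qed.

Theorem theorem3p2 (R : realType) (d : measure_display) (T : measurableType d)
    (P : R -> probability T R) (X : R -> T -> R) (alpha beta : R)
    (nu : {sigma_finite_measure set (measurableTypeR R) -> \bar R})
    (hX : is_CB alpha beta nu P X)
    (hnu : nu `]0, +oo[%classic != 0%E)
    (x : R) (hx : 0 < x) :
  exists u : set R -> R -> R -> R,
    (forall (r : R) (A : set R) (lam : R),
        0 < r -> A = `]r, +oo[%classic \/ A = `[r, +oo[%classic -> 0 <= lam ->
        is_unique_solution (truncated_mechanism alpha beta nu A)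
          (fun t => \int[lebesgue_measure]_(s in `[0, t]) lam)
          (fun t => u A t lam)) /\
    (forall t r : R, 0 < t -> 0 < r ->
        P x [set w | (sup_jump X t w <= r%:E)%E] =
          (expR (- x * u `]r, +oo[%classic t (fine (nu `]r, +oo[%classic))))%:E /\
        P x [set w | (sup_jump X t w < r%:E)%E] =
          (expR (- x * u `[r, +oo[%classic t (fine (nu `[r, +oo[%classic))))%:E).
Proof.
have [triple rX markov [v [sol_v laplace_v]]] := hX.
(* A single [u] is chosen for all A and lam at once, so existence is guarded by measurability of A
   and lam >= 0; elsewhere its value is arbitrary. *)
have ex (A : set R) : exists f : R -> R -> R, forall lam,
    measurable (A : set (measurableTypeR R)) -> 0 <= lam ->
    is_unique_solution (truncated_mechanism alpha beta nu A)
      (fun t => 0 + lam * t) (fun t => f t lam).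
  have exl lam : exists g : R -> R, measurable (A : set (measurableTypeR R)) ->
      0 <= lam -> is_unique_solution (truncated_mechanism alpha beta nu A)
      (fun t => 0 + lam * t) g.
    have [mA|nA] := pselect (measurable (A : set (measurableTypeR R))); last by exists id.
    have [lam0|_] := leP 0 lam; last by exists id.
    have [a rA] := truncated_regular triple mA.
    by have [g sg] := exists_unique_solution rA (lexx 0) lam0; exists g.
  by have [g sg] := choice exl; exists (fun t lam => g lam t).
have [u su] := choice ex; exists u; split.
  move=> r A lam r0 hA lam0.
  have mA : measurable (A : set (measurableTypeR R)).
    by case: hA => ->; exact: measurable_itv.
  apply: eq_unique_solution (su A lam mA lam0) => t t0.
  by rewrite Rintegral_segment_cst// add0r subr0.
move=> t r t0 r0; split.
  have [s _] := su `]r, +oo[%classic (fine (nu `]r, +oo[%classic))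
    (measurable_itv _) (fine_ge0 (measure_ge0 _ _)).
  exact: (law_jumps_le triple rX markov sol_v laplace_v (ltW hx) r0 t0
    (is_solution_upto (ltW t0) s)).
have [s _] := su `[r, +oo[%classic (fine (nu `[r, +oo[%classic))
  (measurable_itv _) (fine_ge0 (measure_ge0 _ _)).
exact: (law_jumps_lt triple rX markov sol_v laplace_v (ltW hx) r0 t0
  (is_solution_upto (ltW t0) s)).
Qed.
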